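(* Let $\Gamma$ be a discrete group and let $\mathcal{G}$ be a $\Gamma$-graded locally compact étale groupoid, with grading $\Phi\colon\mathcal{G}\to\Gamma$. For a fixed $x\in\mathcal{G}^{(0)}$, assume that $\Phi$ is injective on $\mathcal{G}^x_x$ and that there is a family $\{U_g\}_{g\in\mathcal{G}^x_x}$ of (open) bisections of $\mathcal{G}$ such that: (1) $g\in U_g$ and $\Phi(U_g)=\{\Phi(g)\}$ for all $g\in\mathcal{G}^x_x$; (2) $U_x=\mathcal{G}^{(0)}$ and, for all $g\in\mathcal{G}^x_x$, $U_{g^{-1}}=U_g^{-1}$; (3) if $g_1,\dots,g_n\in\mathcal{G}^x_x$ and $g_1\cdots g_n=x$, then $U_{g_1}U_{g_2}\cdots U_{g_n}\subset\mathcal{G}^{(0)}$. Then $\lVert\cdot\rVert_e=\lVert\cdot\rVert_r$ on $\mathbb{C}\mathcal{G}^x_x$.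
   Context: Locally compact étale groupoids (not necessarily Hausdorff): groupoids $\mathcal{G}$, with unit space $\mathcal{G}^{(0)}$, range $r(g)=gg^{-1}$ and source $s(g)=g^{-1}g$, endowed with a topology such that the groupoid operations are continuous, $\mathcal{G}^{(0)}$ is locally compact Hausdorff in the relative topology, and $r$ is a local homeomorphism. Put $\mathcal{G}_x=s^{-1}(x)$, $\mathcal{G}^x=r^{-1}(x)$, $\mathcal{G}^x_x=\mathcal{G}^x\cap\mathcal{G}_x$ (the isotropy group, a discrete group with identity $x$). An (open) bisection is an open set $W\subset\mathcal{G}$ such that $r|_W\colon W\to r(W)$ and $s|_W\colon W\to s(W)$ are homeomorphisms onto open sets. For subsets $U,V\subset\mathcal{G}$, $UV$ is the set of all products of composable pairs $(u,v)\in U\times V$, and $U^{-1}=\{u^{-1}:u\in U\}$. Algebras: $C_c(\mathcal{G})$ is the linear span of the spaces $C_c(U)$ of continuous compactly supported functions on open Hausdorff sets $U\subset\mathcal{G}$, extended by zero to $\mathcal{G}$. It is a $*$-algebra with $(f_1*f_2)(g)=\sum_{h\in\mathcal{G}^{r(g)}}f_1(h)f_2(h^{-1}g)$ and $f^*(g)=\overline{f(g^{-1})}$. $C^*(\mathcal{G})$ is its completion in the norm $\sup_\rho\lVert\rho(f)\rVert$ over all representations by bounded operators on Hilbert spaces. $C^*_r(\mathcal{G})$ is its completion in the reduced norm $\lVert f\rVert_r=\sup_{y\in\mathcal{G}^{(0)}}\lVert\rho_y(f)\rVert$, where $\rho_y(f)\delta_g=\sum_{h\in\mathcal{G}_{r(g)}}f(h)\delta_{hg}$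 on $\ell^2(\mathcal{G}_y)$. A representation of $C^*(\mathcal{G})$ factors through $C^*_r(\mathcal{G})$ if it vanishes on the kernel of the canonical surjection $C^*(\mathcal{G})\to C^*_r(\mathcal{G})$. Induction: let $\rho\colon C^*(\mathcal{G}^x_x)\to B(H)$ be a representation of the full group C$^*$-algebra with canonical unitaries $u_g$. Let $L$ be the Hilbert space of functions $\xi\colon\mathcal{G}_x\to H$ with $\xi(gh)=\rho(u_h^* )\xi(g)$ for $g\in\mathcal{G}_x$, $h\in\mathcal{G}^x_x$, and $\sum_{g\in\mathcal{G}_x/\mathcal{G}^x_x}\lVert\xi(g)\rVert^2<\infty$. Then $\operatorname{Ind}\rho\colon C^*(\mathcal{G})\to B(L)$ is given by $((\operatorname{Ind}\rho)(f)\xi)(g)=\sum_{h\in\mathcal{G}^{r(g)}}f(h)\xi(h^{-1}g)$ for $f\in C_c(\mathcal{G})$. Norms on the group algebra $\mathbb{C}\mathcal{G}^x_x=C_c(\mathcal{G}^x_x)$: $\lVert h\rVert_e=\sup_\rho\lVert\rho(h)\rVert$, the supremum over all representations $\rho$ of $C^*(\mathcal{G}^x_x)$ such that $\operatorname{Ind}\rho$ factors through $C^*_r(\mathcal{G})$ (this is a C$^*$-norm); $\lVert\cdot\rVert_r$ on $\mathbb{C}\mathcal{G}^x_x$ is the norm of the reduced group C$^*$-algebra $C^*_r(\mathcal{G}^x_x)$. Grading: a $\Gamma$-grading on $\mathcal{G}$ is a continuous homomorphism $\Phi\colon\mathcal{G}\to\Gamma$, with $\Gamma$ discrete. *)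

(* Defs.v *)
From HB Require Import structures.
From mathcomp Require Import all_boot all_order all_algebra.
From mathcomp Require Import sesquilinear.
From mathcomp Require Import all_classical all_reals all_analysis.
From mathcomp.real_closed Require Import complex.

Set Implicit Arguments.
Unset Strict Implicit.
Unset Printing Implicit Defensive.

Import Order.TTheory GRing.Theory Num.Theory.
Import numFieldNormedType.Exports.

Local Open Scope classical_set_scope.
Local Open Scope ring_scope.

(* Groupoids in the sense of Hahn and Renault: a partial product, here a total
   function whose values off the composable pairs are irrelevant. These axioms
   imply that (g, h) is composable iff g^-1 g = h h^-1. *)
Record groupoid (G : Type) := Groupoid {
  gcomp : G -> G -> Prop;
  gmul : G -> G -> G;
  ginv : G -> G;
  ginvK : forall g, ginv (ginv g) = g;
  gmulA : forall g h k, gcomp g h -> gcomp h k ->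
    [/\ gcomp (gmul g h) k, gcomp g (gmul h k)
      & gmul (gmul g h) k = gmul g (gmul h k)];
  gcompVg : forall g, gcomp (ginv g) g;
  gcompgV : forall g, gcomp g (ginv g);
  gmulKg : forall g h, gcomp g h -> gmul (ginv g) (gmul g h) = h;
  gmulgK : forall g h, gcomp g h -> gmul (gmul g h) (ginv h) = g
}.

Section GroupoidSets.
Variables (G : Type) (m : groupoid G).

Definition grange (g : G) : G := gmul m g (ginv m g).
Definition gsource (g : G) : G := gmul m (ginv m g) g.
Definition gunits : set G := [set u | exists g, u = grange g].
Definition gfiber_s (x : G) : set G := [set g | gsource g = x].
Definition gfiber_r (x : G) : set G := [set g | grange g = x].
Definition isotropy (x : G) : set G := gfiber_r x `&` gfiber_s x.

Definition gsetmul (U V : set G) : set G :=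
  [set k | exists u v, [/\ U u, V v, gcomp m u v & k = gmul m u v]].
Definition gsetinv (U : set G) : set G := ginv m @` U.

(* Products of the nonempty family g, gs_0, gs_1, ... *)
Definition gprod (g : G) (gs : seq G) : G := foldl (gmul m) g gs.
Definition gsetprod (U : G -> set G) (g : G) (gs : seq G) : set G :=
  foldl (fun W h => gsetmul W (U h)) (U g) gs.

End GroupoidSets.

Section Etale.
Variables (G : topologicalType) (m : groupoid G).

Definition open_in (Y B : set G) : Prop := exists2 O, open O & B = O `&` Y.

Definition homeo_on (f : G -> G) (W : set G) : Prop :=
  {within W, continuous f} /\
  exists f' : G -> G,
    (forall w, W w -> f' (f w) = w) /\ {within f @` W, continuous f'}.

Definition local_homeo_to (f : G -> G) (Y : set G) : Prop :=
  forall g, exists W,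
    [/\ open W, W g, open_in Y (f @` W) & homeo_on f W].

Record lc_etale_groupoid : Prop := LcEtaleGroupoid {
  etale_inv : continuous (ginv m);
  etale_mul : {within [set p : G * G | gcomp m p.1 p.2],
                continuous (fun p : G * G => gmul m p.1 p.2)};
  etale_units_lc : locally_compact [set: set_type (gunits m)];
  etale_units_hausdorff : hausdorff_space (set_type (gunits m));
  etale_range : local_homeo_to (grange m) (gunits m)
}.

Definition bisection (W : set G) : Prop :=
  [/\ open W,
      open_in (gunits m) (grange m @` W), homeo_on (grange m) W,
      open_in (gunits m) (gsource m @` W) & homeo_on (gsource m) W].

Definition grading (Gam : groupType) (Phi : G -> Gam) : Prop :=
  continuous (Phi : G -> discrete_topology Gam) /\
  forall g h, gcomp m g h -> Phi (gmul m g h) = (Phi g * Phi h)%g.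

End Etale.

Record hilbert (R : realType) := Hilbert {
  hcarrier :> lmodType R[i];
  hdot : {dot hcarrier for Num.conj};
  hnorm := fun v : hcarrier => Num.sqrt (complex.Re (hdot v v)) : R;
  hcomplete : forall v : nat -> hcarrier,
    (forall e : R, 0 < e -> exists N, forall p q,
       (N <= p)%N -> (N <= q)%N -> hnorm (v p - v q) < e) ->
    exists l, forall e : R, 0 < e -> exists N, forall p,
       (N <= p)%N -> hnorm (v p - l) < e
}.

Section OperatorNorms.
Variable R : realType.

(* Norm of an operator T on the normed space {v in D | N v < +oo}. *)
Definition opnorm (V : Type) (D : set V) (N : V -> \bar R) (T : V -> V) :
    \bar R :=
  ereal_sup [set N (T v) | v in [set v | D v /\ (N v <= 1)%E]].

Definition hopnorm (H : hilbert R) (T : H -> H) : \bar R :=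
  opnorm [set: H] (fun v => (hnorm v)%:E) T.

End OperatorNorms.

Section StarAlgebras.
(* A *-algebra is given as a subspace A of V with its product and involution. *)
Variables (R : realType) (V : lmodType R[i]) (A : set V).
Variables (mul : V -> V -> V) (star : V -> V).

Record star_rep (H : hilbert R) (pi : V -> H -> H) : Prop := StarRep {
  rep_oplinear : forall a, A a -> forall c u v,
    pi a (c *: u + v) = c *: pi a u + pi a v;
  rep_bounded : forall a, A a ->
    exists M : R, forall v, hnorm (pi a v) <= M * hnorm v;
  rep_linear : forall c a b, A a -> A b -> forall v,
    pi (c *: a + b) v = c *: pi a v + pi b v;
  rep_mul : forall a b, A a -> A b -> forall v, pi (mul a b) v = pi a (pi b v);
  rep_star : forall a, A a -> forall u v,
    hdot H (pi a u) v = hdot H u (pi (star a) v)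
}.

Definition full_norm (a : V) : \bar R :=
  ereal_sup [set r | exists (H : hilbert R) (pi : V -> H -> H),
                       star_rep pi /\ r = hopnorm (pi a)].

(* Elements of the completion of A in full_norm are represented by the Cauchy
   sequences of A. *)
Definition full_cauchy (a : nat -> V) : Prop :=
  (forall n, A (a n)) /\
  forall e : R, 0 < e -> exists N, forall p q,
    (N <= p)%N -> (N <= q)%N -> (full_norm (a p - a q) <= e%:E)%E.

End StarAlgebras.

Section GroupoidAlgebras.
Variables (R : realType) (G : topologicalType) (m : groupoid G).
Local Notation C := R[i].

Definition Cc_on (U : set G) (f : G -> C) : Prop :=
  [/\ {within U, continuous (f : G -> C^o)},
      (forall g, ~ U g -> f g = 0)
    & compact (U `&` closure [set g | f g != 0])].

Definition Cc (f : G -> C) : Prop :=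
  exists n (c : 'I_n -> C) (F : 'I_n -> G -> C),
    (forall i, exists U,
       [/\ open U, hausdorff_space (set_type U) & Cc_on U (F i)]) /\
    f = \sum_(i < n) c i *: F i.

Definition gconv (f1 f2 : G -> C) : G -> C := fun g =>
  \sum_(h \in gfiber_r m (grange m g)) f1 h * f2 (gmul m (ginv m h) g).

Definition fstar (f : G -> C) : G -> C := fun g => (f (ginv m g))^*.

Definition gdelta (g : G) : G -> C := \1_[set g].

Definition l2norm (S : set G) (xi : G -> C) : \bar R :=
  ((\esum_(g in S) ((complex.Re `|xi g|) ^+ 2)%:E) `^ 2^-1)%E.

(* l^2(S) consists of functions on G that vanish off S. *)
Definition l2space (S : set G) : set (G -> C) :=
  [set xi | forall g, ~ S g -> xi g = 0].

(* The value of rho_y(f) at the basis vector delta_g, for g in G_y. *)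
Definition regular_col (f : G -> C) (g : G) : G -> C :=
  \sum_(h \in gfiber_s m (grange m g)) f h *: gdelta (gmul m h g).

(* Linear and continuous extension of regular_col to l^2(S). For a given k the
   sum below is finite when f is in C_c(G). *)
Definition regular (S : set G) (f : G -> C) (xi : G -> C) : G -> C := fun k =>
  \sum_(g \in S) xi g * regular_col f g k.

Definition regular_norm (S : set G) (f : G -> C) : \bar R :=
  opnorm (l2space S) (l2norm S) (regular S f).

Definition reduced_norm (f : G -> C) : \bar R :=
  ereal_sup [set regular_norm (gfiber_s m y) f | y in gunits m].

Definition Cstar_cauchy (a : nat -> G -> C) : Prop :=
  full_cauchy Cc gconv fstar a.

(* The element of C^*(G) represented by a Cauchy sequence a lies in the kernel
   of C^*(G) -> C^*_r(G). *)
Definition in_reduced_kernel (a : nat -> G -> C) : Prop :=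
  Cstar_cauchy a /\ (fun n => reduced_norm (a n)) @ \oo --> 0%E.

(* [opn f] is the operator norm of the image of f in C_c(G) under a
   representation; the image in B(L) of the element represented by a is the norm
   limit of the images of the a n, so it is zero iff their norms tend to 0. *)
Definition factors_through_reduced (opn : (G -> C) -> \bar R) : Prop :=
  forall a, in_reduced_kernel a -> (fun n => opn (a n)) @ \oo --> 0%E.

Section Isotropy.
Variable x : G.

(* The group algebra of the isotropy group, as functions on G vanishing off it;
   on such functions gconv and fstar are the operations of the group algebra. *)
Definition group_algebra (h : G -> C) : Prop :=
  finite_set [set g | h g != 0] /\ [set g | h g != 0] `<=` isotropy m x.

(* Representations of the full group C*-algebra, given on its dense *-subalgebra
   (they extend uniquely, by the definition of the full norm). The canonical
   unitary u_g is gdelta g. *)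
Definition isotropy_rep (H : hilbert R) (rho : (G -> C) -> H -> H) : Prop :=
  star_rep group_algebra gconv fstar rho.

Section Induction.
Variables (H : hilbert R) (rho : (G -> C) -> H -> H).

Definition isotropy_cosets : set (set G) :=
  [set [set gmul m g h | h in isotropy m x] | g in gfiber_s m x].

(* Functions on G_x, extended by 0 to G. *)
Definition ind_space : set (G -> H) :=
  [set xi | (forall g, ~ gfiber_s m x g -> xi g = 0) /\
            forall g h, gfiber_s m x g -> isotropy m x h ->
              xi (gmul m g h) = rho (fstar (gdelta h)) (xi g)].

(* On ind_space the norm of xi is constant on cosets when rho is a
   representation, so the chosen point of each coset is irrelevant. *)
Definition ind_l2norm (xi : G -> H) : \bar R :=
  ((\esum_(c in isotropy_cosets) ((hnorm (xi (xget x c))) ^+ 2)%:E)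
     `^ 2^-1)%E.

Definition Ind (f : G -> C) (xi : G -> H) : G -> H := fun g =>
  \sum_(h \in gfiber_r m (grange m g)) f h *: xi (gmul m (ginv m h) g).

Definition Ind_norm (f : G -> C) : \bar R :=
  opnorm ind_space ind_l2norm (Ind f).

End Induction.

Definition norm_e (h : G -> C) : \bar R :=
  ereal_sup [set r | exists (H : hilbert R) (rho : (G -> C) -> H -> H),
    [/\ isotropy_rep rho, factors_through_reduced (Ind_norm rho)
      & r = hopnorm (rho h)]].

Definition norm_r (h : G -> C) : \bar R := regular_norm (isotropy m x) h.

End Isotropy.

End GroupoidAlgebras.

(* Main.v *)
(* [norm_r <= norm_e]: the left regular representation lambda of the isotropy group
   is admissible, since a vector of Ind lambda untwists to a vector of l^2(G_x) on
   which f acts by the regular representation of G.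

   [norm_e <= norm_r]: let k be the reduced norm of h and f the sum over t of the
   functions h(t) q(s(u)), u in U_t, with q a bump function at x. Calling g, g' in G_y
   equivalent when g g'^-1 lies in a product of the U_t, the hypotheses make Phi
   separate the elements of a class and identify the class with a subset of the
   isotropy group, on which f acts as h up to the contraction q; so f has norm at
   most k in every regular representation. If Ind rho factors through C^*_r(G), then
   f has norm at most k in Ind rho, and Ind rho restricts on the isotropy group to
   rho, f acting there as h. The completion is never formed: a norm bound in the
   reduced algebra is transferred through a Cauchy sequence of C_c(G) converging to
   a cutoff of (f^* f)^2 and tending to zero in the reduced norm, which an algebraic
   iteration for the modulus of an operator provides. *)

Require Import Defs.
From HB Require Import structures.
From mathcomp Require Import all_boot all_order all_algebra.
From mathcomp Require Import finmap.
From mathcomp Require Import all_classical all_reals all_analysis.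
From mathcomp.real_closed Require Import complex.
From mathcomp Require Import ring lra.

Set Implicit Arguments.
Unset Strict Implicit.
Unset Printing Implicit Defensive.

Import Order.TTheory GRing.Theory Num.Theory.
Import numFieldNormedType.Exports.

Local Open Scope classical_set_scope.
Local Open Scope ring_scope.

Reserved Notation "a ** b" (at level 40, left associativity).
Local Notation "r %:C" := (real_complex _ r) (at level 1, format "r %:C").

(** * Cutoffs of positive operators *)

(** The function [f] itself is not in the kernel of $C^*(G) \to C^*_r(G)$; the kernel element that
    detects a norm above $k' > k$ is a function of $f^* f$ vanishing on $[0, k'^2]$. Functional
    calculus would produce it in the completion. Having it as an explicit Cauchy sequence of
    compactly supported functions forces three choices. The modulus is reached by a polynomial
    iteration whose increments are dominated by those of a scalar sequence, so that one Cauchy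
    estimate holds in all representations at once. The algebra may have no unit, so the cutoff
    carries a factor $(f^* f)^2$ which absorbs the constants. The iteration starts from a
    contraction, so [f] needs a bound valid in every representation; the bump function is therefore
    taken of the form $q = 2b/(1+b^2)$, for which $1 - q^2$ is the square of an explicit function.
    The regular representations and the [Ind rho] are treated by one construction, on vectors
    supported on finitely many cosets, where adjunctions and norms are finite sums. *)

Section FormSpace.
Variables (R : realType) (V : lmodType R[i]) (D : set V) (form : V -> V -> R).

(** To be read as the real part of an inner product; norms, Cauchy-Schwarz and adjoints carry over
    to it. The vectors are a subset [D] so that finitely supported functions inside [G -> V]
    qualify, and the form is only asked to be semidefinite. *)
Record form_space : Prop := FormSpace {
  form_dom0 : D 0;
  form_domL : forall (c : R[i]) u v, D u -> D v -> D (c *: u + v);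
  formPl : forall (c : R) u v w, D u -> D v -> D w ->
    form (c%:C *: u + v) w = c * form u w + form v w;
  formC : forall u v, D u -> D v -> form u v = form v u;
  form_ge0 : forall u, D u -> 0 <= form u u
}.

Definition fnorm (v : V) : R := Num.sqrt (form v v).

Hypothesis fs : form_space.

Lemma form_domZ (c : R[i]) u : D u -> D (c *: u).
Proof. by move=> Du; rewrite -[_ *: _]addr0; apply: (form_domL fs) => //; exact: form_dom0. Qed.

Lemma form_domD u v : D u -> D v -> D (u + v).
Proof. by move=> Du Dv; rewrite -[u]scale1r; exact: (form_domL fs). Qed.

Lemma form_domB u v : D u -> D v -> D (u - v).
Proof. by move=> Du Dv; rewrite addrC -scaleN1r; exact: (form_domL fs). Qed.

Lemma form0l w : D w -> form 0 w = 0.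
Proof.
move=> Dw; have D0 := form_dom0 fs.
have := formPl fs 1 D0 D0 Dw; rewrite scaler0 addr0 mul1r => h.
by apply: (addrI (form 0 w)); rewrite addr0 -h.
Qed.

Lemma formDl u v w : D u -> D v -> D w -> form (u + v) w = form u w + form v w.
Proof. by move=> Du Dv Dw; have := formPl fs 1 Du Dv Dw; rewrite scale1r mul1r. Qed.

Lemma formZl (c : R) u w : D u -> D w -> form (c%:C *: u) w = c * form u w.
Proof.
move=> Du Dw; have := formPl fs c Du (form_dom0 fs) Dw.
by rewrite addr0 form0l// addr0.
Qed.

Lemma formBl u v w : D u -> D v -> D w -> form (u - v) w = form u w - form v w.
Proof.
move=> Du Dv Dw; have := formPl fs (-1) Dv Du Dw.
by rewrite rmorphN rmorph1 scaleN1r addrC => ->; rewrite mulN1r addrC.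
Qed.

Lemma formDr u v w : D u -> D v -> D w -> form w (u + v) = form w u + form w v.
Proof.
move=> Du Dv Dw; rewrite !(formC fs Dw)//; first exact: formDl.
exact: form_domD.
Qed.

Lemma formBr u v w : D u -> D v -> D w -> form w (u - v) = form w u - form w v.
Proof.
move=> Du Dv Dw; rewrite !(formC fs Dw)//; first exact: formBl.
exact: form_domB.
Qed.

Lemma formZr (c : R) u w : D u -> D w -> form w (c%:C *: u) = c * form w u.
Proof.
move=> Du Dw; rewrite !(formC fs Dw)//; first exact: formZl.
exact: form_domZ.
Qed.

Lemma fnorm_ge0 v : 0 <= fnorm v. Proof. exact: sqrtr_ge0. Qed.

Lemma sqr_fnorm v : D v -> fnorm v ^+ 2 = form v v.
Proof. by move=> Dv; rewrite sqr_sqrtr//; exact: (form_ge0 fs). Qed.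

Lemma fnorm_le v k : D v -> 0 <= k -> (fnorm v <= k) = (form v v <= k ^+ 2).
Proof.
move=> Dv k0; rewrite -sqr_fnorm//.
by rewrite ler_sqr// nnegrE// fnorm_ge0.
Qed.

Lemma form_cauchy_schwarz u v : D u -> D v -> form u v <= fnorm u * fnorm v.
Proof.
move=> Du Dv.
have h t : 0 <= form u u + 2 * t * form u v + t ^+ 2 * form v v.
  have Dtv := form_domZ t%:C Dv.
  have := form_ge0 fs (form_domD Du Dtv).
  rewrite formDl// ?formDr// ?formDr ?formZl ?formZr//; last exact: form_domD.
  by rewrite (formC fs Dv Du) => /le_trans; apply; rewrite le_eqVlt; apply/orP; left; apply/eqP; ring.
have a0 := form_ge0 fs Du; have c0 := form_ge0 fs Dv.
apply: le_trans (ler_norm _) _.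
rewrite -ler_sqr ?nnegrE ?mulr_ge0 ?fnorm_ge0// exprMn !sqr_fnorm// real_normK ?num_real//.
have [c_0|c_n0] := eqVneq (form v v) 0.
  have [->|b_n0] := eqVneq (form u v) 0; first by rewrite expr0n mulr_ge0.
  (* The form may be degenerate: with [form v v = 0] the quadratic in [t] is affine, and this [t]
     gives it the value -1. *)
  have := h (- (form u u + 1) / (2 * form u v)); rewrite c_0 mulr0 addr0.
  have -> : 2 * (- (form u u + 1) / (2 * form u v)) * form u v = - (form u u + 1).
    by field.
  by lra.
have := h (- form u v / form v v).
have -> : form u u + 2 * (- form u v / form v v) * form u v +
   (- form u v / form v v) ^+ 2 * form v v = form u u - form u v ^+ 2 / form v v by field.
have cp : 0 < form v v by rewrite lt_def c_n0.
by rewrite subr_ge0 ler_pdivrMr.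
Qed.

Lemma fnormD u v : D u -> D v -> fnorm (u + v) <= fnorm u + fnorm v.
Proof.
move=> Du Dv; have Duv := form_domD Du Dv.
rewrite fnorm_le ?addr_ge0 ?fnorm_ge0// formDl// !formDr//.
rewrite (formC fs Dv Du) sqrrD !sqr_fnorm//.
have := form_cauchy_schwarz Du Dv; lra.
Qed.

Lemma fnormZ (c : R) v : D v -> fnorm (c%:C *: v) = `|c| * fnorm v.
Proof.
move=> Dv; have Dc := form_domZ c%:C Dv.
by rewrite /fnorm formZl// formZr// mulrA -expr2 sqrtrM ?sqr_ge0// sqrtr_sqr.
Qed.

Lemma fnormN v : D v -> fnorm (- v) = fnorm v.
Proof.
by move=> Dv; have := fnormZ (-1) Dv; rewrite rmorphN rmorph1 scaleN1r normrN1 mul1r.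
Qed.

Lemma fnormBC u v : D u -> D v -> fnorm (u - v) = fnorm (v - u).
Proof. by move=> Du Dv; rewrite -fnormN ?opprB//; exact: form_domB. Qed.

Lemma fnorm0 : fnorm 0 = 0.
Proof. by rewrite /fnorm form0l ?sqrtr0//; exact: form_dom0. Qed.

Definition oplin (T : V -> V) :=
  (forall v, D v -> D (T v)) /\
  (forall (c : R[i]) u v, D u -> D v -> T (c *: u + v) = c *: T u + T v).

Definition opbound (T : V -> V) (k : R) :=
  forall v, D v -> fnorm (T v) <= k * fnorm v.

Lemma oplinB T u v : oplin T -> D u -> D v -> T (u - v) = T u - T v.
Proof.
by move=> [_ TL] Du Dv; rewrite addrC -scaleN1r TL// scaleN1r addrC.
Qed.

Lemma oplinZ T c v : oplin T -> D v -> T (c *: v) = c *: T v.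
Proof.
move=> [_ TL] Dv; have D0 := form_dom0 fs.
have T0 : T 0 = 0.
  have := TL 1 0 0 D0 D0; rewrite scale1r addr0 scale1r => h.
  by apply: (addrI (T 0)); rewrite addr0 -h.
by rewrite -[c *: v]addr0 TL// T0 addr0.
Qed.

Section Contraction.
Variables (T : V -> V) (c : R).
Hypotheses (TL : oplin T) (c0 : 0 <= c) (c1 : c <= 1).

Definition shift_op v := T v - c%:C *: v.
Definition defect_op v := v - shift_op (shift_op v).
(* Visser's iteration: [visser_op n] converges to 1 - |S| with S = T - c. *)
Fixpoint visser_op n v :=
  if n is n'.+1 then (2^-1)%:C *: (defect_op v + visser_op n' (visser_op n' v))
  else 0.
(** The same iteration with the scalar 1 in place of [defect_op]. It dominates the norms of the
    operators and of their increments, whatever the space they act on. *)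
Fixpoint visser_bound n : R :=
  if n is n'.+1 then 2^-1 * (1 + visser_bound n' ^+ 2) else 0.

Lemma oplin_shift : oplin shift_op.
Proof.
have [TD TLi] := TL; split=> [v Dv|a u v Du Dv]; rewrite /shift_op.
  by apply: form_domB; [exact: TD|exact: form_domZ].
by rewrite TLi// !scalerBr scalerDr !scalerA mulrC opprD addrACA.
Qed.

Lemma oplin_defect : oplin defect_op.
Proof.
have [SD SL] := oplin_shift; split=> [v Dv|a u v Du Dv]; rewrite /defect_op.
  by apply: form_domB => //; do 2 apply SD.
by rewrite (SL _ _ _ Du Dv) (SL _ _ _ (SD _ Du) (SD _ Dv)) (scalerBr a u) opprD addrACA.
Qed.

Lemma oplin_visser n : oplin (visser_op n).
Proof.
have [ED EL] := oplin_defect.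
elim: n => [|n [XD XL]]; split=> [v Dv|a u v Du Dv] /=; rewrite ?scaler0 ?addr0//.
- exact: form_dom0.
- by apply: form_domZ; apply: form_domD; [exact: ED|do 2 apply XD].
- rewrite (EL _ _ _ Du Dv) (XL _ _ _ Du Dv) (XL _ _ _ (XD _ Du) (XD _ Dv)).
  have comb (h : R[i]) (p q r s : V) :
      h *: (a *: p + q + (a *: r + s)) = a *: (h *: (p + r)) + h *: (q + s).
    by rewrite addrACA -scalerDr (scalerDr h (a *: _)) !scalerA mulrC.
  exact: comb.
Qed.

Lemma visser_bound_itv n : 0 <= visser_bound n <= 1.
Proof.
elim: n => [|n /andP[x0 x1]] /=; first by rewrite lexx ler01.
have h : visser_bound n ^+ 2 <= 1 by rewrite expr_le1.
have h0 := sqr_ge0 (visser_bound n).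
by apply/andP; split; lra.
Qed.

Lemma visser_boundS n : visser_bound n <= visser_bound n.+1.
Proof.
have /andP[x0 x1] := visser_bound_itv n; rewrite /=.
by have := sqr_ge0 (1 - visser_bound n); rewrite sqrrB expr1n mul1r; lra.
Qed.

Hypothesis Ebound : opbound defect_op 1.

Lemma visser_opbound n : opbound (visser_op n) (visser_bound n).
Proof.
have [ED _] := oplin_defect.
elim: n => [|n IH] v Dv /=; first by rewrite fnorm0 mul0r.
have [XD XL] := oplin_visser n.
have /andP[x0 x1] := visser_bound_itv n.
rewrite fnormZ; last by apply: form_domD; [exact: ED|do 2 apply XD].
rewrite ger0_norm// -mulrA ler_pM2l// mulrDl.
apply: le_trans (fnormD _ _) _; [exact: ED|by do 2 apply XD|].
apply: lerD; first exact: Ebound.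
apply: le_trans (IH _ (XD _ Dv)) _.
by rewrite expr2 -mulrA ler_wpM2l//; exact: IH.
Qed.

(* The identity x^2 - y^2 = x (x - y) + (x - y) y avoids any commutation. *)
Lemma visser_op_step n : opbound (fun v => visser_op n.+1 v - visser_op n v)
  (visser_bound n.+1 - visser_bound n).
Proof.
elim: n => [|n IH] v Dv.
  by have := visser_opbound 1 Dv; rewrite /= subr0 subr0.
have [XD XL] := oplin_visser n.
have [YD YL] := oplin_visser n.+1.
have [ED _] := oplin_defect.
set X := visser_op n in IH XD XL *; set Y := visser_op n.+1 in IH YD YL *.
have -> : visser_op n.+2 v - Y v = (2^-1)%:C *: (Y (Y v - X v) + (Y (X v) - X (X v))).
  rewrite (oplinB (conj YD YL) (YD _ Dv) (XD _ Dv)) addrA subrK.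
  have -> : visser_op n.+2 v = (2^-1)%:C *: (defect_op v + Y (Y v)) by [].
  have -> : Y v = (2^-1)%:C *: (defect_op v + X (X v)) by [].
  by rewrite -scalerBr opprD addrACA subrr add0r.
have DX := XD _ Dv; have DY := YD _ Dv.
have D1 : D (Y v - X v) by exact: form_domB.
rewrite fnormZ; last first.
  by apply: form_domD; [exact: YD|apply: form_domB; [exact: YD|exact: XD]].
have /andP[x0 x1] := visser_bound_itv n.
have /andP[y0 y1] := visser_bound_itv n.+1.
have -> : visser_bound n.+2 - visser_bound n.+1 =
    2^-1 * ((visser_bound n.+1 - visser_bound n) * (visser_bound n.+1 + visser_bound n)).
  rewrite -[visser_bound n.+2]/(2^-1 * (1 + visser_bound n.+1 ^+ 2)).
  by rewrite -[X in _ - X]/(2^-1 * (1 + visser_bound n ^+ 2)); ring.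
rewrite ger0_norm// -mulrA ler_pM2l// mulrDr mulrDl.
apply: le_trans (fnormD _ _) _; [exact: YD|by apply: form_domB; [exact: YD|exact: XD]|].
have d0 := visser_boundS n; rewrite -subr_ge0 in d0.
apply: lerD.
  apply: le_trans (visser_opbound n.+1 D1) _.
  by rewrite [leRHS]mulrAC [leRHS]mulrC ler_wpM2l//; exact: IH.
apply: le_trans (IH _ DX) _.
by rewrite -mulrA ler_wpM2l//; exact: visser_opbound.
Qed.

Lemma visser_op_dist n p : (n <= p)%N -> opbound (fun v => visser_op p v - visser_op n v)
  (visser_bound p - visser_bound n).
Proof.
move=> np v Dv; rewrite -(subnK np); elim: (p - n)%N => [|k IH].
  by rewrite add0n !subrr fnorm0 mul0r.
rewrite addSn.
have [D1 _] := oplin_visser (k + n).+1; have [D2 _] := oplin_visser (k + n).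
have [D3 _] := oplin_visser n.
rewrite -(subrKA (visser_op (k + n) v)) -[visser_bound _ - _](subrKA (visser_bound (k + n))) mulrDl.
apply: le_trans (fnormD _ _) _; [apply: form_domB; [exact: D1|exact: D2]| apply: form_domB; [exact: D2|exact: D3]|].
by apply: lerD => //; exact: visser_op_step.
Qed.

End Contraction.

Section SelfAdjoint.
Variables (B : V -> V) (c : R).
Hypotheses (BL : oplin B) (c0 : 0 <= c) (c1 : c <= 1).
Hypothesis Bsym : forall u v, D u -> D v -> form (B u) v = form u (B v).
Hypothesis B1 : opbound B 1.
Let T v := B (B v).

Lemma oplin_sqr : oplin T.
Proof.
have [BD Bl] := BL; split=> [v Dv|a u v Du Dv]; rewrite /T; first by do 2 apply BD.
by rewrite (Bl _ _ _ Du Dv) (Bl _ _ _ (BD _ Du) (BD _ Dv)).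
Qed.

Lemma form_sqr v : D v -> form (T v) v = fnorm (B v) ^+ 2.
Proof. by move=> Dv; have [BD _] := BL; rewrite /T Bsym// ?sqr_fnorm//; exact: BD. Qed.

(** Because 0 <= T <= 1 and 0 <= c <= 1. In elementary terms, |Tv| <= |Bv| <= |v| reduces |Tv -
    cv|^2 to (1 - 2c)|Bv|^2 + c^2 |v|^2, and the sign of 1 - 2c decides which bound on |Bv| to
    use. *)
Lemma opbound_shift_sqr : opbound (shift_op T c) 1.
Proof.
have [BD _] := BL; have [TD _] := oplin_sqr.
move=> v Dv; have DB := BD _ Dv; have DT := TD _ Dv; have Dc := form_domZ c%:C Dv.
rewrite mul1r fnorm_le ?fnorm_ge0//; last exact: form_domB.
rewrite /shift_op formBl ?formBr//; last exact: form_domB.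
rewrite !formZl// !formZr// -!sqr_fnorm// (formC fs Dv DT) form_sqr//.
have h1 : fnorm (T v) ^+ 2 <= fnorm (B v) ^+ 2.
  by rewrite ler_sqr ?nnegrE ?fnorm_ge0//; have := B1 DB; rewrite mul1r.
have h2 : fnorm (B v) ^+ 2 <= fnorm v ^+ 2.
  by rewrite ler_sqr ?nnegrE ?fnorm_ge0//; have := B1 Dv; rewrite mul1r.
have h3 := sqr_ge0 (fnorm (B v)).
move: (fnorm (T v) ^+ 2) (fnorm (B v) ^+ 2) (fnorm v ^+ 2) h1 h2 h3 => t b a h1 h2 h3.
have a0 : 0 <= a by exact: le_trans h2.
have h4 : c ^+ 2 * a <= a by rewrite ler_piMl ?expr_le1.
have [c2|c2] := leP (2 * c) 1.
  have h5 : 0 <= (1 - 2 * c) * (a - b) by rewrite mulr_ge0 ?subr_ge0.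
  have h6 : 0 <= c * (2 - c) * a by rewrite !mulr_ge0// subr_ge0; lra.
  by lra.
have h5 : 0 <= (2 * c - 1) * b by rewrite mulr_ge0 ?subr_ge0// ltW.
by lra.
Qed.

(** For a symmetric contraction S, |v - S^2 v|^2 = |v|^2 - 2|Sv|^2 + |S^2 v|^2 <= |v|^2 - |Sv|^2. *)
Lemma opbound_defect_sqr : opbound (defect_op T c) 1.
Proof.
have SL := oplin_shift c oplin_sqr; have [SD _] := SL.
have [TD _] := oplin_sqr; have [BD _] := BL.
have Ssym u v : D u -> D v -> form (shift_op T c u) v = form u (shift_op T c v).
  move=> Du Dv; have DTu := TD _ Du; have DTv := TD _ Dv.
  rewrite /shift_op formBl// ?formBr// ?formZl ?formZr//; try exact: form_domZ.
  by rewrite /T !Bsym//; exact: BD.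
move=> v Dv; have DS := SD _ Dv; have DSS := SD _ DS.
rewrite mul1r fnorm_le ?fnorm_ge0//; last exact: form_domB.
rewrite /defect_op (formBl Dv DSS (form_domB Dv DSS)).
rewrite (formBr Dv DSS Dv) (formBr Dv DSS DSS).
rewrite (formC fs Dv DSS) (Ssym _ v DS Dv) -!sqr_fnorm//.
have h1 : fnorm (shift_op T c (shift_op T c v)) ^+ 2 <= fnorm (shift_op T c v) ^+ 2.
  by rewrite ler_sqr ?nnegrE ?fnorm_ge0//; have := opbound_shift_sqr DS; rewrite mul1r.
have h3 := sqr_ge0 (fnorm (shift_op T c v)).
by lra.
Qed.

(* T (T - c)_+ up to a factor 2, in the limit. *)
Definition cutoff_op n v := shift_op T c (T v) + T v - visser_op T c n (T v).

Lemma cutoff_op_dist n p : (n <= p)%N -> opbound (fun v => cutoff_op p v - cutoff_op n v)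
  (visser_bound p - visser_bound n).
Proof.
move=> np v Dv; rewrite /cutoff_op; have [TD _] := oplin_sqr; have DT := TD _ Dv.
have [D1 _] := oplin_visser c oplin_sqr p; have [D2 _] := oplin_visser c oplin_sqr n.
rewrite opprB addrC subrKA (fnormBC (D2 _ DT) (D1 _ DT)).
apply: le_trans (visser_op_dist oplin_sqr opbound_defect_sqr np DT) _.
have [BD _] := BL.
apply: ler_wpM2l.
  elim: p np {D1} => [|p IH]; first by rewrite leqn0 => /eqP->; rewrite subrr.
  rewrite leq_eqVlt => /orP[/eqP<-|/IH]; first by rewrite subrr.
  by have := @visser_boundS p; lra.
by apply: le_trans (B1 (BD _ Dv)) _; rewrite mul1r; have := B1 Dv; rewrite mul1r.
Qed.

(* If T <= theta < c then 1 + S is the fixed point of the iteration. *)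
Lemma cutoff_op_vanish (theta : R) n : 0 <= theta -> theta <= c -> opbound T theta ->
  opbound (cutoff_op n) ((1 - (c - theta) / 2) ^+ n).
Proof.
move=> t0 tc Tb v Dv; rewrite /cutoff_op.
have TL := oplin_sqr; have [TD TLi] := TL.
have SL := oplin_shift c TL; have [SD SLi] := SL.
have ED := (oplin_defect c TL).1.
set S := shift_op T c in SL SD SLi *.
pose Y w := S w + w.
have YL : oplin Y.
  split=> [w Dw|a u w Du Dw]; first by apply: form_domD => //; exact: SD.
  by rewrite /Y (SLi _ _ _ Du Dw) (scalerDr a (S u)) addrACA.
have YD := YL.1.
(* Y = 1 + S = T + (1 - c) has norm at most theta + 1 - c. *)
pose k : R := 1 - (c - theta).
have lec1 := c1.
have k0 : 0 <= k by rewrite /k; lra.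
have Yb : opbound Y k.
  move=> w Dw; have -> : Y w = T w + (1 - c)%:C *: w.
    by rewrite /Y /S /shift_op rmorphB rmorph1 scalerBl scale1r -addrA [- _ + w]addrC.
  apply: le_trans (fnormD _ _) _; [exact: TD|exact: form_domZ|].
  rewrite fnormZ// ger0_norm ?subr_ge0//; have := Tb _ Dw; rewrite /k.
  by have := fnorm_ge0 w; nra.
(* Fixed point equation: (1 - S^2) + (1 + S)^2 = 2 (1 + S). *)
have YE w : D w -> Y w = (2^-1)%:C *: (defect_op T c w + Y (Y w)).
  move=> Dw; rewrite /defect_op -/S {2 3}/Y.
  have -> : S (S w + w) = S (S w) + S w.
    by rewrite -[S w]scale1r SLi ?scale1r//; exact: SD.
  have -> : w - S (S w) + (S (S w) + S w + (S w + w)) = (S w + w) *+ 2.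
    by rewrite -(addrA (S (S w))) subrKA addrCA addrA mulr2n.
  rewrite -(scaler_nat 2 (S w + w)) scalerA -/(Y w).
  have -> : (2^-1)%:C * 2%:R = 1 :> R[i].
    by rewrite fmorphV rmorph_nat mulVf// pnatr_eq0.
  by rewrite scale1r.
have key m w : D w ->
    fnorm (Y w - visser_op T c m w) <= (1 - (c - theta) / 2) ^+ m * fnorm w.
  elim: m w => [|m IH] w Dw.
    rewrite /= subr0 expr0 mul1r; apply: le_trans (Yb _ Dw) _.
    by have := fnorm_ge0 w; rewrite /k; nra.
  have XL := oplin_visser c TL m; have XD := XL.1.
  have Xb := visser_opbound TL opbound_defect_sqr m.
  set X := visser_op T c m in IH XL XD Xb *.
  (* The new error is (Y (Y - X) + (Y - X) X) / 2 with |Y| <= k and |X| <= 1, so each step contracts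
     it by (k + 1) / 2, which is the announced ratio. *)
  have -> : Y w - visser_op T c m.+1 w =
      (2^-1)%:C *: (Y (Y w - X w) + (Y (X w) - X (X w))).
    rewrite (oplinB YL (YD _ Dw) (XD _ Dw)) subrKA.
    have -> : visser_op T c m.+1 w = (2^-1)%:C *: (defect_op T c w + X (X w)) by [].
    by rewrite {1}(YE _ Dw) -scalerBr opprD addrACA subrr add0r.
  have DX := XD _ Dw; have DY := YD _ Dw.
  have D1 : D (Y w - X w) by exact: form_domB.
  rewrite fnormZ; last first.
    by apply: form_domD; [exact: YD|apply: form_domB; [exact: YD|exact: XD]].
  rewrite ger0_norm// exprS -mulrA.
  have -> : 1 - (c - theta) / 2 = 2^-1 * (k + 1) by rewrite /k; field.
  rewrite -mulrA ler_pM2l//.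
  apply: le_trans (fnormD _ _) _; [exact: YD|by apply: form_domB; [exact: YD|exact: XD]|].
  rewrite mulrDl mul1r; apply: lerD.
    apply: le_trans (Yb _ D1) _; rewrite ler_wpM2l//.
    by have := IH _ Dw; rewrite /k; congr (_ <= _ ^+ _ * _); field.
  have := IH _ DX.
  have -> : 2^-1 * (k + 1) = 1 - (c - theta) / 2 by rewrite /k; field.
  move=> /le_trans; apply; rewrite ler_wpM2l//.
    by rewrite exprn_ge0//; lra.
  apply: le_trans (Xb _ Dw) _; have /andP[_ x1] := visser_bound_itv m.
  by have := fnorm_ge0 w; nra.
have DT := TD _ Dv.
rewrite -/(Y (T v)); apply: le_trans (key n _ DT) _.
rewrite ler_wpM2l//; first by rewrite exprn_ge0//; lra.
by apply: le_trans (Tb _ Dv) _; have := fnorm_ge0 v; nra.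
Qed.

(** Pair the cutoff with Tv: the shift S contributes the left side, and 1 - X_n contributes a
    nonnegative term because X_n is a contraction. *)
Lemma cutoff_op_ge n v : D v ->
  fnorm (B (T v)) ^+ 2 - c * fnorm (T v) ^+ 2 <= fnorm (cutoff_op n v) * fnorm (T v).
Proof.
move=> Dv; have TL := oplin_sqr; have [TD _] := TL; have DT := TD _ Dv.
have SD := (oplin_shift c TL).1; have XL := oplin_visser c TL n; have XD := XL.1.
have DS := SD _ DT; have DX := XD _ DT.
have h := form_cauchy_schwarz (form_domB (form_domD DS DT) DX) DT.
apply: le_trans h; rewrite formBl//; last exact: form_domD.
rewrite formDl// /shift_op formBl//; try exact: TD; try exact: form_domZ.
rewrite formZl// form_sqr// -!sqr_fnorm//.
have := form_cauchy_schwarz DX DT.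
have := visser_opbound TL opbound_defect_sqr n DT.
have /andP[_ x1] := visser_bound_itv n.
by have := fnorm_ge0 (T v); nra.
Qed.

(* The moments |B^k v| are log-convex in k. *)
Lemma opbound_of_cutoff v : D v ->
  (forall e, 0 < e -> exists n, fnorm (cutoff_op n v) <= e) ->
  fnorm (B v) <= Num.sqrt c * fnorm v.
Proof.
move=> Dv small; have [TD _] := oplin_sqr; have DT := TD _ Dv; have [BD _] := BL.
have DB := BD _ Dv; have DBT := BD _ DT.
have h1 : fnorm (B v) ^+ 2 <= fnorm (T v) * fnorm v.
  by rewrite -form_sqr//; exact: form_cauchy_schwarz.
have h2 : fnorm (T v) ^+ 2 <= fnorm (B (T v)) * fnorm (B v).
  rewrite -[T v]/(B (B v)) -form_sqr//; exact: form_cauchy_schwarz.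
have h3 : fnorm (B (T v)) ^+ 2 <= c * fnorm (T v) ^+ 2.
  apply/ler_addgt0Pr => e e0.
  have [n hn] := small (e / (fnorm (T v) + 1)) (divr_gt0 e0 (ltr_wpDl (fnorm_ge0 _) ltr01)).
  have := cutoff_op_ge n Dv; rewrite lerBlDl => /le_trans; apply; rewrite lerD2l.
  have t0 := fnorm_ge0 (T v); have q0 := fnorm_ge0 (cutoff_op n v).
  move: hn; rewrite ler_pdivlMr ?ltr_wpDl// => hn.
  by apply: le_trans hn; nra.
have a0 := fnorm_ge0 v; have b0 := fnorm_ge0 (B v).
have t0 := fnorm_ge0 (T v); have q0 := fnorm_ge0 (B (T v)).
pose s : R := Num.sqrt c; have s0 : 0 <= s by exact: sqrtr_ge0.
have sc : s ^+ 2 = c by rewrite sqr_sqrtr.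
(* The bound on the ratio of |B^3 v| to |B^2 v| descends, by log-convexity, to the ratios of |B^2 v|
   to |B v| and of |B v| to |v|. *)
have h3' : fnorm (B (T v)) <= s * fnorm (T v).
  by rewrite -ler_sqr ?nnegrE ?mulr_ge0// exprMn sc.
have h2' : fnorm (T v) <= s * fnorm (B v).
  have [->|tn0] := eqVneq (fnorm (T v)) 0; first exact: mulr_ge0.
  have tp : 0 < fnorm (T v) by rewrite lt_def tn0.
  rewrite -(ler_pM2r tp) -expr2; apply: le_trans h2 _.
  by rewrite mulrAC ler_wpM2r.
have [->|bn0] := eqVneq (fnorm (B v)) 0; first exact: mulr_ge0.
have bp : 0 < fnorm (B v) by rewrite lt_def bn0.
rewrite -(ler_pM2r bp) -expr2; apply: le_trans h1 _.
by rewrite mulrAC ler_wpM2r.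
Qed.

End SelfAdjoint.
End FormSpace.

(* Linear combinations of four fixed vectors, so that an identity between
   vectors reduces to ring identities between coefficients. *)
Definition comb4 (K : pzRingType) (V : lmodType K) (x : V * V * V * V)
    (a b c d : K) : V :=
  a *: x.1.1.1 + b *: x.1.1.2 + c *: x.1.2 + d *: x.2.

Lemma comb4E (K : pzRingType) (V : lmodType K) (u v w z : V) : exists x,
  [/\ u = comb4 x 1 0 0 0, v = comb4 x 0 1 0 0,
      w = comb4 x 0 0 1 0 & z = comb4 x 0 0 0 1].
Proof.
by exists (u, v, w, z); split; rewrite /comb4 !scale0r scale1r ?addr0 ?add0r.
Qed.

Lemma comb4D (K : pzRingType) (V : lmodType K) (x : V * V * V * V) a b c d a' b' c' d' :
  comb4 x a b c d + comb4 x a' b' c' d' =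
  comb4 x (a + a') (b + b') (c + c') (d + d').
Proof. by rewrite /comb4 !scalerDl addrACA; congr (_ + _); rewrite addrACA; congr (_ + _); rewrite addrACA. Qed.

Lemma comb4Z (K : pzRingType) (V : lmodType K) (x : V * V * V * V) k a b c d :
  k *: comb4 x a b c d = comb4 x (k * a) (k * b) (k * c) (k * d).
Proof. by rewrite /comb4 !scalerDr !scalerA. Qed.

Lemma comb4N (K : pzRingType) (V : lmodType K) (x : V * V * V * V) a b c d :
  - comb4 x a b c d = comb4 x (- a) (- b) (- c) (- d).
Proof. by rewrite -scaleN1r comb4Z !mulN1r. Qed.

(** * Representations on spaces with a form, and the cutoffs as elements of the algebra *)

Section FormRep.
Variables (R : realType) (W : lmodType R[i]) (A : set W) (mul : W -> W -> W).
Variable star : W -> W.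

Record subalgebra : Prop := Subalgebra {
  subalg0 : A 0;
  subalgL : forall c a b, A a -> A b -> A (c *: a + b);
  subalgM : forall a b, A a -> A b -> A (mul a b)
}.

(** The adjoint relation is asked when both [a] and [star a] lie in [A], so that it makes sense for
    a subalgebra [A] not known to be stable under [star]. Pre-Hilbert spaces qualify. *)
Record form_rep (V : lmodType R[i]) (D : set V) (form : V -> V -> R)
    (pi : W -> V -> V) : Prop := FormRep {
  rep_space : form_space D form;
  rep_oplin : forall a, A a -> oplin D (pi a);
  rep_lin : forall c a b v, A a -> A b -> D v ->
    pi (c *: a + b) v = c *: pi a v + pi b v;
  rep_mulE : forall a b v, A a -> A b -> D v -> pi (mul a b) v = pi a (pi b v);
  rep_adj : forall a u v, A a -> A (star a) -> D u -> D v ->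
    form (pi a u) v = form u (pi (star a) v)
}.

Hypothesis SA : subalgebra.

Lemma subalgZ c a : A a -> A (c *: a).
Proof. by move=> Aa; rewrite -[_ *: _]addr0; apply: (subalgL SA) => //; exact: subalg0. Qed.

Lemma subalgD a b : A a -> A b -> A (a + b).
Proof. by move=> Aa Ab; rewrite -[a]scale1r; exact: (subalgL SA). Qed.

Lemma subalgB a b : A a -> A b -> A (a - b).
Proof. by move=> Aa Ab; rewrite addrC -scaleN1r; exact: (subalgL SA). Qed.

Section OneRep.
Variables (V : lmodType R[i]) (D : set V) (form : V -> V -> R).
Variable pi : W -> V -> V.
Hypothesis rp : form_rep D form pi.
Let fs := rep_space rp.

Lemma rep_dom a v : A a -> D v -> D (pi a v).
Proof. by move=> Aa; exact: (rep_oplin rp Aa).1. Qed.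

Lemma rep_D a b v : A a -> A b -> D v -> pi (a + b) v = pi a v + pi b v.
Proof. by move=> Aa Ab Dv; have := rep_lin rp 1 Aa Ab Dv; rewrite !scale1r. Qed.

Lemma rep_0 v : D v -> pi 0 v = 0.
Proof.
move=> Dv; have A0 := subalg0 SA.
by have := rep_lin rp (-1) A0 A0 Dv; rewrite !scaleN1r !addNr.
Qed.

Lemma rep_Z c a v : A a -> D v -> pi (c *: a) v = c *: pi a v.
Proof.
move=> Aa Dv; have := rep_lin rp c Aa (subalg0 SA) Dv.
by rewrite !addr0 rep_0// addr0.
Qed.

Lemma rep_B a b v : A a -> A b -> D v -> pi (a - b) v = pi a v - pi b v.
Proof.
move=> Aa Ab Dv; have := rep_lin rp (-1) Ab Aa Dv.
by rewrite !scaleN1r addrC => ->; rewrite addrC.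
Qed.

Lemma rep_adjr a u v : A a -> A (star a) -> D u -> D v ->
  form (pi (star a) u) v = form u (pi a v).
Proof.
move=> Aa As Du Dv; rewrite (formC fs)//; last exact: rep_dom.
by rewrite -(rep_adj rp)// (formC fs)//; exact: rep_dom.
Qed.

Lemma opbound_star a k : A a -> A (star a) -> 0 <= k ->
  opbound D form (pi a) k -> opbound D form (pi (star a)) k.
Proof.
move=> Aa As k0 ak v Dv; have Ds := rep_dom As Dv; have Da := rep_dom Aa Ds.
have [->|n0] := eqVneq (fnorm form (pi (star a) v)) 0.
  by rewrite mulr_ge0// fnorm_ge0.
have np : 0 < fnorm form (pi (star a) v) by rewrite lt_def n0 fnorm_ge0.
rewrite -(ler_pM2r np) -expr2 (sqr_fnorm fs)// rep_adjr//.
apply: le_trans (form_cauchy_schwarz fs Dv Da) _.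
rewrite mulrAC [leRHS]mulrC ler_wpM2l ?fnorm_ge0//; exact: ak.
Qed.

End OneRep.

Section CutoffElement.
Variables (b : W) (c : R).
Hypothesis Ab : A b.
Let t := mul b b.
Let e := (2 * c)%:C *: t - mul t t.

(* [visser_op n] is [visser_scalar n + visser_elt n] in the unitization. *)
Fixpoint visser_scalar n : R :=
  if n is n'.+1 then 2^-1 * (1 - c ^+ 2 + visser_scalar n' ^+ 2) else 0.
Fixpoint visser_elt n : W :=
  if n is n'.+1 then
    let z := visser_elt n' in
    (2^-1)%:C *: (e + ((2 * visser_scalar n')%:C *: z + mul z z))
  else 0.
(** This is (S + 1 - X_n) t with S = t - c. The scalars of the unitization occur only multiplied by
    t, so the element stays in the nonunital algebra. *)
Definition cutoff_elt n : W :=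
  mul t t + ((1 - c - visser_scalar n)%:C *: t - mul (visser_elt n) t).

Lemma A_sqr : A t. Proof. exact: (subalgM SA). Qed.

Lemma A_defect : A e.
Proof. by apply: subalgB; [apply: subalgZ|apply: (subalgM SA)]; exact: A_sqr. Qed.

Lemma A_visser n : A (visser_elt n).
Proof.
elim: n => [|n IH] /=; first exact: subalg0.
apply: subalgZ; apply: subalgD; first exact: A_defect.
by apply: subalgD; [exact: subalgZ|exact: (subalgM SA)].
Qed.

Lemma A_cutoff n : A (cutoff_elt n).
Proof.
have At := A_sqr; apply: subalgD; first exact: (subalgM SA).
by apply: subalgB; [exact: subalgZ|apply: (subalgM SA) => //; exact: A_visser].
Qed.

Variables (V : lmodType R[i]) (D : set V) (form : V -> V -> R).
Variable pi : W -> V -> V.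
Hypothesis rp : form_rep D form pi.
Let T v := pi b (pi b v).

Lemma rep_sqr v : D v -> pi t v = T v.
Proof. by move=> Dv; exact: (rep_mulE rp). Qed.

(** The origin of [e]: 1 - (t - c)^2 = (1 - c^2) + (2ct - t^2). *)
Lemma rep_defect v : D v -> defect_op T c v = (1 - c ^+ 2)%:C *: v + pi e v.
Proof.
move=> Dv; have At := A_sqr; have Att := subalgM SA At At.
have Dt := rep_dom rp At Dv.
rewrite /defect_op /shift_op (rep_B rp)//; last exact: subalgZ.
rewrite (rep_Z rp)// (rep_mulE rp)// -!rep_sqr//; last first.
  by apply: (form_domB (rep_space rp)) => //; exact: (form_domZ (rep_space rp)).
have Dc := form_domZ (rep_space rp) c%:C Dv.
rewrite (oplinB (rep_oplin rp At) Dt Dc) (oplinZ (rep_space rp) _ (rep_oplin rp At) Dv).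
move: (pi t (pi t v)) => y; move: (pi t v) => z.
have [q [-> -> -> _]] := comb4E v y z 0.
rewrite !(comb4N, comb4D, comb4Z) -[c%:C]/(real_complex R c).
rewrite !(rmorphB, rmorph1, rmorphM, rmorphXn, rmorph_nat) /=.
by congr comb4; ring.
Qed.

Lemma rep_visser n v : D v ->
  visser_op T c n v = (visser_scalar n)%:C *: v + pi (visser_elt n) v.
Proof.
have Ae := A_defect; have fs := rep_space rp.
elim: n v => [|n IH] v Dv /=; first by rewrite scale0r add0r (rep_0 rp).
have Az := A_visser n; have Azz := subalgM SA Az Az.
have Dz := rep_dom rp Az Dv; have De := rep_dom rp Ae Dv.
rewrite rep_defect// IH//; last first.
  by rewrite IH//; apply: (form_domD fs) => //; exact: (form_domZ fs).
have A2 : A ((2 * visser_scalar n)%:C *: visser_elt n) by exact: subalgZ.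
rewrite IH// (rep_Z rp _ (subalgD Ae (subalgD A2 Azz)) Dv).
rewrite (rep_D rp Ae (subalgD A2 Azz) Dv) (rep_D rp A2 Azz Dv).
rewrite (rep_Z rp _ Az Dv) (rep_mulE rp Az Az Dv).
rewrite ((rep_oplin rp Az).2 _ _ _ Dv Dz).
move: (pi _ (pi (visser_elt n) v)) => y; move: (visser_scalar n) (pi e v) (pi (visser_elt n) v) => s p z.
have [q [-> -> -> ->]] := comb4E v p y z.
rewrite !(comb4N, comb4D, comb4Z).
rewrite !(rmorphB, rmorph1, rmorphM, rmorphXn, rmorph_nat, rmorphD) /=.
by congr comb4; ring.
Qed.

Lemma rep_cutoff n v : D v -> pi (cutoff_elt n) v = cutoff_op (pi b) c n v.
Proof.
move=> Dv; have At := A_sqr; have Az := A_visser n.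
have Att := subalgM SA At At; have Azt := subalgM SA Az At.
have Act : A ((1 - c - visser_scalar n)%:C *: t) by exact: subalgZ.
have Dt := rep_dom rp At Dv; have Dtt := rep_dom rp At Dt.
have -> : cutoff_op (pi b) c n v = shift_op T c (T v) + T v - visser_op T c n (T v) by [].
rewrite -rep_sqr// rep_visser// /shift_op -rep_sqr//.
rewrite (rep_D rp Att (subalgB Act Azt) Dv) (rep_B rp Act Azt Dv).
rewrite (rep_Z rp _ At Dv) (rep_mulE rp At At Dv) (rep_mulE rp Az At Dv).
move: (visser_scalar n) (pi t (pi t v)) (pi (visser_elt n) (pi t v)) => s x y.
move: (pi t v) => z.
have [q [-> -> -> _]] := comb4E x y z 0.
rewrite !(comb4N, comb4D, comb4Z) !(rmorphB, rmorph1).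
by congr comb4; ring.
Qed.

End CutoffElement.

Lemma visser_bound_dist n p : (n <= p)%N ->
  `|visser_bound R p - visser_bound R n| = visser_bound R p - visser_bound R n.
Proof.
move=> np; rewrite ger0_norm// subr_ge0.
elim: p np => [|p IH]; first by rewrite leqn0 => /eqP->.
rewrite leq_eqVlt => /orP[/eqP<-//|/IH] /le_trans; apply.
exact: visser_boundS.
Qed.

Section Cutoff.
Variables (f : W) (K r r' : R).
Hypotheses (Af : A f) (Asf : A (star f)).
Hypotheses (r0 : 0 <= r) (rr' : r < r') (r'K : r' <= K).

(** The factor makes it a contraction wherever [f] has norm at most K. The operator to be cut is its
    square, so a level r' for the norm of [f] turns into (r'/K)^4. *)
Definition cutoff_base : W := (K ^- 2)%:C *: mul (star f) f.
Definition cutoff_seq := cutoff_elt cutoff_base ((r' / K) ^+ 4).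

Let K0 : 0 < K.
Proof. by have h1 := r0; have h2 := rr'; have h3 := r'K; lra. Qed.

Let c0 : 0 <= (r' / K) ^+ 4.
Proof. by apply/exprn_ge0/divr_ge0; apply/ltW => //; exact: le_lt_trans rr'. Qed.

Let c1 : (r' / K) ^+ 4 <= 1.
Proof.
rewrite exprn_ile1// ?ler_pdivrMr ?mul1r// divr_ge0// ltW//.
exact: le_lt_trans rr'.
Qed.

Lemma A_cutoff_base : A cutoff_base.
Proof. by apply: subalgZ; exact: (subalgM SA). Qed.

Lemma A_cutoff_seq n : A (cutoff_seq n).
Proof. by apply: A_cutoff; exact: A_cutoff_base. Qed.

Variables (V : lmodType R[i]) (D : set V) (form : V -> V -> R).
Variable pi : W -> V -> V.
Hypothesis rp : form_rep D form pi.
Let fs := rep_space rp.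
Hypothesis fK : opbound D form (pi f) K.

Let Ab := A_cutoff_base.

Lemma cutoff_baseE v : D v -> pi cutoff_base v = (K ^- 2)%:C *: pi (star f) (pi f v).
Proof.
move=> Dv; have A1 := subalgM SA Asf Af.
by rewrite (rep_Z rp _ A1 Dv) (rep_mulE rp Asf Af Dv).
Qed.

Lemma cutoff_base_form u v : D u -> D v ->
  form (pi cutoff_base u) v = K ^- 2 * form (pi f u) (pi f v).
Proof.
move=> Du Dv; have Du' := rep_dom rp Af Du; have Dv' := rep_dom rp Af Dv.
have D1 := rep_dom rp Asf Du'.
by rewrite cutoff_baseE// (formZl fs _ D1 Dv) (rep_adjr rp).
Qed.

Lemma cutoff_base_sym u v : D u -> D v ->
  form (pi cutoff_base u) v = form u (pi cutoff_base v).
Proof.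
move=> Du Dv; have D1 := rep_dom rp Ab Dv.
rewrite (formC fs Du D1) !cutoff_base_form//.
by rewrite (formC fs)//; exact: (rep_dom rp Af).
Qed.

Lemma cutoff_base_bound k : 0 <= k -> opbound D form (pi f) k ->
  opbound D form (pi cutoff_base) ((k / K) ^+ 2).
Proof.
move=> k0 fk v Dv; have D1 := rep_dom rp Af Dv; have D2 := rep_dom rp Asf D1.
rewrite cutoff_baseE// (fnormZ fs)// ger0_norm ?invr_ge0 ?exprn_ge0 ?(ltW K0)//.
have h := opbound_star rp Af Asf k0 fk D1.
rewrite exprMn exprVn [k ^+ 2 * _]mulrC -mulrA. rewrite ler_pM2l ?invr_gt0 ?exprn_gt0//.
by apply: le_trans h _; rewrite expr2 -mulrA ler_wpM2l//; exact: fk.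
Qed.

Let B1 : opbound D form (pi cutoff_base) 1.
Proof.
have := cutoff_base_bound (ltW K0) fK.
by rewrite divff ?gt_eqF// expr1n.
Qed.

(** The bound depends neither on the representation nor on [f]: this is what makes the sequence
    Cauchy in the full norm. *)
Lemma cutoff_seq_dist n p : opbound D form (pi (cutoff_seq p - cutoff_seq n))
  `|visser_bound R p - visser_bound R n|.
Proof.
move=> v Dv; have A1 := A_cutoff_seq p; have A2 := A_cutoff_seq n.
have D1 := rep_dom rp A1 Dv; have D2 := rep_dom rp A2 Dv.
rewrite (rep_B rp A1 A2 Dv).
wlog np : n p A1 A2 D1 D2 / (n <= p)%N.
  move=> wl; have [np|/ltnW pn] := leqP n p; first exact: wl.
  by rewrite (fnormBC fs)// distrC; exact: wl.
rewrite /cutoff_seq !(rep_cutoff _ Ab rp)// visser_bound_dist//.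
exact: (cutoff_op_dist fs (rep_oplin rp Ab) c0 c1 cutoff_base_sym B1 np).
Qed.

(** Where [f] has norm at most r, the operator to be cut has norm at most (r/K)^4, strictly below
    the level. The rate involves only r, r' and K, hence is uniform over the fibers of the
    groupoid. *)
Lemma cutoff_seq_vanish n : opbound D form (pi f) r ->
  opbound D form (pi (cutoff_seq n))
    ((1 - ((r' / K) ^+ 4 - (r / K) ^+ 4) / 2) ^+ n).
Proof.
move=> fr v Dv; rewrite /cutoff_seq (rep_cutoff _ Ab rp)//.
have bl := rep_oplin rp Ab.
apply: (cutoff_op_vanish fs bl c0 c1 cutoff_base_sym B1) => //.
- by rewrite exprn_ge0// divr_ge0// ltW.
- rewrite ler_pXn2r ?nnegrE ?divr_ge0 ?(ltW K0)//; last exact: le_trans (ltW rr').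
  by rewrite ler_pM2r ?invr_gt0// ltW.
- move=> w Dw; have h := cutoff_base_bound r0 fr.
  have Db := rep_dom rp Ab Dw.
  apply: le_trans (h _ Db) _.
  rewrite -[4%N]/(2 + 2)%N exprD -mulrA ler_wpM2l ?sqr_ge0//; exact: h.
Qed.

Lemma cutoff_rate : 0 <= 1 - ((r' / K) ^+ 4 - (r / K) ^+ 4) / 2 < 1.
Proof.
have h1 := c0; have h2 := c1.
have h3 : 0 <= (r / K) ^+ 4 by rewrite exprn_ge0// divr_ge0// ltW.
have h4 : (r / K) ^+ 4 < (r' / K) ^+ 4.
  rewrite ltr_pXn2r// ?nnegrE ?divr_ge0 ?(ltW K0)//.
    by rewrite ltr_pM2r ?invr_gt0.
  exact: le_trans (ltW rr').
by apply/andP; split; lra.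
Qed.

(** Small cutoffs bound |[cutoff_base] v| by (r'/K)^2 |v|, and K^-2 |f v|^2 is the form of
    [cutoff_base] at v, so Cauchy-Schwarz concludes. Everything concerns the single vector v. *)
Lemma fnorm_of_cutoff_seq v : D v ->
  (forall e, 0 < e -> exists n, fnorm form (pi (cutoff_seq n) v) <= e) ->
  fnorm form (pi f v) <= r' * fnorm form v.
Proof.
move=> Dv small; have bl := rep_oplin rp Ab.
have Db := rep_dom rp Ab Dv; have Df := rep_dom rp Af Dv.
have rp' : 0 <= r' by apply: le_trans (ltW rr').
have := opbound_of_cutoff fs bl c0 c1 cutoff_base_sym B1 Dv.
have -> : Num.sqrt ((r' / K) ^+ 4) = (r' / K) ^+ 2.
  by rewrite -[4%N]/(2 * 2)%N exprM sqrtr_sqr ger0_norm ?sqr_ge0.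
have sm e : 0 < e -> exists n,
    fnorm form (cutoff_op (pi cutoff_base) ((r' / K) ^+ 4) n v) <= e.
  move=> e0; have [n hn] := small e e0; exists n.
  by rewrite -(rep_cutoff _ Ab rp).
move=> /(_ sm) h.
rewrite (fnorm_le fs)// ?mulr_ge0 ?fnorm_ge0// exprMn.
have : K ^- 2 * form (pi f v) (pi f v) <= (r' / K) ^+ 2 * fnorm form v * fnorm form v.
  rewrite -cutoff_base_form//; apply: le_trans (form_cauchy_schwarz fs Db Dv) _.
  by rewrite ler_wpM2r ?fnorm_ge0.
rewrite exprMn exprVn -mulrA -expr2 mulrAC [leRHS]mulrC ler_pM2l//.
by rewrite invr_gt0 exprn_gt0.
Qed.

End Cutoff.
End FormRep.

(** * Groupoids and induced representations *)

Section GroupoidTheory.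
Variables (G : Type) (m : groupoid G).
Local Notation r := (grange m).
Local Notation s := (gsource m).
Local Notation "a ** b" := (gmul m a b).
Local Notation inv := (ginv m).

(** The axioms give (g^-1 g) h = h, and multiplying by h^-1 identifies the two units; conversely g
    is composable with its source and the range of h with h. *)
Lemma gcompP g h : gcomp m g h <-> s g = r h.
Proof.
split=> [c|e].
  have [c1 _ e1] := gmulA (gcompVg m g) c.
  by have := gmulgK c1; rewrite e1 gmulKg.
have [_ c1 _] := gmulA (gcompgV m g) (gcompVg m g).
rewrite -/(s g) e in c1.
have [c2 _ e2] := gmulA (gcompgV m h) (gcompVg m h).
have [_ c3 _] := gmulA c1 c2; suff : r h ** h = h by move=> <-.
by rewrite /grange e2 -{1}(ginvK m h) gmulKg//; exact: gcompVg.
Qed.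

Lemma grangeV g : r (inv g) = s g. Proof. by rewrite /grange ginvK. Qed.
Lemma gsourceV g : s (inv g) = r g. Proof. by rewrite /gsource ginvK. Qed.

Lemma gmulAE g h k : s g = r h -> s h = r k -> (g ** h) ** k = g ** (h ** k).
Proof. by move=> /gcompP c1 /gcompP c2; case: (gmulA c1 c2). Qed.

Lemma gmulKE g h : s g = r h -> inv g ** (g ** h) = h.
Proof. by move=> /gcompP; exact: gmulKg. Qed.

Lemma gmulKVE g h : r g = r h -> g ** (inv g ** h) = h.
Proof. by move=> e; rewrite -{1}(ginvK m g) gmulKE// gsourceV. Qed.

Lemma gmulEK g h : s g = r h -> (g ** h) ** inv h = g.
Proof. by move=> /gcompP; exact: gmulgK. Qed.

Lemma gmulEKV g h : s g = s h -> (g ** inv h) ** h = g.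
Proof. by move=> e; rewrite -{2}(ginvK m h) gmulEK// grangeV. Qed.

Lemma grangeM g h : s g = r h -> r (g ** h) = r g.
Proof.
move=> /gcompP c; have [_ /gcompP e _] := gmulA (gcompVg m g) c.
by rewrite -e gsourceV.
Qed.

Lemma gsourceM g h : s g = r h -> s (g ** h) = s h.
Proof.
move=> /gcompP c; have [/gcompP e _ _] := gmulA c (gcompgV m h).
by rewrite e grangeV.
Qed.

Lemma grange_mulE g : r g ** g = g.
Proof. by rewrite /grange gmulEKV. Qed.

Lemma gmul_sourceE g : g ** s g = g.
Proof. by rewrite /gsource gmulKVE// grangeV. Qed.

Lemma grangeK g : r (r g) = r g.
Proof. by rewrite {2}/grange grangeM ?grangeV. Qed.

Lemma gsource_range g : s (r g) = r g.
Proof. by rewrite {2}/grange gsourceM ?gsourceV ?grangeV. Qed.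

Lemma grange_source g : r (s g) = s g.
Proof. by rewrite -(grangeV g) grangeK. Qed.

Lemma gsourceK g : s (s g) = s g.
Proof. by rewrite -(grangeV g) gsource_range. Qed.

Lemma gunits_range g : gunits m (r g). Proof. by exists g. Qed.
Lemma gunits_source g : gunits m (s g).
Proof. by rewrite -grangeV; exact: gunits_range. Qed.

Lemma gunits_sourceE u : gunits m u -> s u = u.
Proof. by move=> [g ->]; exact: gsource_range. Qed.

Lemma gunits_rangeE u : gunits m u -> r u = u.
Proof. by move=> [g ->]; exact: grangeK. Qed.

Lemma gmul_cancelr g h k : s g = r k -> s h = r k -> g ** k = h ** k -> g = h.
Proof. by move=> e1 e2 e; rewrite -(gmulEK e1) e gmulEK. Qed.

Lemma gmul_cancell g h k : s k = r g -> s k = r h -> k ** g = k ** h -> g = h.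
Proof. by move=> e1 e2 e; rewrite -(gmulKE e1) e gmulKE. Qed.

Lemma ginvM g h : s g = r h -> inv (g ** h) = inv h ** inv g.
Proof.
move=> e; have sgh := gsourceM e; have rgh := grangeM e.
have e' : s (inv h) = r (inv g) by rewrite gsourceV grangeV.
apply: (@gmul_cancelr _ _ (g ** h)).
- by rewrite gsourceV.
- by rewrite gsourceM// gsourceV rgh.
rewrite -/(s (g ** h)) sgh gmulAE//; last by rewrite gsourceV.
by rewrite gmulKE.
Qed.

Lemma ginv_unit u : gunits m u -> inv u = u.
Proof.
move=> uu; have := gmul_sourceE (inv u).
rewrite gsourceV (gunits_rangeE uu) => {1}<-.
by rewrite -/(s u) (gunits_sourceE uu).
Qed.

Lemma ginv_inj : injective inv.
Proof. exact: can_inj (ginvK m). Qed.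

(** On a fiber of the source map, [f (gdiv g k)] is the matrix of convolution by [f]: convolution
    becomes the product of matrices, and [fstar] the conjugate transpose. *)
Definition gdiv g k := g ** inv k.

Section Div.
Variables (g k : G).
Hypothesis e : s g = s k.

Let e' : s g = r (inv k). Proof. by rewrite grangeV. Qed.

Lemma grange_div : r (gdiv g k) = r g. Proof. exact: grangeM. Qed.
Lemma gsource_div : s (gdiv g k) = r k. Proof. by rewrite gsourceM// gsourceV. Qed.
Lemma gdivK : gdiv g k ** k = g. Proof. exact: gmulEKV. Qed.
Lemma gdivV : inv (gdiv g k) = gdiv k g. Proof. by rewrite ginvM// ginvK. Qed.

Lemma gdivM l : s k = s l -> gdiv g k ** gdiv k l = gdiv g l.
Proof.
move=> e1; rewrite gmulAE// ?gsourceV ?grange_div//; last first.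
  by rewrite grangeM// grangeV.
by rewrite gmulKE// grangeV.
Qed.

Lemma gdiv_unit : gunits m (gdiv g k) -> g = k.
Proof.
move=> u; have := gsource_div; rewrite (gunits_sourceE u) => h.
by rewrite -gdivK h grange_mulE.
Qed.
End Div.

Lemma gdivgg g : gdiv g g = r g. Proof. by []. Qed.

Lemma gmulgK_div w k : s w = r k -> gdiv (w ** k) k = w.
Proof. exact: gmulEK. Qed.

Lemma gdiv_mulr g k t : s g = s t -> s k = r t ->
  gdiv g (k ** t) = gdiv (g ** inv t) k.
Proof.
move=> e1 e2; rewrite /gdiv ginvM// gmulAE//; first by rewrite grangeV.
by rewrite gsourceV grangeV.
Qed.

Variable x : G.
Hypothesis ux : gunits m x.

Lemma isotropy1 : isotropy m x x.
Proof. by split; [exact: gunits_rangeE|exact: gunits_sourceE]. Qed.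

Lemma isotropyM g h : isotropy m x g -> isotropy m x h -> isotropy m x (g ** h).
Proof.
move=> [g1 g2] [h1 h2]; have e : s g = r h by rewrite [LHS]g2 [RHS]h1.
by split; rewrite /gfiber_r /gfiber_s /= ?grangeM ?gsourceM.
Qed.

Lemma isotropyV g : isotropy m x g -> isotropy m x (inv g).
Proof. by move=> [g1 g2]; split; rewrite /gfiber_r /gfiber_s /= ?grangeV ?gsourceV. Qed.

Lemma isotropyVE g : isotropy m x (inv g) <-> isotropy m x g.
Proof. by split=> [/isotropyV|/isotropyV//]; rewrite ginvK. Qed.

Lemma isotropy_mulg1 g : s g = x -> g ** x = g.
Proof. by move=> <-; exact: gmul_sourceE. Qed.

Lemma isotropy_mul1g g : r g = x -> x ** g = g.
Proof. by move=> <-; exact: grange_mulE. Qed.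

Lemma isotropy_mulV g : isotropy m x g -> g ** inv g = x.
Proof. by case. Qed.

End GroupoidTheory.

(** A sum over a set is 0 by convention when the summand has infinite support. Passing to one common
    finite index set lets such sums be handled as ordinary big operators. *)
Lemma fsum_fset (I : choiceType) (V : nmodType) (A B : set I) (F : I -> V) :
  finite_set B -> B `<=` A -> (forall i, A i -> F i <> 0 -> B i) ->
  \sum_(i \in A) F i = \sum_(i <- fset_set B) F i.
Proof.
move=> fB BA AB; rewrite -fsbig_finite//; apply/esym/fsbig_widen => // i [Ai nBi] /=.
by apply: contrapT => /(AB _ Ai).
Qed.

Lemma fsum_morph (I : choiceType) (V W : nmodType) (phi : V -> W) (A : set I) (F : I -> V) :
  phi 0 = 0 -> (forall u v, phi (u + v) = phi u + phi v) ->
  finite_set [set i | A i /\ F i <> 0] ->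
  phi (\sum_(i \in A) F i) = \sum_(i \in A) phi (F i).
Proof.
move=> p0 pD fA.
rewrite (fsum_fset fA); [|by move=> i []|by move=> i Ai Fi; split].
rewrite (fsum_fset fA); [|by move=> i []|move=> i Ai Fi; split=> // F0; by rewrite F0 in Fi].
by elim/big_ind2 : _ => // u u' v v' <- <-.
Qed.

Lemma pair_fsum (I J : choiceType) (V : nmodType) (A S : set I) (B P : set J) (F : I -> J -> V) :
  finite_set S -> finite_set P -> S `<=` A -> P `<=` B ->
  (forall i j, A i -> B j -> F i j <> 0 -> S i /\ P j) ->
  \sum_(i \in A) \sum_(j \in B) F i j = \sum_(p \in A `*` B) F p.1 p.2.
Proof.
move=> fS fP SA PB H.
transitivity (\sum_(i \in S) \sum_(j \in P) F i j).
  transitivity (\sum_(i \in A) \sum_(j \in P) F i j).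
    apply: eq_fsbigr => i /[!inE] Ai; apply/esym/fsbig_widen => // j [Bj nP] /=.
    by apply: contrapT => /(H _ _ Ai Bj)[].
  apply/esym/fsbig_widen => // i [Ai nS] /=.
  apply: fsbig1 => j Pj; apply: contrapT => /(H _ _ Ai (PB _ Pj))[].
  by [].
rewrite pair_fsbig//; apply: fsbig_widen => [[i j] [/= Si Pj]|[i j] [[/= Ai Bj] nSP]] /=.
  by split; [exact: SA|exact: PB].
by apply: contrapT => /(H _ _ Ai Bj).
Qed.

Section GroupoidAction.
Variables (R : realType) (G : topologicalType) (m : groupoid G).
Local Notation C := R[i].
Local Notation r := (grange m).
Local Notation s := (gsource m).
Local Notation "a ** b" := (gmul m a b).
Local Notation inv := (ginv m).

(** The functions whose matrices on the fibers have finite rows and columns. Both C_c(G) and the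
    group algebra of the isotropy group consist of such functions, so one theory of [gact] serves
    both. *)
Definition fiber_finite : set (G -> C) :=
  [set f | forall z, finite_set [set h | r h = z /\ f h <> 0] /\
                     finite_set [set h | s h = z /\ f h <> 0]].

Definition gact (V : lmodType C) (f : G -> C) (xi : G -> V) : G -> V := fun g =>
  \sum_(h \in gfiber_r m (r g)) f h *: xi (inv h ** g).

Lemma bij_gdiv g : set_bij (gfiber_s m (s g)) (gfiber_r m (r g)) (gdiv m g).
Proof.
split=> [k /= sk|k l /[!inE] sk sl /= e|h /= rh].
- by rewrite /gfiber_r /= grange_div.
- have := congr1 inv e; rewrite !gdivV ?sk ?sl// => e'.
  by rewrite -(gdivK sk) e' gdivK.
- exists (inv h ** g); first by rewrite /gfiber_s /= gsourceM// gsourceV.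
  by rewrite /gdiv ginvM ?gsourceV// ginvK gmulKVE// grangeV.
Qed.

Lemma fiber_finite0 : fiber_finite (0 : G -> C).
Proof. by move=> z; split; apply: (sub_finite_set _ (finite_set0 _)) => g [_]. Qed.

Lemma fiber_finite_lin c (f g : G -> C) : fiber_finite f -> fiber_finite g ->
  fiber_finite (c *: f + g).
Proof.
move=> hf hg z; have [f1 f2] := hf z; have [g1 g2] := hg z.
have key (p : G -> G) : finite_set [set h | p h = z /\ f h <> 0] ->
    finite_set [set h | p h = z /\ g h <> 0] ->
    finite_set [set h | p h = z /\ (c *: f + g) h <> 0].
  move=> pf pg; apply: (@sub_finite_set _ _
    ([set h | p h = z /\ f h <> 0] `|` [set h | p h = z /\ g h <> 0])).
    move=> h [ph n0]; have [fh|fh] := pselect (f h = 0); last by left.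
    by right; split=> // gh; apply: n0; rewrite !fctE fh gh scaler0 addr0.
  by rewrite finite_setU.
by split; exact: key.
Qed.

Lemma bij_mulr_fiber k : set_bij (gfiber_s m (r k)) (gfiber_s m (s k)) (fun l => l ** k).
Proof.
split=> [l sl|l l' /[!inE] sl sl'|h sh]; first by rewrite /gfiber_s /= gsourceM.
  exact: gmul_cancelr.
exists (h ** inv k); last exact: gmulEKV.
by rewrite /gfiber_s /= gsourceM ?gsourceV// grangeV.
Qed.

Lemma gactE (V : lmodType C) (f : G -> C) (xi : G -> V) g :
  gact f xi g = \sum_(k \in gfiber_s m (s g)) f (gdiv m g k) *: xi k.
Proof.
rewrite /gact (reindex_fsbig _ _ _ _ (bij_gdiv g)); apply: eq_fsbigr => k /[!inE] sk.
by rewrite gdivV ?sk// gdivK.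
Qed.

Lemma gconvE (f1 f2 : G -> C) g k : s g = s k ->
  gconv m f1 f2 (gdiv m g k) =
  \sum_(l \in gfiber_s m (s g)) f1 (gdiv m g l) * f2 (gdiv m l k).
Proof.
move=> e; rewrite /gconv grange_div// (reindex_fsbig _ _ _ _ (bij_gdiv g)).
apply: eq_fsbigr => l /[!inE] sl.
by rewrite gdivV ?sl// gdivM// sl.
Qed.

Lemma fstarE (f : G -> C) g k : s g = s k ->
  fstar m f (gdiv m g k) = (f (gdiv m k g))^*.
Proof. by move=> e; rewrite /fstar gdivV. Qed.

Lemma fiber_finite_row (f : G -> C) g : fiber_finite f ->
  finite_set [set k | gfiber_s m (s g) k /\ f (gdiv m g k) <> 0].
Proof.
move=> /(_ (r g))[fr _]; apply: sub_finite_set (finite_image (fun h => inv h ** g) fr).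
move=> k [sk fk]; exists (gdiv m g k); first by rewrite /= grange_div ?sk.
by rewrite gdivV ?sk// gdivK.
Qed.

Lemma fiber_finite_col (f : G -> C) k : fiber_finite f ->
  finite_set [set g | gfiber_s m (s k) g /\ f (gdiv m g k) <> 0].
Proof.
move=> /(_ (r k))[_ fs]; apply: sub_finite_set (finite_image (fun h => h ** k) fs).
move=> g [sg fg]; exists (gdiv m g k); last by rewrite gdivK.
by rewrite /= gsource_div.
Qed.

Lemma fiber_finite_row_act (V : lmodType C) f (xi : G -> V) g : fiber_finite f ->
  finite_set [set k | gfiber_s m (s g) k /\ f (gdiv m g k) *: xi k <> 0].
Proof.
move=> ff; apply: sub_finite_set (fiber_finite_row g ff) => k [sk fk]; split=> //.
by move=> f0; apply: fk; rewrite f0 scale0r.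
Qed.

Lemma gactDl (V : lmodType C) (c : C) f1 f2 (xi : G -> V) :
  fiber_finite f1 -> fiber_finite f2 ->
  gact (c *: f1 + f2) xi = c *: gact f1 xi + gact f2 xi.
Proof.
move=> h1 h2; apply/funext => g.
rewrite -[RHS]/(c *: gact f1 xi g + gact f2 xi g) !gactE.
pose P1 := [set k | gfiber_s m (s g) k /\ f1 (gdiv m g k) <> 0].
pose P2 := [set k | gfiber_s m (s g) k /\ f2 (gdiv m g k) <> 0].
have fP : finite_set (P1 `|` P2).
  by rewrite finite_setU; split; exact: fiber_finite_row.
have PG : P1 `|` P2 `<=` gfiber_s m (s g) by move=> k [[]|[]].
have out k : gfiber_s m (s g) k -> ~ (P1 `|` P2) k ->
    f1 (gdiv m g k) = 0 /\ f2 (gdiv m g k) = 0.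
  by move=> sk nk; split; apply: contrapT => h; apply: nk; [left|right].
have key (f : G -> C) : (forall k, gfiber_s m (s g) k -> ~ (P1 `|` P2) k ->
      f (gdiv m g k) = 0) ->
    \sum_(k \in gfiber_s m (s g)) f (gdiv m g k) *: xi k =
    \sum_(k <- fset_set (P1 `|` P2)) f (gdiv m g k) *: xi k.
  move=> f0; apply: fsum_fset => // k sk h; apply: contrapT => nk.
  by apply: h; rewrite f0// scale0r.
rewrite (key f1) => [|k sk /(out _ sk)[]//].
rewrite (key f2) => [|k sk /(out _ sk)[]//].
rewrite (key (c *: f1 + f2)) => [|k sk /(out _ sk)[e1 e2]]; last first.
  by rewrite !fctE e1 e2 scaler0 addr0.
rewrite scaler_sumr -big_split /=; apply: eq_bigr => k _.
by rewrite scalerDl scalerA.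
Qed.

Lemma gactDr (V : lmodType C) (c : C) f (xi eta : G -> V) : fiber_finite f ->
  gact f (c *: xi + eta) = c *: gact f xi + gact f eta.
Proof.
move=> ff; apply/funext => g.
rewrite -[RHS]/(c *: gact f xi g + gact f eta g) !gactE.
have fP := fiber_finite_row g ff.
have key (F : G -> V) : \sum_(k \in gfiber_s m (s g)) f (gdiv m g k) *: F k =
    \sum_(k <- fset_set [set k | gfiber_s m (s g) k /\ f (gdiv m g k) <> 0])
      f (gdiv m g k) *: F k.
  apply: fsum_fset => // k; first by case.
  by move=> sk h; split=> // f0; apply: h; rewrite f0 scale0r.
rewrite !key scaler_sumr -big_split /=; apply: eq_bigr => k _.
by rewrite scalerDr !scalerA mulrC.
Qed.

Lemma gactM (V : lmodType C) f1 f2 (xi : G -> V) :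
  fiber_finite f1 -> fiber_finite f2 ->
  gact (gconv m f1 f2) xi = gact f1 (gact f2 xi).
Proof.
move=> h1 h2; apply/funext => g; rewrite !gactE.
set L := [set k | gfiber_s m (s g) k /\ f1 (gdiv m g k) <> 0].
have fL : finite_set L by exact: fiber_finite_row.
(* The columns reached from row g in two steps; the sums over the fiber can be exchanged once
   restricted to the finite sets [K] and [L]. *)
set K := \bigcup_(l in L) [set k | gfiber_s m (s l) k /\ f2 (gdiv m l k) <> 0].
have fK : finite_set K by apply: bigcup_finite => // l _; exact: fiber_finite_row.
have KG : K `<=` gfiber_s m (s g).
  by move=> k [l [/= sl _]] [/= sk _]; rewrite /gfiber_s /= sk sl.
have e1 k : gfiber_s m (s g) k ->
    gconv m f1 f2 (gdiv m g k) = \sum_(l <- fset_set L) f1 (gdiv m g l) * f2 (gdiv m l k).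
  move=> sk; rewrite gconvE//; apply: fsum_fset => // l; first by case.
  by move=> sl h; split=> // f0; apply: h; rewrite f0 mul0r.
transitivity (\sum_(k <- fset_set K) \sum_(l <- fset_set L)
    (f1 (gdiv m g l) * f2 (gdiv m l k)) *: xi k).
  rewrite (fsum_fset fK)//.
    apply: eq_big_seq => k; rewrite in_fset_set// inE => /KG sk.
    by rewrite e1// scaler_suml.
  move=> k sk; rewrite e1// => h; apply: contrapT => nK; apply: h.
  rewrite big_seq big1 ?scale0r// => l; rewrite in_fset_set// inE => Ll.
  have -> : f2 (gdiv m l k) = 0.
    apply: contrapT => f20; apply: nK; exists l => //; split=> //.
    by case: Ll => /= ->.
  by rewrite mulr0.
rewrite exchange_big /= (fsum_fset fL); [|by move=> l []|]; last first.
  by move=> l sl h; split=> // f0; apply: h; rewrite f0 scale0r.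
apply: eq_big_seq => l; rewrite in_fset_set// inE => Ll.
rewrite gactE (fsum_fset fK).
- by rewrite scaler_sumr; apply: eq_bigr => k _; rewrite scalerA.
- by case: Ll => /= ->.
- move=> k sk h; exists l => //; split=> // f0; apply: h; rewrite f0 scale0r.
  by [].
Qed.

End GroupoidAction.

(** * Induction from a subgroup of an isotropy group, on finitely supported vectors *)

Section InducedRep.
Variables (R : realType) (G : topologicalType) (m : groupoid G).
Local Notation C := R[i].
Local Notation r := (grange m).
Local Notation s := (gsource m).
Local Notation "a ** b" := (gmul m a b).
Local Notation inv := (ginv m).
Variables (V : lmodType C) (form : V -> V -> R).
Hypothesis fs : form_space setT form.
Hypothesis formJ : forall (c : C) u v, form (c *: u) v = form u (c^* *: v).

(* [T] is a transversal of the cosets of the subgroup [K] in the fiber over [y],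
   with [tau k] the representative of the coset of [k]. *)
Variables (y : G) (K T : set G) (E : G -> V -> V) (tau : G -> G).
Hypothesis Kiso : K `<=` isotropy m y.
Hypothesis KV : forall t, K t -> K (inv t).
Hypothesis EL : forall t, K t -> forall (c : C) u v, E t (c *: u + v) = c *: E t u + E t v.
Hypothesis Eadj : forall t u v, K t -> form (E t u) v = form u (E (inv t) v).
Hypothesis TG : T `<=` gfiber_s m y.
Hypothesis tauT : forall k, gfiber_s m y k -> T (tau k).
Hypothesis tauE : forall k, gfiber_s m y k -> exists2 t, K t & k = tau k ** t.
Hypothesis tauK : forall g t, T g -> K t -> tau (g ** t) = g.

(** Finite support on the transversal replaces square summability: pairings are finite sums, and the
    finite columns of [f] preserve the space. A trivial subgroup with the whole fiber as transversal
    gives the regular representation; the isotropy group with E t the image of u_t^* gives part of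
    the space of [Ind rho]. *)
Definition ind_dom : set (G -> V) :=
  [set xi | [/\ forall g, ~ gfiber_s m y g -> xi g = 0,
                forall g t, gfiber_s m y g -> K t -> xi (g ** t) = E t (xi g)
              & finite_set [set g | T g /\ xi g <> 0]]].

Definition ind_form (xi eta : G -> V) : R := \sum_(g \in T) form (xi g) (eta g).

Lemma E0 t : K t -> E t 0 = 0.
Proof.
move=> Kt; have := EL Kt 1 0 0; rewrite scaler0 addr0 scale1r => h.
by apply: (addrI (E t 0)); rewrite addr0 -h.
Qed.

Lemma EZ t c u : K t -> E t (c *: u) = c *: E t u.
Proof. by move=> Kt; have := EL Kt c u 0; rewrite !addr0 E0// addr0. Qed.

Lemma ED t u v : K t -> E t (u + v) = E t u + E t v.
Proof. by move=> Kt; have := EL Kt 1 u v; rewrite !scale1r. Qed.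

Lemma form_0 u v : u = 0 \/ v = 0 -> form u v = 0.
Proof.
case=> ->; first exact: (form0l fs).
by rewrite (formC fs)//; exact: (form0l fs).
Qed.

Lemma fiber_div g k : gfiber_s m y g -> gfiber_s m y k -> s g = s k.
Proof. by rewrite /gfiber_s /= => -> ->. Qed.

Lemma Kmul k t : gfiber_s m y k -> K t -> s k = r t /\ s (k ** t) = y.
Proof.
move=> sk /Kiso[rt st]; have e : s k = r t by rewrite [LHS]sk [RHS]rt.
by split=> //; rewrite gsourceM.
Qed.

Lemma ind_dom_supp xi k : ind_dom xi -> gfiber_s m y k -> xi k <> 0 ->
  T (tau k) /\ xi (tau k) <> 0.
Proof.
move=> [x0 xE _] sk xk; split; first exact: tauT.
have [t Kt e] := tauE sk; move=> x_0; apply: xk.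
by rewrite e xE ?x_0 ?E0//; apply: TG; exact: tauT.
Qed.

Lemma ind_dom_space : form_space ind_dom ind_form.
Proof.
have fin2 xi eta : ind_dom xi -> ind_dom eta ->
    finite_set ([set g | T g /\ xi g <> 0] `|` [set g | T g /\ eta g <> 0]).
  by move=> [_ _ h1] [_ _ h2]; rewrite finite_setU.
split.
- split=> // [g t sg Kt|]; first by rewrite [RHS]E0.
  by apply: (sub_finite_set _ (finite_set0 _)) => g [].
- move=> c xi eta Dx De; have fU := fin2 _ _ Dx De.
  have [x0 xE xf] := Dx; have [e0 eE ef] := De; split.
  + by move=> g ng; rewrite !fctE x0// e0// scaler0 addr0.
  + by move=> g t sg Kt; rewrite !fctE xE// eE// EL.
  + apply: sub_finite_set fU => g [Tg h].
    apply: contrapT => nU; apply: h; rewrite !fctE.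
    have -> : xi g = 0 by apply: contrapT => h; apply: nU; left.
    have -> : eta g = 0 by apply: contrapT => h; apply: nU; right.
    by rewrite scaler0 addr0.
- move=> c xi eta ze Dx De Dz; have fU := fin2 _ _ Dx De.
  set U := _ `|` _ in fU.
  have UT : U `<=` T by move=> g [[]|[]].
  have key (F : G -> V) : (forall g, T g -> ~ U g -> F g = 0) ->
      ind_form F ze = \sum_(g <- fset_set U) form (F g) (ze g).
    move=> F0; apply: fsum_fset => // g Tg h; apply: contrapT => nU.
    by apply: h; apply: form_0; left; exact: F0.
  have x0 g : T g -> ~ U g -> xi g = 0.
    by move=> Tg nU; apply: contrapT => h; apply: nU; left.
  have e0 g : T g -> ~ U g -> eta g = 0.
    by move=> Tg nU; apply: contrapT => h; apply: nU; right.
  rewrite (key xi)// (key eta)// key; last first.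
    by move=> g Tg nU; rewrite !fctE x0// e0// scaler0 addr0.
  rewrite mulr_sumr -big_split /=; apply: eq_bigr => g _.
  exact: (formPl fs).
- move=> xi eta _ _; apply: eq_fsbigr => g _; exact: (formC fs).
- by move=> xi _; apply: fsumr_ge0 => g _; exact: (form_ge0 fs).
Qed.

Lemma bij_mulr t : K t -> set_bij (gfiber_s m y) (gfiber_s m y) (fun k => k ** t).
Proof.
by move=> /Kiso[rt st]; have := bij_mulr_fiber m t; rewrite [r t]rt [s t]st.
Qed.

Lemma gact_dom f xi : fiber_finite m f -> ind_dom xi -> ind_dom (gact m f xi).
Proof.
move=> ff Dx; have [x0 xE xf] := Dx; split.
- move=> g ng; rewrite gactE fsbig1// => k /= sk; rewrite x0 ?scaler0//.
  by rewrite /gfiber_s /= sk.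
- move=> g t sg Kt; have [e1 e2] := Kmul sg Kt.
  rewrite !gactE e2 sg (reindex_fsbig _ _ _ _ (bij_mulr Kt)).
  rewrite (fsum_morph (E0 Kt) (fun u v => ED u v Kt)); last first.
    by have := fiber_finite_row_act xi g ff; rewrite sg.
  apply: eq_fsbigr => k /[!inE] sk; have [e3 e4] := Kmul sk Kt.
  rewrite xE// EZ//; congr (f _ *: _).
  rewrite gdiv_mulr//; last by rewrite e2; have [_ ->] := Kiso Kt.
  by rewrite gmulEK.
- set S := [set g | T g /\ xi g <> 0] in xf.
  (* If the result is nonzero at g, then f (g k^-1) and xi k are nonzero for some k = (tau k) t. So
     g t^-1 = h (tau k) with h in the finite column of [f] at the range of tau k, and g is the
     representative of g t^-1. *)
  pose F g' := (fun h => tau (h ** g')) @` [set h | s h = r g' /\ f h <> 0].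
  apply: (@sub_finite_set _ _ (\bigcup_(g' in S) F g')); last first.
    by apply: bigcup_finite => // g' _; apply: finite_image; case: (ff (r g')).
  move=> g [Tg]; rewrite gactE => h.
  have sg := TG Tg; rewrite [s g]sg in h.
  have [k sk hk] : exists2 k, gfiber_s m y k & f (gdiv m g k) *: xi k <> 0.
    apply: contrapT => nk; apply: h; apply: fsbig1 => k sk.
    by apply: contrapT => hk; apply: nk; exists k.
  have xk : xi k <> 0 by move=> xk; apply: hk; rewrite xk scaler0.
  have fk : f (gdiv m g k) <> 0 by move=> fk; apply: hk; rewrite fk scale0r.
  have Sk := ind_dom_supp Dx sk xk; have [t Kt e] := tauE sk.
  have sT := TG Sk.1; have [e1 e2] := Kmul sT Kt.
  have [rt st] := Kiso Kt.
  have sgt : s g = s t by rewrite [LHS]sg [RHS]st.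
  have [e3 e4] := Kmul sg (KV Kt).
  have eg : s (g ** inv t) = s (tau k) by rewrite e4 [RHS]sT.
  exists (tau k) => //; exists (gdiv m (g ** inv t) (tau k)); last first.
    by rewrite gdivK// tauK//; exact: KV.
  by split; [rewrite gsource_div|rewrite -gdiv_mulr// -e].
Qed.

(* The involution matching the terms of the two sides of the adjunction
   [ind_form (gact f xi) eta = ind_form xi (gact (fstar f) eta)]. *)
Let sw (p : G * G) : G * G := (tau p.2, p.1 ** (inv p.2 ** tau p.2)).
Let TY := T `*` gfiber_s m y.

Let swE g k t : T g -> T k -> K t -> sw (g, k ** t) = (k, g ** inv t).
Proof.
move=> Tg Tk Kt; rewrite /sw /= tauK//; congr (_, g ** _).
have [e1 e2] := Kmul (TG Tk) Kt; have [rt st] := Kiso Kt.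
rewrite ginvM// gmulAE ?gsourceV ?grangeV//.
by rewrite -/(s k) e1 -(gsourceV m t) gmul_sourceE.
Qed.

Let swTY p : TY p -> TY (sw p).
Proof.
case: p => g k [/= Tg sk]; have [t Kt e] := tauE sk; rewrite e swE//; last exact: tauT.
split=> /=; first exact: tauT.
by have [] := Kmul (TG Tg) (KV Kt).
Qed.

Let swK p : TY p -> sw (sw p) = p.
Proof.
case: p => g k [/= Tg sk]; have [t Kt e] := tauE sk; rewrite e swE//; last exact: tauT.
by rewrite swE ?ginvK//; [exact: tauT|exact: KV].
Qed.

Let bij_sw : set_bij TY TY sw.
Proof.
split=> [p|p q /[!inE] Tp Tq e|p Tp]; first exact: swTY.
  by rewrite -(swK Tp) e swK.
by exists (sw p); [exact: swTY|exact: swK].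
Qed.

Lemma gact_adj f xi eta : fiber_finite m f -> fiber_finite m (fstar m f) ->
  ind_dom xi -> ind_dom eta ->
  ind_form (gact m f xi) eta = ind_form xi (gact m (fstar m f) eta).
Proof.
move=> ff fsf Dx De; have [x0 xE xf] := Dx; have [e0 eE ef] := De.
pose F g k := form (f (gdiv m g k) *: xi k) (eta g).
pose F' g k := form (f (gdiv m k g) *: xi g) (eta k).
(* Writing k = (tau k) t, equivariance takes the factor t^-1 out of xi, the adjoint of E moves it to
   eta as t, and equivariance again absorbs it into eta k. *)
have FF' p : TY p -> F (sw p).1 (sw p).2 = F' p.1 p.2.
  case: p => g k [/= Tg sk]; have [t Kt e] := tauE sk.
  have /(congr1 snd) /= -> : sw (g, k) = (tau k, g ** inv t).
    by rewrite [in LHS]e; apply: swE => //; exact: tauT.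
  have sg := TG Tg; have sT := TG (tauT sk).
  rewrite /F /F' xE//; last exact: KV.
  rewrite -EZ; last exact: KV.
  rewrite Eadj ?ginvK; last exact: KV.
  rewrite -eE// -e; congr (form (f _ *: _) _).
  rewrite gdiv_mulr ?ginvK -?e//.
    by rewrite gsourceV [LHS]sT (Kiso Kt).1.
  by rewrite grangeV [LHS]sg (Kiso Kt).2.
transitivity (\sum_(g \in T) \sum_(k \in gfiber_s m y) F g k).
  apply: eq_fsbigr => g /[!inE] Tg; rewrite gactE [s g](TG Tg).
  apply: (@fsum_morph _ _ _ (fun u => form u (eta g))).
  - by apply: form_0; left.
  - by move=> u v; exact: (formDl fs).
  - by have := fiber_finite_row_act xi g ff; rewrite [s g](TG Tg).
transitivity (\sum_(g \in T) \sum_(k \in gfiber_s m y) F' g k); last first.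
  apply: eq_fsbigr => g /[!inE] Tg; rewrite gactE [s g](TG Tg).
  rewrite (@fsum_morph _ _ _ (fun u => form (xi g) u)).
  - apply: eq_fsbigr => k /[!inE] sk; rewrite /F' formJ fstarE//.
    by rewrite [LHS](TG Tg).
  - by apply: form_0; right.
  - by move=> u v; exact: (formDr fs).
  - by have := fiber_finite_row_act eta g fsf; rewrite [s g](TG Tg).
(* Both double sums are flattened into sums over pairs, whose terms [sw] permutes; the flattening
   requires finite supports in each variable. *)
set Sx := [set g | T g /\ xi g <> 0] in xf.
set Se := [set g | T g /\ eta g <> 0] in ef.
pose P := \bigcup_(g in Se) [set k | gfiber_s m (s g) k /\ f (gdiv m g k) <> 0].
pose P' := \bigcup_(g in Sx) [set k | gfiber_s m (s g) k /\ f (gdiv m k g) <> 0].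
have fP : finite_set P by apply: bigcup_finite => // g _; exact: fiber_finite_row.
have fP' : finite_set P' by apply: bigcup_finite => // g _; exact: fiber_finite_col.
rewrite (@pair_fsum _ _ _ T Se _ P)//; first last.
- move=> g k Tg sk h.
  have Sg : Se g.
    by split=> // eg; apply: h; apply: form_0; right.
  split=> //; exists g => //; split; first by rewrite /gfiber_s /= [RHS](TG Tg).
  by move=> f0; apply: h; apply: form_0; left; rewrite f0 scale0r.
- by move=> k [g [Tg _] [sk _]]; rewrite /gfiber_s /= [LHS]sk (TG Tg).
- by move=> g [].
rewrite (@pair_fsum _ _ _ T Sx _ P')//; first last.
- move=> g k Tg sk h.
  have Sg : Sx g.
    by split=> // eg; apply: h; apply: form_0; left; rewrite eg scaler0.
  split=> //; exists g => //; split; first by rewrite /gfiber_s /= [RHS](TG Tg).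
  by move=> f0; apply: h; apply: form_0; left; rewrite f0 scale0r.
- by move=> k [g [Tg _] [sk _]]; rewrite /gfiber_s /= [LHS]sk (TG Tg).
- by move=> g [].
rewrite (reindex_fsbig _ _ _ _ bij_sw); apply: eq_fsbigr => p /[!inE].
exact: FF'.
Qed.

Lemma ind_form_rep (A : set (G -> C)) : A `<=` fiber_finite m ->
  form_rep A (gconv m) (fstar m) ind_dom ind_form (@gact R G m V).
Proof.
move=> AF; split.
- exact: ind_dom_space.
- move=> a /AF fa; split=> [v|c u v _ _]; first exact: gact_dom.
  exact: gactDr.
- by move=> c a b v /AF fa /AF fb _; rewrite gactDl.
- by move=> a b v /AF fa /AF fb _; exact: gactM.
- by move=> a u v /AF fa /AF fsa; exact: gact_adj.
Qed.

End InducedRep.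

(** * Functions supported on bisections *)

(** The groupoid may fail to be Hausdorff, so a compact set need not be closed; the separation of
    [p] from the points of [K] is an input, to be supplied by the Hausdorff unit space. *)
Lemma compact_avoid (X : topologicalType) (K : set X) (p : X) : compact K ->
  (forall k, K k -> exists A B, [/\ nbhs p A, nbhs k B & A `&` B `<=` set0]) ->
  \forall q \near p, ~ K q.
Proof.
move=> /compact_near_coveringP cK sep.
have nA : \forall q \near p, K `<=` (fun k => q <> k).
  apply: cK => k Kk; have [A [B [nA nB AB]]] := sep k Kk.
  exists (B, A) => // -[k' q] [/= Bk Aq] e; apply: (AB k').
  by split=> //; rewrite -e.
by apply: filterS nA => q Aq Kq; exact: (Aq q Kq).
Qed.

Lemma closed_compl_compact (X : topologicalType) (K : set X) :
  (forall p, ~ K p -> \forall q \near p, ~ K q) -> closed K.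
Proof.
move=> h; rewrite -openC openE => p /h; exact.
Qed.

Section EtaleTopology.
Variables (R : realType) (G : topologicalType) (m : groupoid G).
Local Notation C := R[i].
Local Notation r := (grange m).
Local Notation s := (gsource m).
Local Notation "a ** b" := (gmul m a b).
Local Notation inv := (ginv m).
Hypothesis lcE : lc_etale_groupoid m.
Hypothesis Uopen : open (gunits m).

Lemma cvg_ginv (g : G) : inv x @[x --> g] --> inv g.
Proof. exact: (etale_inv lcE). Qed.

Lemma cvg_gmul (T : Type) (F : set_system T) (phi psi : T -> G) (g h : G) :
  Filter F -> phi x @[x --> F] --> g -> psi x @[x --> F] --> h -> s g = r h ->
  (\forall x \near F, s (phi x) = r (psi x)) ->
  phi x ** psi x @[x --> F] --> g ** h.
Proof.
move=> FF cphi cpsi e near_e.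
have /subspace_continuousP/(_ (g, h)) := etale_mul lcE.
move=> /(_ (proj2 (gcompP m g h) e)) cm.
have cpair : (phi x, psi x) @[x --> F] --> within [set p | gcomp m p.1 p.2] (nbhs (g, h)).
  have cp : (phi x, psi x) @[x --> F] --> (g, h) by exact: cvg_pair.
  move=> A nA; have nA' := cp _ nA.
  apply: filterS2 near_e nA' => x ex; apply.
  exact/gcompP.
by apply: cvg_comp cpair cm.
Qed.

Lemma cvg_grange (g : G) : r x @[x --> g] --> r g.
Proof.
apply: cvg_gmul; [exact: cvg_id|exact: cvg_ginv|by rewrite grangeV|].
by apply: nearW => x; rewrite grangeV.
Qed.

Lemma cvg_gsource (g : G) : s x @[x --> g] --> s g.
Proof.
apply: cvg_gmul; [exact: cvg_ginv|exact: cvg_id|by rewrite gsourceV|].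
by apply: nearW => x; rewrite gsourceV.
Qed.

Lemma gunits_separated u v : gunits m u -> gunits m v -> u <> v ->
  exists A B, [/\ nbhs u A, nbhs v B & A `&` B `<=` set0].
Proof.
move=> uu uv uDv; have := etale_units_hausdorff lcE; rewrite open_hausdorff.
pose u' : gunits m := SigSub (mem_set uu).
pose v' : gunits m := SigSub (mem_set uv).
have /[swap]/[apply] : u' != v' by apply/eqP => /(congr1 set_val).
case=> -[A B] /= [/set_mem Au /set_mem Bv] [[A' oA' eA] [B' oB' eB] /eqP AB].
exists (A' `&` gunits m), (B' `&` gunits m); split.
- apply: open_nbhs_nbhs; split; first exact: openI.
  by split=> //; rewrite -eA in Au.
- apply: open_nbhs_nbhs; split; first exact: openI.
  by split=> //; rewrite -eB in Bv.
- move=> w [[Aw uw] [Bw _]].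
  suff : (A `&` B) (SigSub (mem_set uw)) by rewrite AB.
  by rewrite -eA -eB.
Qed.

Lemma separated_of (f : G -> G) g h : (forall x, f y @[y --> x] --> f x) ->
  (forall x, gunits m (f x)) -> f g <> f h ->
  exists A B, [/\ nbhs g A, nbhs h B & A `&` B `<=` set0].
Proof.
move=> cf uf d; have [A [B [nA nB AB]]] := gunits_separated (uf g) (uf h) d.
exists (f @^-1` A), (f @^-1` B); split; [exact: cf|exact: cf|].
by move=> y [/= Ay By]; apply: (AB (f y)).
Qed.

(** Each point of G is sent to a unit, and units are separated from each other by sets open in G, as
    the unit space is open. *)
Lemma closed_preim_compact (f : G -> G) (K : set G) : (forall x, f y @[y --> x] --> f x) ->
  (forall x, gunits m (f x)) -> compact K -> K `<=` gunits m -> closed (f @^-1` K).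
Proof.
move=> cf uf cK KU; apply: closed_compl_compact => g nK.
apply: (cf g [set y | ~ K y]); apply: compact_avoid => // k Kk.
by apply: gunits_separated => //; [exact: KU|move=> e; rewrite -e in Kk].
Qed.

(* Half of a bisection: an open set with a continuous section of the source map
   defined on an open set of units. *)
Definition sbisec (W : set G) : Prop :=
  [/\ open W, open (s @` W)
    & exists sg : G -> G, forall w, W w -> sg (s w) = w /\ sg y @[y --> s w] --> w].

(** The symmetry under inversion lets statements about the range be read off from those about the
    source. *)
Definition bisec (W : set G) : Prop := sbisec W /\ sbisec (inv @^-1` W).

Lemma sbisec_inj (W : set G) v w : sbisec W -> W v -> W w -> s v = s w -> v = w.
Proof. by move=> [_ _ [sg h]] /h[e1 _] /h[e2 _] e; rewrite -e1 e e2. Qed.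

Lemma bisec_injr (W : set G) v w : bisec W -> W v -> W w -> r v = r w -> v = w.
Proof.
move=> [_ bW] Wv Ww e; rewrite -(ginvK m v) -(ginvK m w); congr inv.
by apply: (sbisec_inj bW); rewrite /preimage /= ?ginvK// !gsourceV.
Qed.

Lemma bisecV W : bisec W -> bisec (inv @^-1` W).
Proof.
move=> [b1 b2]; split=> //; congr sbisec: b1.
by apply/seteqP; split=> g /=; rewrite /preimage /= ginvK.
Qed.

Lemma open_cvg (O : set G) (T : Type) (F : set_system T) (phi : T -> G) g : open O -> O g ->
  phi x @[x --> F] --> g -> \forall x \near F, O (phi x).
Proof. by move=> oO Og; apply; exact: open_nbhs_nbhs. Qed.

(** An element g near u v factors as (g w^-1) w, with w the value at s g of the section of W; by
    continuity g w^-1 remains in V. This gives openness, and the section of the product is built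
    from the two sections. *)
Lemma sbisecM V W : sbisec V -> sbisec W -> sbisec (gsetmul m V W).
Proof.
move=> [oV osV [sV hV]] [oW osW [sW hW]].
have osect u v : V u -> W v -> s u = r v ->
    \forall y \near s v, (s @` W) y /\ (s @` V) (r (sW y)).
  move=> Vu Wv e; have [e1 c1] := hW v Wv; near=> y; split; near: y.
    by apply: open_nbhs_nbhs; split=> //; exists v.
  apply: (open_cvg osV (g := r v)); first by exists u.
  by apply: cvg_comp c1 _; exact: cvg_grange.
split.
- rewrite openE => _ [u [v [Vu Wv /gcompP e ->]]].
  have [e1 c1] := hW v Wv.
  have sguv : s (u ** v) = s v by rewrite gsourceM.
  have csg : sW (s g) @[g --> u ** v] --> v.
    by apply: cvg_comp c1; rewrite -sguv; exact: cvg_gsource.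
  have nsW : \forall g \near u ** v, (s @` W) (s g).
    apply: (open_cvg osW (g := s (u ** v))); last exact: cvg_gsource.
    by exists v => //; rewrite sguv.
  have nV : \forall g \near u ** v, V (g ** inv (sW (s g))).
    apply: (open_cvg oV Vu); rewrite -[X in _ --> X](gmulEK e).
    apply: cvg_gmul; first exact: cvg_id.
    - by apply: cvg_comp csg _; exact: cvg_ginv.
    - by rewrite gsourceM// grangeV.
    - apply: filterS nsW => g [w Ww ew]; rewrite grangeV -ew.
      by have [-> _] := hW w Ww; rewrite ew.
  near=> g; have [w Ww ew] : (s @` W) (s g) by near: g.
  have Vg : V (g ** inv (sW (s g))) by near: g.
  move: Vg; rewrite -ew; have [-> _] := hW w Ww => Vg.
  exists (g ** inv w), w; split=> //; last by rewrite gmulEKV.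
  by apply/gcompP; rewrite gsourceM ?gsourceV// grangeV.
- rewrite openE => _ [_ [u [v [Vu Wv /gcompP e ->]]] <-]; rewrite gsourceM//.
  apply: filterS (osect _ _ Vu Wv e) => y [[w Ww <-]].
  have [-> _] := hW w Ww; case=> u' Vu' e'.
  exists (u' ** w); last by rewrite gsourceM.
  by exists u', w; split=> //; exact/gcompP.
- exists (fun y => sV (r (sW y)) ** sW y).
  move=> _ [u [v [Vu Wv /gcompP e ->]]]; rewrite gsourceM//.
  have [e1 c1] := hW v Wv; have [e2 c2] := hV u Vu.
  rewrite e1 -e e2; split=> //; apply: cvg_gmul => //.
  + apply: cvg_comp c2; rewrite e; apply: cvg_comp c1 _; exact: cvg_grange.
  + apply: filterS (osect _ _ Vu Wv e) => y [_ [u' Vu' <-]].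
    by have [-> _] := hV u' Vu'.
Unshelve. all: by end_near.
Qed.

Lemma preim_inv_gsetmul V W :
  inv @^-1` gsetmul m V W = gsetmul m (inv @^-1` W) (inv @^-1` V).
Proof.
apply/seteqP; split=> [g [u [v [Vu Wv /gcompP e eg]]]|g [v [u [Wv Vu /gcompP e ->]]]].
  exists (inv v), (inv u); rewrite /preimage /= !ginvK; split=> //.
    by apply/gcompP; rewrite gsourceV grangeV.
  by rewrite -ginvM// -eg ginvK.
exists (inv u), (inv v); split=> //; last by rewrite ginvM.
by apply/gcompP; rewrite gsourceV grangeV.
Qed.

Lemma bisecM V W : bisec V -> bisec W -> bisec (gsetmul m V W).
Proof.
by move=> [V1 V2] [W1 W2]; split; rewrite ?preim_inv_gsetmul; exact: sbisecM.
Qed.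

Lemma bisection_bisec W : bisection m W -> bisec W.
Proof.
move=> [oW [Or oOr er] [_ [fr [hr cr]]] [Os oOs es] [_ [fs [hs cs]]]].
have or : open (r @` W) by rewrite er; exact: openI.
have os : open (s @` W) by rewrite es; exact: openI.
rewrite continuous_open_subspace// in cr; rewrite continuous_open_subspace// in cs.
split; split=> //.
- by exists fs => w Ww; rewrite hs//; split=> //; rewrite -{2}(hs _ Ww); apply: cs; rewrite inE; exists w.
- by apply: open_comp => // g _; exact: cvg_ginv.
- suff -> : s @` (inv @^-1` W) = r @` W by [].
  apply/seteqP; split=> _ [w Ww <-]; exists (inv w); rewrite ?grangeV ?gsourceV//.
  by rewrite /preimage /= ginvK.
- exists (fun y => inv (fr y)) => w Ww.
  rewrite -(grangeV m w) hr// ginvK; split=> //; rewrite -{2}(ginvK m w).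
  apply: continuous_cvg; first exact: cvg_ginv.
  by rewrite -{2}(hr _ Ww); apply: cr; rewrite inE; exists (inv w).
Qed.

Lemma cvg_real_complex (T : Type) (F : set_system T) (f : T -> R) (l : R) : Filter F ->
  f x @[x --> F] --> l -> ((f x)%:C : C^o) @[x --> F] --> (l%:C : C^o).
Proof.
move=> FF cf; apply/cvgrPdist_lt => e; rewrite ltcE /= => /andP[/eqP e0 ep].
have /cvgrPdist_lt/(_ _ ep) := cf; apply: filterS => x.
rewrite -rmorphB normc_def /= expr0n addr0 sqrtr_sqr => h.
by rewrite ltcE /= e0 eqxx.
Qed.

Lemma cvg_conjC (T : Type) (F : set_system T) (f : T -> C) (l : C) : Filter F ->
  (f x : C^o) @[x --> F] --> (l : C^o) -> ((f x)^* : C^o) @[x --> F] --> (l^* : C^o).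
Proof.
move=> FF cf; apply/cvgrPdist_lt => e ep.
have /cvgrPdist_lt/(_ _ ep) := cf; apply: filterS => x.
by rewrite -rmorphB norm_conjC.
Qed.

(** Continuity is asked at the points of W only: extended by zero to a non-Hausdorff G, the function
    may be discontinuous elsewhere. The support is recorded by a compact subset of W because
    closures taken in G may leave W. *)
Definition bisec_fun (W : set G) (F : G -> C) : Prop :=
  [/\ bisec W, forall w, W w -> (F x : C^o) @[x --> w] --> (F w : C^o)
    & exists K, [/\ compact K, K `<=` W & forall g, ~ K g -> F g = 0]].

Lemma compact_image_at (X Y : topologicalType) (f : X -> Y) (K : set X) :
  (forall k, K k -> f x @[x --> k] --> f k) -> compact K -> compact (f @` K).
Proof.
move=> cf; apply: continuous_compact; apply: continuous_in_subspaceT => k.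
by rewrite inE; exact: cf.
Qed.

Lemma bisec_fun_out W F g : bisec_fun W F -> ~ W g -> F g = 0.
Proof. by move=> [_ _ [K [_ KW F0]]] nW; apply: F0 => /KW. Qed.

Lemma bisec_funZ W F c : bisec_fun W F -> bisec_fun W (c *: F).
Proof.
move=> [bW cF [K [cK KW F0]]]; split; first exact: bW.
  move=> w Ww; have cw : (c * F x : C^o) @[x --> w] --> (c * F w : C^o).
    by apply: cvgM; [exact: cvg_cst|exact: cF].
  exact: cw.
by exists K; split=> // g nK; rewrite fctE F0// scaler0.
Qed.

Lemma bisec_fun_star W F : bisec_fun W F -> bisec_fun (inv @^-1` W) (fstar m F).
Proof.
move=> [bW cF [K [cK KW F0]]]; split; first exact: bisecV.
  move=> w Ww; apply: cvg_conjC; apply: cvg_comp (cF _ Ww); exact: cvg_ginv.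
exists (inv @` K); split.
- by apply: compact_image_at => // k _; exact: cvg_ginv.
- by move=> _ [k Kk <-]; rewrite /preimage /= ginvK; exact: KW.
- by move=> g nK; rewrite /fstar F0 ?conjC0// => Kg; apply: nK; exists (inv g); rewrite ?ginvK.
Qed.

Section Convolution.
Variables (V W : set G) (F1 F2 : G -> C).
Hypotheses (g1 : bisec_fun V F1) (g2 : bisec_fun W F2).

(** The range map is injective on V, so only the term h = u survives. *)
Lemma gconv_bisec u v : V u -> W v -> s u = r v ->
  gconv m F1 F2 (u ** v) = F1 u * F2 v.
Proof.
move=> Vu Wv e; rewrite /gconv grangeM//.
rewrite -(@fsbig_widen _ _ _ _ [set u]) ?fsbig_set1 ?gmulKE//.
  by move=> _ ->.
move=> h [rh nu] /=; have [Vh|nVh] := pselect (V h).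
  by exfalso; apply: nu; case: g1 => bV _ _; exact: (bisec_injr bV).
by rewrite (bisec_fun_out g1 nVh) mul0r.
Qed.

Lemma gconv_neq0 g : gconv m F1 F2 g <> 0 ->
  exists h, [/\ r h = r g, F1 h <> 0 & F2 (inv h ** g) <> 0].
Proof.
move=> n0; apply: contrapT => nh; apply: n0; apply: fsbig1 => h rh.
apply: contrapT => h0; apply: nh; exists h; split=> // e; apply: h0.
  by rewrite e mul0r.
by rewrite e mulr0.
Qed.

Lemma bisec_fun_conv : bisec_fun (gsetmul m V W) (gconv m F1 F2).
Proof.
have [bV cF1 [K1 [cK1 KV F10]]] := g1; have [bW cF2 [K2 [cK2 KW F20]]] := g2.
have [[oV osV [sV hV]] _] := bV; have [[oW osW [sW hW]] _] := bW.
have bVW : bisec (gsetmul m V W) by exact: bisecM.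
split=> //.
- move=> _ [u [v [Vu Wv /gcompP e ->]]]; have [e1 c1] := hW v Wv.
  have sguv : s (u ** v) = s v by rewrite gsourceM.
  have csg : sW (s g) @[g --> u ** v] --> v.
    by apply: cvg_comp c1; rewrite -sguv; exact: cvg_gsource.
  have nVW : \forall g \near u ** v, gsetmul m V W g.
    apply: open_nbhs_nbhs; split; first by case: bVW => -[].
    by exists u, v; split=> //; exact/gcompP.
  have cu : g ** inv (sW (s g)) @[g --> u ** v] --> u.
    rewrite -[X in _ --> X](gmulEK e).
    apply: cvg_gmul; first exact: cvg_id.
    - by apply: cvg_comp csg _; exact: cvg_ginv.
    - by rewrite gsourceM// grangeV.
    - apply: filterS nVW => _ [u' [v' [Vu' Wv' /gcompP e' ->]]].
      by rewrite gsourceM// (hW _ Wv').1 grangeV.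
  rewrite (gconv_bisec Vu Wv e).
  have cprod : (F1 (g ** inv (sW (s g))) * F2 (sW (s g)) : C^o) @[g --> u ** v] -->
      (F1 u * F2 v : C^o).
    by apply: cvgM; [apply: cvg_comp cu (cF1 _ Vu)|apply: cvg_comp csg (cF2 _ Wv)].
  apply: cvg_trans cprod; apply: near_eq_cvg.
  apply: filterS nVW => _ [u' [v' [Vu' Wv' /gcompP e' ->]]].
  by rewrite gsourceM// (hW _ Wv').1 gmulEK// gconv_bisec.
(* [th] multiplies v on the left by the element of V composable with it, and [L] is the part of [K2]
   that meets [K1] in this way. It is compact because the sources of [K1] form a compact set of
   units, with closed preimage. *)
- pose th v := sV (r v) ** v.
  pose L := K2 `&` r @^-1` (s @` K1).
  have cL : compact L.
    apply: compact_closedI => //; apply: closed_preim_compact.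
    + exact: cvg_grange.
    + by move=> x; exact: gunits_range.
    + by apply: compact_image_at => // k _; exact: cvg_gsource.
    + by move=> _ [k _ <-]; exact: gunits_source.
  exists (th @` L); split.
  + apply: compact_image_at => // v [/KW Wv [u /KV Vu e]].
    have [e2 c2] := hV u Vu.
    have cth : th x @[x --> v] --> u ** v.
      apply: cvg_gmul => //.
      - by apply: cvg_comp c2; rewrite e; exact: cvg_grange.
      - have : \forall x \near v, (s @` V) (r x).
          apply: (open_cvg osV (g := r v)); first by exists u.
          exact: cvg_grange.
        by apply: filterS => x [u' Vu' <-]; rewrite (hV _ Vu').1.
    by rewrite /th -e e2.
  + move=> _ [v [Kv [u Ku e]] <-]; rewrite /th -e (hV u (KV _ Ku)).1.
    by exists u, v; split; [exact: KV|exact: KW|exact/gcompP|].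
  + move=> g nL; apply: contrapT => /gconv_neq0[h [rh f1 f2]]; apply: nL.
    have Kh : K1 h by apply: contrapT => /F10.
    have Khg : K2 (inv h ** g) by apply: contrapT => /F20.
    exists (inv h ** g).
      by split=> //; exists h => //; rewrite grangeM ?grangeV// gsourceV.
    rewrite /th grangeM ?gsourceV// grangeV (hV _ (KV _ Kh)).1.
    by rewrite gmulKVE.
Qed.

End Convolution.

Lemma bisec_fun_finite W F : bisec_fun W F -> fiber_finite m F.
Proof.
move=> gF z; have bW : bisec W by case: gF.
have inW h : F h <> 0 -> W h by move=> Fh; apply: contrapT => /(bisec_fun_out gF).
have one (P : set G) : (forall g h, P g -> P h -> g = h) -> finite_set P.
  move=> P1; have [->|/set0P[g Pg]] := eqVneq P set0; first exact: finite_set0.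
  by apply: (sub_finite_set _ (finite_set1 g)) => h Ph; exact: P1.
split; apply: one => g h [zg Fg] [zh Fh].
  by apply: (bisec_injr bW); [exact: inW|exact: inW|rewrite zg zh].
by apply: (sbisec_inj bW.1); [exact: inW|exact: inW|rewrite zg zh].
Qed.

Lemma bisec_separated W g h : bisec W -> W g -> W h -> g <> h ->
  exists A B, [/\ nbhs g A, nbhs h B & A `&` B `<=` set0].
Proof.
move=> bW Wg Wh gh; apply: (@separated_of s).
- exact: cvg_gsource.
- by move=> x; exact: gunits_source.
- by move=> e; apply: gh; exact: (sbisec_inj bW.1).
Qed.

Lemma bisec_hausdorff W : bisec W -> hausdorff_space (set_type W).
Proof.
move=> bW p q cl; apply: contrapT => pq.
have [A [B [nA nB AB]]] : exists A B,
    [/\ nbhs (set_val p) A, nbhs (set_val q) B & A `&` B `<=` set0].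
  apply: (bisec_separated bW); [exact: set_valP|exact: set_valP|].
  by move=> /val_inj.
have cval : continuous (set_val : set_type W -> G) by exact: initial_continuous.
have [x [/= Ax Bx]] := cl _ _ (cval p _ nA) (cval q _ nB).
exact: (AB (set_val x)).
Qed.

Lemma bisec_fun_Cc_on W F : bisec_fun W F -> Cc_on W F.
Proof.
move=> gF; have [bW cF [K [cK KW F0]]] := gF; have oW : open W by case: bW => -[].
split.
- by rewrite continuous_open_subspace// => w; rewrite inE; exact: cF.
- by move=> g; exact: (bisec_fun_out gF).
(* [K] may fail to be closed in G, but points of the bisection W are separated from each other, so
   within W the closure of the support stays in [K]. *)
- suff -> : W `&` closure [set g | F g != 0] = K `&` closure [set g | F g != 0].
    by apply: compact_closedI => //; exact: closed_closure.
  apply/seteqP; split=> g [Wg cg]; split=> //; last exact: KW.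
  apply: contrapT => nK; have : \forall q \near g, ~ K q.
    apply: compact_avoid => // k Kk; apply: (bisec_separated bW) => //; first exact: KW.
    by move=> e; rewrite e in nK.
  by move=> /cg[h [/= h0 /F0 e]]; rewrite e eqxx in h0.
Qed.

(* The span of the functions supported on bisections; sums suffice since these
   functions are stable under scaling. *)
Inductive bisec_span : set (G -> C) :=
| bisec_span0 : bisec_span 0
| bisec_spanD W F f : bisec_fun W F -> bisec_span f -> bisec_span (F + f).

Lemma bisec_span_fun W F : bisec_fun W F -> bisec_span F.
Proof. by move=> gF; rewrite -[F]addr0; apply: bisec_spanD gF bisec_span0. Qed.

Lemma bisec_span_add f g : bisec_span f -> bisec_span g -> bisec_span (f + g).
Proof.
move=> Bf Bg; elim: Bf => [|W F h gF _ IH]; first by rewrite add0r.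
by rewrite -addrA; exact: bisec_spanD gF IH.
Qed.

Lemma bisec_spanZ c f : bisec_span f -> bisec_span (c *: f).
Proof.
elim=> [|W F h gF _ IH]; first by rewrite scaler0; exact: bisec_span0.
by rewrite scalerDr; apply: bisec_spanD IH; exact: bisec_funZ gF.
Qed.

Lemma bisec_span_finite : bisec_span `<=` fiber_finite m.
Proof.
move=> f; elim=> [|W F h gF _ IH]; first exact: fiber_finite0.
by rewrite -[F]scale1r; apply: fiber_finite_lin IH; exact: bisec_fun_finite gF.
Qed.

Lemma gconv_gact (f1 f2 : G -> C) : gconv m f1 f2 = gact m f1 (f2 : G -> C^o).
Proof. by []. Qed.

Lemma bisec_span_conv f g : bisec_span f -> bisec_span g -> bisec_span (gconv m f g).
Proof.
move=> Bf Bg; have h0 (h : G -> C) : gact m 0 (h : G -> C^o) = 0.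
  by apply/funext => x; apply: fsbig1 => k _; rewrite scale0r.
elim: Bf => [|W F f' gF Bf' IH]; first by rewrite gconv_gact h0; exact: bisec_span0.
rewrite gconv_gact -[F]scale1r gactDl ?scale1r; last 2 first.
- exact: bisec_fun_finite gF.
- exact: bisec_span_finite.
apply: bisec_span_add => // {IH f' Bf'}.
have fF := bisec_fun_finite gF.
elim: Bg => [|V F' f' gF' Bf' IH].
  suff -> : gact m F (0 : G -> C^o) = 0 by exact: bisec_span0.
  by apply/funext => x; apply: fsbig1 => k _; rewrite scaler0.
rewrite -[F']scale1r gactDr// scale1r.
by apply: bisec_span_add => //; apply: bisec_span_fun; exact: bisec_fun_conv gF gF'.
Qed.

(** The algebra in which the cutoffs are formed: convolution of its generators is explicit, and it
    lies inside C_c(G) by [bisec_span_Cc]. *)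
Lemma bisec_subalgebra : subalgebra bisec_span (gconv m).
Proof.
split; [exact: bisec_span0| |exact: bisec_span_conv].
by move=> c a b Ba Bb; apply: bisec_span_add => //; exact: bisec_spanZ.
Qed.

Lemma bisec_span_Cc : bisec_span `<=` Cc (G := G) (R := R).
Proof.
move=> f; elim=> [|W F h gF _ [n [c [H [HW ->]]]]].
  by exists 0%N, (fun _ => 0), (fun _ => 0); split; [case|rewrite big_ord0].
exists n.+1, (fun i => if unlift ord0 i is Some j then c j else 1),
  (fun i => if unlift ord0 i is Some j then H j else F); split.
  move=> i; case: unliftP => [j _|_]; first exact: HW.
  have bW : bisec W by case: gF.
  exists W; split; [by case: bW => -[]|exact: bisec_hausdorff|exact: bisec_fun_Cc_on].
rewrite big_ord_recl unlift_none scale1r; congr (_ + _).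
by apply: eq_bigr => i _; rewrite liftK.
Qed.

End EtaleTopology.

(* If Q = 1 - (1 - L)^2 then 1 - Q is a square, whence Q <= 1. *)
Lemma opbound_of_square (R : realType) (W V : lmodType R[i]) (A : set W)
    (mul : W -> W -> W) (star : W -> W) (D : set V) (form : V -> V -> R)
    (pi : W -> V -> V) (e L Q : W) (a : R) :
  subalgebra A mul -> form_rep A mul star D form pi ->
  A e -> A (star e) -> A L -> star L = L -> A Q -> 0 <= a ->
  mul (star e) e = (a ^+ 2)%:C *: Q ->
  mul L L = (2%:R : R)%:C *: L - Q -> opbound D form (pi e) a.
Proof.
move=> SA rp Ae Ase AL sL AQ a0 eQ LQ v Dv; have fs := rep_space rp.
have De := rep_dom rp Ae Dv; have DL := rep_dom rp AL Dv; have DQ := rep_dom rp AQ Dv.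
have DLL := rep_dom rp AL DL.
have h1 : form (pi e v) (pi e v) = a ^+ 2 * form v (pi Q v).
  rewrite (rep_adj rp Ae Ase Dv De) -(rep_mulE rp Ase Ae Dv) eQ (rep_Z SA rp _ AQ Dv).
  exact: (formZr fs).
have AsL : A (star L) by rewrite sL.
have h2 : form (pi L v) (pi L v) = 2 * form v (pi L v) - form v (pi Q v).
  have A2 : A ((2%:R : R)%:C *: L) by exact: (subalgZ SA).
  rewrite (rep_adj rp AL AsL Dv DL) sL -(rep_mulE rp AL AL Dv) LQ.
  rewrite (rep_B rp A2 AQ Dv) (rep_Z SA rp _ AL Dv).
  have D2 := form_domZ fs (2%:R : R)%:C DL.
  by rewrite (formBr fs D2 DQ Dv) (formZr fs _ DL Dv).
(* Expanding the square of v - L v and inserting L^2 = 2L - Q leaves form v (Q v) <= form v v. *)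
have := form_ge0 fs (form_domB fs Dv DL).
rewrite (formBl fs Dv DL (form_domB fs Dv DL)) (formBr fs Dv DL Dv) (formBr fs Dv DL DL).
rewrite h2 (formC fs DL Dv) => h3.
rewrite (fnorm_le fs De) ?mulr_ge0 ?fnorm_ge0// h1 exprMn (sqr_fnorm fs)//.
by rewrite ler_wpM2l ?sqr_ge0//; lra.
Qed.

Lemma continuous_clip (R : realType) (X : topologicalType) (f : X -> R) : continuous f ->
  continuous (fun u => 2^-1 * (`|1 - 2 * f u| + (1 - 2 * f u))).
Proof.
move=> cf u; have c1 : 1 - 2 * f y @[y --> u] --> 1 - 2 * f u.
  by apply: cvgB; [exact: cvg_cst|apply: cvgM; [exact: cvg_cst|exact: cf]].
by apply: cvgM; [exact: cvg_cst|apply: cvgD => //; exact: cvg_norm].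
Qed.

(** * Bump functions on the unit space and their transport to bisections *)

Section Bump.
Variables (R : realType) (G : topologicalType) (m : groupoid G).
Local Notation C := R[i].
Local Notation s := (gsource m).
Local Notation "a ** b" := (gmul m a b).
Local Notation inv := (ginv m).
Hypothesis lcE : lc_etale_groupoid m.
Hypothesis Uopen : open (gunits m).

Lemma near_gunits_set_type (u : set_type (gunits m)) (A : set (set_type (gunits m))) :
  nbhs u A -> nbhs (set_val u : G) (set_val @` A : set G).
Proof.
move=> nA; have [B [[B' oB' <-] B'u] BA] : exists2 B, open_nbhs u B & B `<=` A.
  by move: nA; rewrite nbhsE.
have : open_nbhs (set_val u : G) (B' `&` gunits m).
  by split; [exact: openI|split=> //; exact: set_valP].
move=> /open_nbhs_nbhs.
apply: filterS => w [Bw uw]; exists (SigSub (mem_set uw)) => //; exact: BA.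
Qed.

Lemma compact_bump (x : G) (V : set G) : gunits m x -> open V -> V x -> V `<=` gunits m ->
  exists t : G -> R, [/\ forall u, gunits m u -> t y @[y --> u] --> t u, t x = 1,
    forall g, 0 <= t g
    & exists K, [/\ compact K, K `<=` V & forall g, ~ K g -> t g = 0]].
Proof.
move=> ux oV Vx VU.
pose X : topologicalType := set_type (gunits m); pose x' : X := SigSub (mem_set ux).
have cval : continuous (set_val : X -> G) by exact: initial_continuous.
have lc := etale_units_lc lcE; have [K0 nK0 [cK0 _]] := lc x' I.
have {}nK0 : nbhs x' K0.
  have h : nbhs x' [set y | [set: X] y -> K0 y] := nK0.
  by apply: filterS h => y; apply.
pose O : set X := set_val @^-1` V `&` K0°.
have oO : open O.
  by apply: openI; [apply: open_comp => // y _; exact: cval|exact: open_interior].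
have /(@uniform_separatorP _ R)[f [cf f01 fx fO]] : uniform_separator [set x'] (~` O).
  apply: (locally_compact_completely_regular (R := R) (etale_units_lc lcE)
    (etale_units_hausdorff lcE)); first exact: open_closedC.
  by apply; split => //; exact: nbhs_singleton.
have {}fx : f x' = 0 by apply: fx; exists x'.
(* The positive part of 1 - 2f. Its support lies in the closed set where f <= 1/2, which is inside
   [O] since f = 1 off [O], hence inside V and the compact neighbourhood [K0]. *)
pose t' u : R := 2^-1 * (`|1 - 2 * f u| + (1 - 2 * f u)).
have ct' : continuous t'.
  exact: continuous_clip.
pose t g : R := if pselect (gunits m g) is left h then t' (SigSub (mem_set h)) else 0.
have tE (u : X) : t (set_val u) = t' u.
  rewrite /t; case: pselect => [h|]; last by have := set_valP u.
  by congr (t' _); apply: val_inj.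
exists t; split.
- move=> u uu A nA; pose u' : X := SigSub (mem_set uu).
  have := near_gunits_set_type (ct' u' A _); rewrite -tE => /(_ nA).
  by apply: filterS => _ [w Aw <-] /=; rewrite tE.
- by rewrite -[x]/(set_val x') tE /t' fx mulr0 subr0 normr1 mulVf.
- move=> g; rewrite /t; case: pselect => // h; rewrite /t' mulr_ge0//.
  by rewrite -lerBlDr sub0r -normrN ler_norm.
- pose K := K0 `&` [set u | f u <= 2^-1].
  have cK : compact K.
    apply: compact_closedI => //.
    rewrite -[X in closed X]/(f @^-1` [set y | y <= 2^-1]).
    by apply: closed_comp => [u _|]; [exact: cf|exact: closed_le].
  have KO : [set u | f u <= 2^-1] `<=` O.
    move=> u /= fu; apply: contrapT => nO; have f1 : f u = 1 by apply: fO; exists u.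
    by move: fu; rewrite f1; lra.
  exists (set_val @` K); split.
  + by apply: compact_image_at => // k _; exact: cval.
  + by move=> _ [k [_ /KO[Vk _]] <-].
  + move=> g nK; rewrite /t; case: pselect => // h.
    set u : X := SigSub (mem_set h); rewrite /t'.
    have [fu|fu] := leP (f u) 2^-1; last by rewrite ler0_norm ?addNr ?mulr0//; lra.
    exfalso; apply: nK; exists u => //; split=> //.
    by apply: interior_subset; exact: (KO u fu).2.
Qed.

Definition source_fun (W : set G) (k : G -> R) (g : G) : C :=
  if pselect (W g) then (k (s g))%:C else 0.

Lemma source_funE W k g : W g -> source_fun W k g = (k (s g))%:C.
Proof. by rewrite /source_fun; case: pselect. Qed.

Lemma source_fun_out W k g : ~ W g -> source_fun W k g = 0.
Proof. by rewrite /source_fun; case: pselect. Qed.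

Section SourceFun.
Variables (W K : set G) (k : G -> R).
Hypothesis bW : bisec m W.
Hypothesis ck : forall u, gunits m u -> k y @[y --> u] --> k u.
Hypotheses (cK : compact K) (KW : K `<=` s @` W) (k0 : forall g, ~ K g -> k g = 0).

Lemma bisec_fun_source : bisec_fun m W (source_fun W k).
Proof.
have [[oW osW [sg h]] _] := bW; split=> //.
- move=> w Ww; have cw : ((k (s x))%:C : C^o) @[x --> w] --> ((k (s w))%:C : C^o).
    apply: cvg_real_complex; apply: cvg_comp (ck (gunits_source m w)).
    exact: cvg_gsource.
  rewrite source_funE//; apply: cvg_trans cw; apply: near_eq_cvg.
  have : \forall x \near w, W x by exact: open_nbhs_nbhs.
  by apply: filterS => x Wx; rewrite source_funE.
- exists (sg @` K); split.
  + by apply: compact_image_at => // _ /KW[w Ww <-]; rewrite (h w Ww).1; exact: (h w Ww).2.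
  + by move=> _ [_ /KW[w Ww <-] <-]; rewrite (h w Ww).1.
  + move=> g nK; have [Wg|nW] := pselect (W g); last exact: source_fun_out.
    rewrite source_funE// k0// => Ks; apply: nK; exists (s g) => //.
    exact: (h g Wg).1.
Qed.

(** For a bisection W, the products of W^-1 with W are units, and at the unit s v the only surviving
    term is the product of the value at v with its conjugate. *)
Lemma gconv_source_star (c : C) (a : R) : `|c| = a%:C ->
  gconv m (fstar m (c *: source_fun W k)) (c *: source_fun W k) =
  (a ^+ 2)%:C *: source_fun (gunits m) (fun u => k u ^+ 2).
Proof.
move=> ca; have gf := bisec_funZ c bisec_fun_source; have gs := bisec_fun_star lcE gf.
apply/funext => g; rewrite [RHS]/=.
have unit_val v : W v -> gconv m (fstar m (c *: source_fun W k)) (c *: source_fun W k) (s v)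
    = ((a * k (s v)) ^+ 2)%:C.
  move=> Wv; rewrite -[X in gconv _ _ _ X]/(inv v ** v) (gconv_bisec (W := W) _ gs)//; last 2 first.
  - by rewrite /preimage /= ginvK.
  - by rewrite gsourceV.
  rewrite /fstar ginvK !fctE source_funE//.
  rewrite mulrC -normCK.
  have -> : `|c *: ((k (s v))%:C : C^o)| = `|c| * `|(k (s v))%:C| by exact: normrM.
  rewrite ca normc_def /= expr0n addr0 sqrtr_sqr -rmorphM -rmorphXn exprMn real_normK ?num_real//.
  by rewrite -exprMn.
have [[v Wv sv]|nW] := pselect (exists2 v, W v & s v = g).
  rewrite -sv unit_val// fctE source_funE; last exact: gunits_source.
  by rewrite gsourceK exprMn rmorphM.
have k_0 : gunits m g -> k g = 0.
  by move=> ug; apply: k0 => /KW[w Ww e]; apply: nW; exists w.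
have -> : gconv m (fstar m (c *: source_fun W k)) (c *: source_fun W k) g = 0.
  apply: contrapT => /gconv_neq0[h [rh n1 n2]]; apply: nW.
  have Wh : W (inv h).
    apply: contrapT => nWh; apply: n1.
    by rewrite /fstar fctE source_fun_out// scaler0 conjC0.
  have Whg : W (inv h ** g).
    by apply: contrapT => nWh; apply: n2; rewrite fctE source_fun_out// scaler0.
  exists (inv h) => //; apply: (@gmul_cancell _ m _ _ (inv h)).
  - by rewrite grange_source.
  - by rewrite gsourceV.
  - rewrite gmul_sourceE; apply: (bisec_injr bW) => //.
    by rewrite grangeM ?gsourceV.
have [ug|nug] := pselect (gunits m g); last by rewrite fctE source_fun_out// scaler0.
by rewrite fctE source_funE// (gunits_sourceE ug) k_0// expr0n scaler0.
Qed.

End SourceFun.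
End Bump.

(** * Lifting functions from the isotropy group *)

Lemma esum_finite (R : realType) (I : choiceType) (A : set I) (a : I -> R) :
  (forall i, A i -> 0 <= a i) -> finite_set [set i | A i /\ a i <> 0] ->
  (\esum_(i in A) (a i)%:E)%E = (\sum_(i \in A) a i)%:E.
Proof.
move=> a0 fA; set B := [set i | A i /\ a i <> 0] in fA.
have BA : B `<=` A by move=> i [].
have -> : (\esum_(i in A) (a i)%:E = \esum_(i in A `&` B) (a i)%:E)%E.
  rewrite esum_mkcondr; apply: eq_esum => i Ai; case: ifPn => //.
  rewrite notin_setE => nB; have -> // : a i = 0.
  by apply: contrapT => h; apply: nB.
have -> : A `&` B = B by apply/setIidPr.
rewrite esum_fset//; last by move=> i /[!inE] /BA Ai; rewrite lee_fin a0.
rewrite fsumEFin//; congr (_%:E); apply: fsbig_widen => // i [Ai nB] /=.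
by apply: contrapT => h; apply: nB.
Qed.

Lemma esum_subset (R : realType) (I : choiceType) (A B : set I) (a : I -> \bar R) :
  B `<=` A -> (forall i, A i -> (0 <= a i)%E) ->
  (\esum_(i in B) a i <= \esum_(i in A) a i)%E.
Proof.
move=> BA a0; have e : A `&` B = B by apply/setIidPr.
rewrite -{1}e esum_mkcondr; apply: le_esum => i Ai.
by case: ifPn => // _; exact: a0.
Qed.

Lemma esum_widen (R : realType) (I : choiceType) (A B : set I) (a : I -> \bar R) :
  B `<=` A -> (forall i, A i -> ~ B i -> a i = 0%E) ->
  (\esum_(i in B) a i = \esum_(i in A) a i)%E.
Proof.
move=> BA a0; have e : A `&` B = B by apply/setIidPr.
rewrite -{1}e esum_mkcondr; apply: eq_esum => i Ai.
by case: ifPn => //; rewrite notin_setE => nB; rewrite a0.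
Qed.

Lemma esum_partition (R : realType) (I J : choiceType) (A : set I) (B : set J)
    (X : J -> set I) (beta : I -> J) (a : I -> \bar R) :
  (forall b g, B b -> X b g -> A g /\ beta g = b) ->
  (forall g, A g -> B (beta g) /\ X (beta g) g) ->
  (forall g, A g -> (0 <= a g)%E) ->
  (\esum_(g in A) a g = \esum_(b in B) \esum_(g in X b) a g)%E.
Proof.
move=> XA AX a0; rewrite esum_esum; last by move=> b g Bb Xg; apply: a0; have [] := XA b g Bb Xg.
apply: (@reindex_esum _ _ _ (B `*`` X) A snd); split.
- by move=> [b g] [/= Bb Xg]; have [] := XA b g Bb Xg.
- move=> [b g] [b' g'] /[!inE] -[/= Bb Xg] [/= Bb' Xg'] e.
  by rewrite -(XA _ _ Bb Xg).2 -(XA _ _ Bb' Xg').2 e.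
- by move=> g Ag; exists (beta g, g) => //; have [] := AX g Ag.
Qed.

Section SquaredNorm.
Variable R : realType.
Local Notation C := R[i].

Definition sqnorm (z : C) : R := complex.Re z ^+ 2 + complex.Im z ^+ 2.

Lemma sqnorm_ge0 z : 0 <= sqnorm z.
Proof. by rewrite addr_ge0 ?sqr_ge0. Qed.

Lemma sqnormM z w : sqnorm (z * w) = sqnorm z * sqnorm w.
Proof. by case: z w => a b [c d]; rewrite /sqnorm /=; ring. Qed.

Lemma sqnormR (a : R) : sqnorm a%:C = a ^+ 2.
Proof. by rewrite /sqnorm /= expr0n addr0. Qed.

Lemma sqnorm0 : sqnorm 0 = 0. Proof. by rewrite /sqnorm /= !expr0n addr0. Qed.

Lemma sqnorm_eq0 (z : C) : sqnorm z = 0 -> z = 0.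
Proof.
case: z => a b /eqP; rewrite /sqnorm /= paddr_eq0 ?sqr_ge0// !sqrf_eq0.
by move=> /andP[/eqP-> /eqP->].
Qed.

End SquaredNorm.

(** * Words in the given bisections, and the classes they cut in a fiber *)

Section Words.
Variables (R : realType) (G : topologicalType) (m : groupoid G).
Local Notation C := R[i].
Local Notation r := (grange m).
Local Notation s := (gsource m).
Local Notation "a ** b" := (gmul m a b).
Local Notation inv := (ginv m).
Variables (Gam : groupType) (Phi : G -> Gam) (x : G) (U : G -> set G).
Hypothesis Phi_mul : forall g h, s g = r h -> Phi (g ** h) = (Phi g * Phi h)%g.
Hypothesis ux : gunits m x.
Hypothesis Phi_inj : forall g h, isotropy m x g -> isotropy m x h -> Phi g = Phi h -> g = h.
Hypothesis PhiU : forall g u, isotropy m x g -> U g u -> Phi u = Phi g.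
Hypothesis Ux : U x = gunits m.
Hypothesis UV : forall g, isotropy m x g -> U (inv g) = gsetinv m (U g).
Hypothesis Uprod : forall g gs, isotropy m x g -> (forall h, h \in gs -> isotropy m x h) ->
  gprod m g gs = x -> gsetprod m U g gs `<=` gunits m.

(* [w] lies in a product of sets [U g] whose indices multiply to [tau]. *)
Definition word (tau w : G) : Prop := exists g gs,
  [/\ isotropy m x g, forall h, h \in gs -> isotropy m x h, gprod m g gs = tau
    & gsetprod m U g gs w].

Lemma word_U g u : isotropy m x g -> U g u -> word g u.
Proof. by move=> ig Ugu; exists g, [::]; split. Qed.

Lemma word_mulU tau w h u : word tau w -> isotropy m x h -> U h u -> s w = r u ->
  word (tau ** h) (w ** u).
Proof.
move=> [g [gs [ig igs e Ww]]] ih Uu swu; exists g, (rcons gs h); split=> //.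
- by move=> k; rewrite mem_rcons inE => /predU1P[->//|/igs].
- by rewrite /gprod foldl_rcons; congr (_ ** _).
- rewrite /gsetprod foldl_rcons; exists w, u; split=> //.
  exact/gcompP.
Qed.

Lemma word_iso tau w : word tau w -> isotropy m x tau.
Proof.
move=> [g [gs [ig igs <- _]]]; elim/last_ind: gs igs => [//|gs h IH] igs.
rewrite /gprod foldl_rcons; apply: isotropyM.
  by apply: IH => k kgs; apply: igs; rewrite mem_rcons inE kgs orbT.
by apply: igs; rewrite mem_rcons inE eqxx.
Qed.

Lemma word_ind (P : G -> G -> Prop) :
  (forall g u, isotropy m x g -> U g u -> P g u) ->
  (forall tau w h u, word tau w -> P tau w -> isotropy m x h -> U h u -> s w = r u ->
    P (tau ** h) (w ** u)) ->
  forall tau w, word tau w -> P tau w.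
Proof.
move=> PU PM tau w [g [gs [ig igs <- Ww]]].
elim/last_ind: gs igs w Ww => [|gs h IH] igs w; first exact: PU.
have igs' k : k \in gs -> isotropy m x k.
  by move=> kgs; apply: igs; rewrite mem_rcons inE kgs orbT.
rewrite /gsetprod foldl_rcons => -[v [u [Vv Uu /gcompP e ->]]].
rewrite /gprod foldl_rcons; apply: PM => //; last 1 first.
- by apply: igs; rewrite mem_rcons inE eqxx.
- by exists g, gs; split.
- exact: IH.
Qed.

Lemma word1 u : gunits m u -> word x u.
Proof. by move=> uu; apply: word_U; [exact: isotropy1|rewrite Ux]. Qed.

Lemma isoE g h : isotropy m x g -> isotropy m x h -> s g = r h.
Proof. by move=> [_ sg] [rh _]; rewrite [LHS]sg [RHS]rh. Qed.

Lemma word_mul tau w sg v : word tau w -> word sg v -> s w = r v ->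
  word (tau ** sg) (w ** v).
Proof.
move=> Ww Wv; elim/word_ind: sg v / Wv => [g u ig Ugu|sg v h u Wv IH ih Uhu evu] e.
  exact: word_mulU.
rewrite grangeM// in e.
have e1 := isoE (word_iso Ww) (word_iso Wv); have e2 := isoE (word_iso Wv) ih.
rewrite -(gmulAE e1 e2) -(gmulAE e evu).
by apply: word_mulU; [exact: IH| | |rewrite gsourceM].
Qed.

Lemma word_inv tau w : word tau w -> word (inv tau) (inv w).
Proof.
elim/word_ind => [g u ig Ugu|{}tau {}w h u Ww IH ih Uhu e].
  by apply: word_U; [exact: isotropyV|rewrite UV//; exists u].
rewrite !ginvM//; last exact: isoE (word_iso Ww) ih.
apply: word_mul => //; last by rewrite gsourceV grangeV.
by apply: word_U; [exact: isotropyV|rewrite UV//; exists u].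
Qed.

(** Combined with the injectivity of [Phi] on the isotropy group, this makes the index of a word
    unique. *)
Lemma word_Phi tau w : word tau w -> Phi w = Phi tau.
Proof.
elim/word_ind => [g u ig Ugu|{}tau {}w h u Ww IH ih Uhu e]; first exact: PhiU.
rewrite !Phi_mul//; last exact: isoE (word_iso Ww) ih.
by rewrite IH (PhiU ih Uhu).
Qed.

Lemma word_unit w : word x w -> gunits m w.
Proof. by move=> [g [gs [ig igs e Ww]]]; exact: Uprod ig igs e _ Ww. Qed.

Lemma word_div tau sg w v : word tau w -> word sg v -> s w = s v ->
  word (gdiv m tau sg) (gdiv m w v).
Proof. by move=> Ww Wv e; apply: word_mul (word_inv Wv) _ => //; rewrite grangeV. Qed.

(** The quotient w v^-1 is a word of index tau tau^-1 = x, hence a unit by [Uprod]. *)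
Lemma word_inj tau w v : word tau w -> word tau v -> s w = s v -> w = v.
Proof.
move=> Ww Wv e; apply: (gdiv_unit e); apply: word_unit.
by have := word_div Ww Wv e; rewrite gdivgg (word_iso Ww).1.
Qed.

Section Lift.
Variables (h : G -> C) (q : G -> R) (K : set G) (l : seq G).
Hypothesis liso : forall t, t \in l -> isotropy m x t.
Hypothesis lh : forall t, isotropy m x t -> h t <> 0 -> t \in l.
Hypothesis lu : uniq l.
Hypothesis KU : forall t, t \in l -> K `<=` s @` U t.
Hypothesis qK : forall g, ~ K g -> q g = 0.

Definition lift_fun : G -> C := \sum_(t <- l) h t *: source_fun (R := R) m (U t) q.

Lemma lift_funE g : lift_fun g = \sum_(t <- l) h t * source_fun m (U t) q g.
Proof. by rewrite /lift_fun fct_sumE. Qed.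

(** The grading excludes w from every U_t with t different from tau. If tau is in [l] and q (s w) is
    nonzero, then s w is in [K], so U_tau has an element with that source, and it is w by
    [word_inj]. If tau is not in [l], both sides vanish. *)
Lemma lift_fun_word tau w : word tau w -> lift_fun w = h tau * (q (s w))%:C.
Proof.
move=> Ww; have itau := word_iso Ww; rewrite lift_funE.
have out t : t \in l -> t <> tau -> h t * source_fun m (U t) q w = 0.
  move=> tl tn; rewrite source_fun_out ?mulr0// => Utw; apply: tn.
  by apply: Phi_inj => //; [exact: liso|rewrite -(PhiU (liso tl) Utw) (word_Phi Ww)].
have [tl|tnl] := boolP (tau \in l); last first.
  have -> : h tau = 0 by apply: contrapT => /(lh itau); apply/negP.
  rewrite mul0r big_seq big1// => t tl; apply: out => // e.
  by rewrite e (negbTE tnl) in tl.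
rewrite (bigD1_seq tau)//= big_seq_cond big1 ?addr0; last first.
  by move=> t /andP[tl' /eqP]; exact: out.
congr (_ * _); have [Ks|nKs] := pselect (K (s w)).
  have [w' Uw' e] := KU tl Ks.
  by rewrite -(word_inj (word_U itau Uw') Ww e) source_funE.
rewrite qK//; have [Uw|nUw] := pselect (U tau w); last by rewrite source_fun_out.
by rewrite source_funE// qK.
Qed.

Lemma lift_fun_neq0 w : lift_fun w <> 0 -> exists tau, word tau w.
Proof.
move=> f0; apply: contrapT => nw; apply: f0.
rewrite lift_funE big_seq big1// => t tl; rewrite source_fun_out ?mulr0// => Utw.
by apply: nw; exists t; apply: word_U => //; exact: liso.
Qed.

Hypothesis q01 : forall g, 0 <= q g <= 1.

Variable (k : R).
Hypothesis hb : forall zeta : G -> C, finite_set [set t | zeta t <> 0] ->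
  zeta @^-1` [set~ 0] `<=` isotropy m x ->
  (\esum_(t in isotropy m x) (sqnorm (gact m h (zeta : G -> C^o) t))%:E <=
   \esum_(t in isotropy m x) (k ^+ 2 * sqnorm (zeta t))%:E)%E.

Section Fiber.
Variables (y : G) (xi : G -> C).
Hypothesis xif : finite_set [set g | xi g <> 0].

Let rel g b := gfiber_s m y b /\ exists tau, word tau (gdiv m g b).

Let rel_refl g : gfiber_s m y g -> rel g g.
Proof. by move=> sg; split=> //; exists x; apply: word1; exact: gunits_range. Qed.

(** Equivalent elements have equal sets [rel g], so the choice operator gives them the same base
    point; on the fiber [rel g] contains g, so the choice is a genuine one. *)
Let base g := xget y (rel g).
Let baseP g : gfiber_s m y g -> rel g (base g).
Proof. by move=> /rel_refl; exact: (@xgetI _ y (rel g) g). Qed.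

Let base_eq g b : gfiber_s m y g -> gfiber_s m y b -> (exists tau, word tau (gdiv m g b)) ->
  base g = base b.
Proof.
move=> sg sb [tau Ww]; have e : s g = s b := fiber_div sg sb.
congr xget; apply/seteqP; split=> c [sc [sigma Wc]]; split=> //.
  exists (inv tau ** sigma); rewrite -(gdivM (esym e) (fiber_div sg sc)) -(gdivV e).
  by apply: word_mul (word_inv Ww) Wc _; rewrite gsourceV !grange_div// (fiber_div sg sc).
exists (tau ** sigma); rewrite -(gdivM e (fiber_div sb sc)).
by apply: word_mul Ww Wc _; rewrite gsource_div// grange_div// (fiber_div sb sc).
Qed.

Let phi g := xget x [set tau | word tau (gdiv m g (base g))].
Let phiP g : gfiber_s m y g -> word (phi g) (gdiv m g (base g)).
Proof. by move=> /baseP[_ [tau Ww]]; exact: (@xgetI _ x [set tau | word tau (gdiv m g (base g))] tau Ww). Qed.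

Section Class.
Variable b : G.
Let X : set G := [set g | gfiber_s m y g /\ base g = b].

Let sb g : X g -> s g = s b.
Proof. by move=> [sg <-]; have [sc _] := baseP sg; exact: fiber_div sg sc. Qed.

Let phi_inj : set_inj X phi.
Proof.
move=> g g' /[!inE] Xg Xg' e; have [sg bg] := Xg; have [sg' bg'] := Xg'.
have Wg := phiP sg; have Wg' := phiP sg'; rewrite bg in Wg; rewrite bg' -e in Wg'.
have e1 := sb Xg; have e2 := sb Xg'.
rewrite -(gdivK e1) -(gdivK e2); congr (_ ** _); apply: (word_inj Wg Wg').
by rewrite !gsource_div.
Qed.

(** The restriction of xi to the class, carried to the isotropy group by [phi]. The weight q (r g)
    is the factor that [lift_fun_word] produces in the column of g, so [f] acts on the class exactly
    as [h] acts on [zeta]. *)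
Let zeta t : C :=
  if pselect (exists2 g, X g & phi g = t) is left e
  then let g := sval (cid2 e) in (q (r g))%:C * xi g else 0.

Let zetaE g : X g -> zeta (phi g) = (q (r g))%:C * xi g.
Proof.
move=> Xg; rewrite /zeta; case: pselect => [e|[]]; last by exists g.
case: cid2 => g' Xg' e' /=.
by rewrite (phi_inj _ _ e') ?inE.
Qed.

Let zeta_out t : ~ (phi @` X) t -> zeta t = 0.
Proof. by move=> nt; rewrite /zeta; case: pselect => [[g Xg e]|//]; case: nt; exists g. Qed.

Let phi_iso : phi @` X `<=` isotropy m x.
Proof. by move=> _ [g [sg _] <-]; exact: word_iso (phiP sg). Qed.

Let gact_class g : X g ->
  gact m lift_fun (xi : G -> C^o) g = gact m h (zeta : G -> C^o) (phi g).
Proof.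
move=> Xg; have [sg bg] := Xg; have Wg := phiP sg; rewrite bg in Wg.
have ig := word_iso Wg; rewrite !gactE (_ : s (phi g) = x); last exact: ig.2.
rewrite (_ : s g = y)//.
rewrite -(@fsbig_widen _ _ _ _ X (gfiber_s m y)); first last.
- move=> c [sc nX] /=.
  suff -> : lift_fun (gdiv m g c) = 0 by rewrite scale0r.
  apply: contrapT => /lift_fun_neq0[tau Wt]; apply: nX; split=> //.
  by rewrite -bg; apply/esym/base_eq => //; exists tau.
- by move=> c [].
rewrite -(@fsbig_widen _ _ _ _ (phi @` X) (gfiber_s m x)); first last.
- by move=> t [_ nt] /=; rewrite zeta_out// scaler0.
- by move=> t /phi_iso[].
rewrite fsbig_image//; apply: eq_fsbigr => c /[!inE] Xc.
have [sc bc] := Xc; have Wc := phiP sc; rewrite bc in Wc.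
have e1 := sb Xg; have e2 := sb Xc.
have Wgc : word (gdiv m (phi g) (phi c)) (gdiv m g c).
  have -> : gdiv m g c = gdiv m (gdiv m g b) (gdiv m c b).
    by rewrite {2}/gdiv (gdivV e2) gdivM// -e2.
  by apply: word_div Wg Wc _; rewrite !gsource_div.
rewrite (lift_fun_word Wgc) zetaE// gsource_div ?e1// /GRing.scale /=.
by rewrite mulrA.
Qed.

(** The class sum of |f xi|^2 is part of the sum of |h zeta|^2 over the isotropy group, which is at
    most k^2 times that of |zeta|^2; and |zeta| <= |xi| along [phi] because 0 <= q <= 1. *)
Lemma lift_fun_bound_class :
  (\esum_(g in X) (sqnorm (gact m lift_fun (xi : G -> C^o) g))%:E <=
   \esum_(g in X) (k ^+ 2 * sqnorm (xi g))%:E)%E.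
Proof.
have k20 := sqr_ge0 k.
have zfin : finite_set [set t | zeta t <> 0].
  apply: sub_finite_set (finite_image phi xif) => t /= zt.
  have [g Xg e] : (phi @` X) t by apply: contrapT => /zeta_out.
  by exists g => // x0; apply: zt; rewrite -e zetaE// x0 mulr0.
have ziso : zeta @^-1` [set~ 0] `<=` isotropy m x.
  by move=> t /= zt; apply: phi_iso; apply: contrapT => /zeta_out.
rewrite (eq_esum (b := fun g => (sqnorm (gact m h (zeta : G -> C^o) (phi g)))%:E)); last first.
  by move=> g Xg; rewrite gact_class.
rewrite -(@esum_image _ _ _ X phi (fun t => (sqnorm (gact m h (zeta : G -> C^o) t))%:E) phi_inj).
apply: (@le_trans _ _ (\esum_(t in isotropy m x) (sqnorm (gact m h (zeta : G -> C^o) t))%:E)%E).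
  by apply: esum_subset => // t _; rewrite lee_fin sqnorm_ge0.
apply: le_trans (hb zfin ziso) _.
rewrite -(@esum_widen _ _ _ (phi @` X))//; last first.
  by move=> t _ nt; rewrite zeta_out// sqnorm0 mulr0.
rewrite esum_image//; apply: le_esum => g Xg.
rewrite lee_fin zetaE// sqnormM sqnormR ler_wpM2l// ler_piMl ?sqnorm_ge0//.
by have /andP[q0 q1] := q01 (r g); rewrite expr_le1.
Qed.

End Class.

Lemma lift_fun_bound :
  (\esum_(g in gfiber_s m y) (sqnorm (gact m lift_fun (xi : G -> C^o) g))%:E <=
   \esum_(g in gfiber_s m y) (k ^+ 2 * sqnorm (xi g))%:E)%E.
Proof.
pose X b : set G := [set g | gfiber_s m y g /\ base g = b].
have XA b g : (base @` gfiber_s m y) b -> X b g -> gfiber_s m y g /\ base g = b by [].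
have AX g : gfiber_s m y g -> (base @` gfiber_s m y) (base g) /\ X (base g) g.
  by move=> sg; split=> //; exists g.
rewrite (esum_partition XA AX); last by move=> g _; rewrite lee_fin sqnorm_ge0.
rewrite (esum_partition XA AX); last first.
  by move=> g _; rewrite lee_fin mulr_ge0 ?sqr_ge0 ?sqnorm_ge0.
by apply: le_esum => b _; exact: lift_fun_bound_class.
Qed.

End Fiber.
End Lift.
End Words.

(** * The inequality [norm_e <= norm_r] *)

Lemma poweR12_le (R : realType) (A : \bar R) (k : R) : (0 <= A)%E -> 0 <= k ->
  (A `^ 2^-1 <= k%:E)%E = (A <= (k ^+ 2)%:E)%E.
Proof.
case: A => [a| |] // a0 k0; rewrite poweR12_sqrt//=.
rewrite !lee_fin in a0 *; rewrite -{1}(ger0_norm k0) -sqrtr_sqr ler_sqrt//.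
exact: sqr_ge0.
Qed.

Lemma esum_leP (R : realType) (I : choiceType) (A : set I) (a : I -> R) (M : R) :
  (forall F, finite_set F -> F `<=` A -> \sum_(i \in F) a i <= M) ->
  (\esum_(i in A) (a i)%:E <= M%:E)%E.
Proof.
move=> h; apply: ge_ereal_sup => _ [F [fF FA] <-].
by rewrite fsumEFin// lee_fin; exact: h.
Qed.

Lemma fsum_le_esum (R : realType) (I : choiceType) (A F : set I) (a : I -> R) (M : R) :
  finite_set F -> F `<=` A -> (\esum_(i in A) (a i)%:E <= M%:E)%E ->
  \sum_(i \in F) a i <= M.
Proof.
move=> fF FA h; rewrite -lee_fin; apply: le_trans h; rewrite -fsumEFin//.
by apply: ereal_sup_ubound; exists F.
Qed.

(** * Regular representations and their norms on finitely supported vectors *)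

Section Norms.
Variables (R : realType) (G : topologicalType) (m : groupoid G).
Local Notation C := R[i].
Local Notation r := (grange m).
Local Notation s := (gsource m).

Lemma Re_norm_sqr (z : C) : (complex.Re `|z|) ^+ 2 = sqnorm z.
Proof. by rewrite normc_def /= sqr_sqrtr// addr_ge0 ?sqr_ge0. Qed.

Lemma l2norm_le (S : set G) (xi : G -> C) (k : R) : 0 <= k ->
  (l2norm S xi <= k%:E)%E = (\esum_(g in S) (sqnorm (xi g))%:E <= (k ^+ 2)%:E)%E.
Proof.
move=> k0; rewrite /l2norm poweR12_le//; last first.
  by apply: esum_ge0 => g _; rewrite lee_fin sqr_ge0.
by congr (_ <= _)%E; apply: eq_esum => g _; rewrite Re_norm_sqr.
Qed.

Lemma regular_colE (f : G -> C) g k : fiber_finite m f -> s k = s g ->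
  regular_col m f g k = f (gdiv m k g).
Proof.
move=> ff e; rewrite /regular_col.
rewrite (@fsum_morph _ _ _ (fun F : G -> C => F k)) //; last first.
  apply: sub_finite_set (proj2 (ff (r g))) => h [/= sh n0]; split=> // f0.
  by apply: n0; rewrite f0 scale0r.
rewrite -(@fsbig_widen _ _ _ _ [set gdiv m k g]).
- by rewrite fsbig_set1 fctE /gdelta gdivK// indicE mem_set// /GRing.scale /= mulr1.
- by move=> _ -> /=; rewrite /gfiber_s /= gsource_div.
- move=> h [/= sh nh] /=; rewrite fctE /gdelta indicE memNset ?scaler0//.
  by move=> /= kh; apply: nh; rewrite kh gmulgK_div.
Qed.

Lemma regularE (S : set G) y (f xi : G -> C) k : fiber_finite m f -> S `<=` gfiber_s m y ->
  (forall g, ~ S g -> xi g = 0) -> gfiber_s m y k ->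
  regular m S f xi k = gact m f (xi : G -> C^o) k.
Proof.
move=> ff SG xi0 sk; rewrite gactE [s k]sk /regular.
rewrite -(@fsbig_widen _ _ _ _ S (gfiber_s m y))//; last first.
  by move=> g [sg nS] /=; rewrite xi0// scaler0.
apply: eq_fsbigr => g /[!inE] /SG sg; rewrite regular_colE//.
  by rewrite mulrC.
exact: fiber_div sk sg.
Qed.

Lemma regular_norm_ge0 (S : set G) (f : G -> C) : (0 <= regular_norm m S f)%E.
Proof.
apply: (@le_trans _ _ (l2norm S (regular m S f 0))); first exact: poweR_ge0.
apply: ereal_sup_ubound; exists 0 => //; split=> //.
by rewrite l2norm_le ?ler01// esum1 ?lee_fin ?sqr_ge0// => g _; rewrite sqnorm0.
Qed.

(* Bounds on finitely supported vectors extend to all of l^2 by lower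
   semicontinuity, because the rows of [gact m f] are finite. *)
Lemma regular_norm_le y (f : G -> C) (k : R) : fiber_finite m f -> 0 <= k ->
  (forall xi : G -> C, (forall g, ~ gfiber_s m y g -> xi g = 0) ->
    finite_set [set g | xi g <> 0] ->
    (\esum_(g in gfiber_s m y) (sqnorm (gact m f (xi : G -> C^o) g))%:E <=
     \esum_(g in gfiber_s m y) (k ^+ 2 * sqnorm (xi g))%:E)%E) ->
  (regular_norm m (gfiber_s m y) f <= k%:E)%E.
Proof.
move=> ff k0 hf; apply: ge_ereal_sup => _ [xi [xi0 xi1] <-].
rewrite l2norm_le ?ler01// expr1n in xi1; rewrite l2norm_le//.
apply: esum_leP => F fF FG.
pose P := \bigcup_(g in F) [set k | gfiber_s m (s g) k /\ f (gdiv m g k) <> 0].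
have fP : finite_set P by apply: bigcup_finite => // g _; exact: fiber_finite_row.
pose xiP g : C := if g \in P then xi g else 0.
have xiP_out g : ~ P g -> xiP g = 0 by move=> nP; rewrite /xiP memNset.
have xiP0 g : ~ gfiber_s m y g -> xiP g = 0.
  by move=> ng; rewrite /xiP; case: ifP => // _; exact: xi0.
have xiPf : finite_set [set g | xiP g <> 0].
  apply: sub_finite_set fP => g /= n0; apply: contrapT => nP; apply: n0.
  exact: xiP_out.
have PG : P `<=` gfiber_s m y.
  by move=> g [h Fh [sg _]]; rewrite /gfiber_s /= [LHS]sg (FG h Fh).
have -> : \sum_(i \in F) sqnorm (regular m (gfiber_s m y) f xi i) =
    \sum_(i \in F) sqnorm (gact m f (xiP : G -> C^o) i).
  apply: eq_fsbigr => g /[!inE] Fg.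
  rewrite (@regularE _ y)//; last exact: FG.
  congr sqnorm; rewrite !gactE; apply: eq_fsbigr => h /[!inE] sh.
  have [Ph|nP] := pselect (P h); first by rewrite /xiP mem_set.
  rewrite xiP_out// scaler0.
  have -> : f (gdiv m g h) = 0 by apply: contrapT => f0; apply: nP; exists g.
  by rewrite scale0r.
apply: (fsum_le_esum fF FG); apply: le_trans (hf _ xiP0 xiPf) _.
rewrite -(@esum_widen _ _ _ P)//; last first.
  by move=> g _ nP; rewrite xiP_out// sqnorm0 mulr0.
rewrite esum_finite//; first last.
- by apply: sub_finite_set fP => g [].
- by move=> g _; rewrite mulr_ge0 ?sqr_ge0 ?sqnorm_ge0.
rewrite -mulr_fsumr lee_fin -[leRHS]mulr1 ler_wpM2l ?sqr_ge0//.
apply: (fsum_le_esum fP PG); apply: le_trans xi1.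
apply: le_esum => g _; rewrite /xiP lee_fin; case: ifP => // _.
by rewrite sqnorm0 sqnorm_ge0.
Qed.

Section GroupBound.
Variables (x : G) (h : G -> C).
Hypothesis gh : group_algebra m x h.

Lemma group_algebra_finite : fiber_finite m h.
Proof.
move=> z; have fh : finite_set [set g | h g <> 0].
  by apply: sub_finite_set gh.1 => g /= /eqP.
by split; apply: sub_finite_set fh => g [].
Qed.

Lemma norm_r_bound (k : R) (zeta : G -> C) : 0 <= k -> (norm_r m x h <= k%:E)%E ->
  finite_set [set t | zeta t <> 0] -> zeta @^-1` [set~ 0] `<=` isotropy m x ->
  (\esum_(t in isotropy m x) (sqnorm (gact m h (zeta : G -> C^o) t))%:E <=
   \esum_(t in isotropy m x) (k ^+ 2 * sqnorm (zeta t))%:E)%E.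
Proof.
move=> k0 hk zf ziso; have hf := group_algebra_finite.
have z0 g : ~ isotropy m x g -> zeta g = 0.
  by move=> ng; apply: contrapT => /ziso.
have sf : finite_set [set i | isotropy m x i /\ sqnorm (zeta i) <> 0].
  apply: sub_finite_set zf => t [_ n0] /= e; apply: n0; rewrite e.
  exact: sqnorm0.
rewrite [leRHS]esum_finite; first last.
- apply: sub_finite_set sf => t [it n0]; split=> // e.
  by apply: n0; rewrite e mulr0.
- by move=> g _; rewrite mulr_ge0 ?sqr_ge0 ?sqnorm_ge0.
rewrite -mulr_fsumr; set N := \sum_(i \in _) _.
have N0 : 0 <= N by apply: fsumr_ge0 => t _; exact: sqnorm_ge0.
have eN : (\esum_(t in isotropy m x) (sqnorm (zeta t))%:E = N%:E)%E.
  by rewrite esum_finite// => t _; exact: sqnorm_ge0.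
have [N_0|Nn0] := eqVneq N 0.
  have zz t : zeta t = 0.
    have [it|/z0//] := pselect (isotropy m x t).
    have : sqnorm (zeta t) <= 0.
      have -> : sqnorm (zeta t) = \sum_(t \in [set t]) sqnorm (zeta t) by rewrite fsbig_set1.
      rewrite -[leRHS]N_0.
      apply: (@fsum_le_esum _ _ (isotropy m x)); [exact: finite_set1| |].
        by move=> _ ->.
      by rewrite eN.
    by move=> z; apply: sqnorm_eq0; apply/eqP; rewrite eq_le z sqnorm_ge0.
  rewrite N_0 mulr0 esum1// => t _.
  have -> : gact m h (zeta : G -> C^o) t = 0.
    by apply: fsbig1 => u _; rewrite zz scaler0.
  by rewrite sqnorm0.
have Np : 0 < N by rewrite lt_def Nn0.
(* [norm_r] is a supremum over the unit ball, so [zeta] is normalized; vectors of norm zero were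
   treated above. *)
pose c : R := (Num.sqrt N)^-1.
have c2 : c ^+ 2 = N^-1 by rewrite exprVn sqr_sqrtr.
pose xi : G -> C := fun t => c%:C * zeta t.
have xi0 g : ~ isotropy m x g -> xi g = 0 by move=> ng; rewrite /xi z0// mulr0.
have xi1 : (l2norm (isotropy m x) xi <= 1%:E)%E.
  rewrite l2norm_le ?ler01// expr1n esum_finite.
  - rewrite lee_fin (eq_fsbigr (fun t => N^-1 * sqnorm (zeta t))).
      by rewrite -mulr_fsumr mulVf.
    by move=> t _; rewrite /xi sqnormM sqnormR c2.
  - by move=> t _; exact: sqnorm_ge0.
  - apply: sub_finite_set sf => t [it n0]; split=> // e.
    by apply: n0; rewrite /xi sqnormM e mulr0.
have := hk; rewrite /norm_r /regular_norm => /(le_trans _) hk'.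
have : (l2norm (isotropy m x) (regular m (isotropy m x) h xi) <= k%:E)%E.
  by apply: hk'; apply: ereal_sup_ubound; exists xi.
rewrite l2norm_le// => hx; apply: esum_leP => F fF FI.
have := fsum_le_esum fF FI hx.
have -> : \sum_(i \in F) sqnorm (regular m (isotropy m x) h xi i) =
    N^-1 * \sum_(i \in F) sqnorm (gact m h (zeta : G -> C^o) i).
  rewrite mulr_fsumr; apply: eq_fsbigr => t /[!inE] /FI it.
  have IG : isotropy m x `<=` gfiber_s m x by move=> t' [].
  rewrite (regularE hf IG xi0 it.2).
  rewrite -c2 -sqnormR -sqnormM; congr sqnorm.
  rewrite -[xi]/(c%:C *: (zeta : G -> C^o)) -[_ *: _]addr0 gactDr//.
  rewrite fctE; suff -> : gact m h (0 : G -> C^o) t = 0 by rewrite addr0.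
  by apply: fsbig1 => u _; rewrite scaler0.
by rewrite mulrC ler_pdivrMr.
Qed.

End GroupBound.

Section FiberRep.
Variable y : G.
Definition re_form (u v : C) : R := complex.Re (u * v^*).

Lemma re_form_space : form_space (setT : set C^o) re_form.
Proof.
split=> //.
- by move=> c [a b] [a' b'] [d e] _ _ _; rewrite /re_form /=; ring.
- by move=> [a b] [a' b'] _ _; rewrite /re_form /=; ring.
- by move=> [a b] _; rewrite /re_form /= mulrN opprK -!expr2 addr_ge0 ?sqr_ge0.
Qed.

Lemma re_formJ (c : C) (u v : C^o) : re_form (c *: u) v = re_form u (c^* *: v).
Proof.
by case: c u v => c d [a b] [a' b']; rewrite /re_form /=; ring.
Qed.

Lemma re_formE (u : C) : re_form u u = sqnorm u.
Proof. by case: u => a b; rewrite /re_form /sqnorm /=; ring. Qed.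

Definition fiber_dom : set (G -> C^o) :=
  ind_dom m y [set y] (gfiber_s m y) (fun _ u => u).
Definition fiber_form : (G -> C^o) -> (G -> C^o) -> R := ind_form re_form (gfiber_s m y).

Hypothesis uy : gunits m y.

(** Induction from the trivial subgroup {y}: each element of the fiber is its own representative. *)
Lemma fiber_rep (A : set (G -> C)) : A `<=` fiber_finite m ->
  form_rep A (gconv m) (fstar m) fiber_dom fiber_form (@gact R G m C^o).
Proof.
apply: (ind_form_rep re_form_space re_formJ (tau := id)) => //.
- by move=> _ ->; exact: isotropy1.
- by move=> _ ->; exact: ginv_unit.
- by move=> k sk; exists y => //; rewrite -[LHS](gmul_sourceE m) sk.
- by move=> g _ sg ->; rewrite -[RHS](gmul_sourceE m) sg.
Qed.

Lemma fiber_domP (xi : G -> C) : fiber_dom xi <->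
  (forall g, ~ gfiber_s m y g -> xi g = 0) /\ finite_set [set g | xi g <> 0].
Proof.
split=> [[x0 _ xf]|[x0 xf]]; split=> //.
- apply: sub_finite_set xf => g n0; split=> //.
  by apply: contrapT => ng; apply: n0; rewrite x0.
- move=> g _ sg ->; have -> // : gmul m g y = g by rewrite -[RHS](gmul_sourceE m) sg.
- by apply: sub_finite_set xf => g [].
Qed.

Lemma fiber_formE (xi : G -> C) : fiber_dom xi ->
  (\esum_(g in gfiber_s m y) (sqnorm (xi g))%:E = (fiber_form xi xi)%:E)%E.
Proof.
move=> /fiber_domP[x0 xf]; rewrite esum_finite.
- by congr (_%:E); apply: eq_fsbigr => g _; rewrite re_formE.
- by move=> g _; exact: sqnorm_ge0.
- by apply: sub_finite_set xf => g [_ n0] /= e; apply: n0; rewrite e sqnorm0.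
Qed.

Lemma fiber_opbound (f : G -> C) (k : R) : fiber_finite m f -> 0 <= k ->
  opbound fiber_dom fiber_form (@gact R G m C^o f) k <->
  (forall xi : G -> C, (forall g, ~ gfiber_s m y g -> xi g = 0) ->
    finite_set [set g | xi g <> 0] ->
    (\esum_(g in gfiber_s m y) (sqnorm (gact m f (xi : G -> C^o) g))%:E <=
     \esum_(g in gfiber_s m y) (k ^+ 2 * sqnorm (xi g))%:E)%E).
Proof.
move=> ff k0; have fF : [set f] `<=` fiber_finite m by move=> _ ->.
have rp := fiber_rep fF; have fs := rep_space rp.
have key (xi : G -> C^o) : fiber_dom xi ->
    (fnorm fiber_form (gact m f xi) <= k * fnorm fiber_form xi) =
    (\esum_(g in gfiber_s m y) (sqnorm (gact m f xi g))%:E <=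
     \esum_(g in gfiber_s m y) (k ^+ 2 * sqnorm (xi g))%:E)%E.
  move=> Dx; have Df : fiber_dom (gact m f xi) := rep_dom rp (erefl f) Dx.
  rewrite fiber_formE// [in RHS]esum_finite; first last.
  - have /fiber_domP[_ xf] := Dx; apply: sub_finite_set xf => g [_ n0] /= e.
    by apply: n0; rewrite e sqnorm0 mulr0.
  - by move=> g _; rewrite mulr_ge0 ?sqr_ge0 ?sqnorm_ge0.
  rewrite lee_fin -mulr_fsumr (fnorm_le fs)// ?mulr_ge0 ?fnorm_ge0//.
  rewrite exprMn (sqr_fnorm fs)//; congr (_ <= _ * _).
  by apply: eq_fsbigr => g _; rewrite re_formE.
split=> [h xi x0 xf|h xi Dx].
  by rewrite -key; [apply: h|]; exact/fiber_domP.
by rewrite key//; have [x0 xf] := (fiber_domP xi).1 Dx; exact: h.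
Qed.

End FiberRep.
End Norms.

(** * Hilbert spaces, cosets of the isotropy group and induced representations *)

Section HilbertForm.
Variables (R : realType) (H : hilbert R).

Definition hform (u v : H) : R := complex.Re (hdot H u v).

Lemma hdotC u v : hdot H u v = (hdot H v u)^*.
Proof. by have := @hermitian_subproof _ _ _ _ (hdot H) u v; rewrite expr0 mul1r. Qed.

Lemma hform_space : form_space setT hform.
Proof.
split=> //.
- move=> c u v w _ _ _; rewrite /hform linearPl /=.
  by case: (hdot H u w) (hdot H v w) => a b [a' b'] /=; ring.
- by move=> u v _ _; rewrite /hform hdotC; case: (hdot H v u).
- move=> u _; rewrite /hform; have [->|u0] := eqVneq u 0; first by rewrite linear0l.
  by have := neq0_dnorm_gt0 (s := hdot H) u u0; rewrite ltcE => /andP[_ /ltW].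
Qed.

Lemma hformJ (c : R[i]) (u v : H) : hform (c *: u) v = hform u (c^* *: v).
Proof.
rewrite /hform [hdot H u (_ *: _)]hdotC !linearZl_LR /= [hdot H u v]hdotC.
by case: (hdot H v u) => a b; case: c => c d /=; ring.
Qed.

Lemma hnormE (v : H) : hnorm v = fnorm hform v. Proof. by []. Qed.

Lemma star_rep_form_rep (W : lmodType R[i]) (A : set W) mul star pi :
  star_rep A mul star pi -> form_rep A mul star setT hform (pi : W -> H -> H).
Proof.
move=> [p1 p2 p3 p4 p5]; split.
- exact: hform_space.
- by move=> a Aa; split=> // c u v _ _; exact: p1.
- by move=> c a b v Aa Ab _; exact: p3.
- by move=> a b v Aa Ab _; exact: p4.
- by move=> a u v Aa _ _ _; rewrite /hform p5.
Qed.

End HilbertForm.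

Lemma form_rep_sub (R : realType) (W V : lmodType R[i]) (A B : set W) mul star
    (D : set V) form pi : A `<=` B ->
  form_rep B mul star D form pi -> form_rep A mul star D form pi.
Proof.
move=> AB [p1 p2 p3 p4 p5]; split=> //.
- by move=> a /AB; exact: p2.
- by move=> c a b v /AB Ba /AB Bb; exact: p3.
- by move=> a b v /AB Ba /AB Bb; exact: p4.
- by move=> a u v /AB Ba /AB Bb; exact: p5.
Qed.

Section GroupAlgebra.
Variables (R : realType) (G : topologicalType) (m : groupoid G) (x : G).
Local Notation C := R[i].
Local Notation r := (grange m).
Local Notation s := (gsource m).
Local Notation "a ** b" := (gmul m a b).
Local Notation inv := (ginv m).
Local Notation delta := (gdelta R (G := G)).
Hypothesis ux : gunits m x.

Lemma gdeltaE t g : delta t g = (g == t)%:R.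
Proof.
rewrite /gdelta indicE; have [->|gt] := eqVneq g t; first by rewrite mem_set.
by rewrite memNset//; apply/eqP.
Qed.

Lemma group_algebra_delta t : isotropy m x t -> group_algebra m x (delta t).
Proof.
move=> it; have sub : [set g | delta t g != 0] `<=` [set t].
  move=> g /=; rewrite gdeltaE; have [//|_] := eqVneq g t.
  by rewrite mulr0n eqxx.
split; first exact: sub_finite_set sub (finite_set1 t).
by move=> g /sub ->.
Qed.

Lemma fstar_delta t : fstar m (delta t) = delta (inv t).
Proof.
apply/funext => g; rewrite /fstar !gdeltaE; have [<-|gt] := eqVneq (inv g) t.
  by rewrite ginvK eqxx conjC1.
have [e|_] := eqVneq g (inv t); last by rewrite conjC0.
by rewrite e ginvK eqxx in gt.
Qed.

Lemma gconv_delta_l a (f : G -> C) g : r g = r a -> gconv m (delta a) f g = f (inv a ** g).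
Proof.
move=> e; rewrite /gconv -(@fsbig_widen _ _ _ _ [set a]).
- by rewrite fsbig_set1 gdeltaE eqxx mul1r.
- by move=> _ ->; rewrite /gfiber_r /= e.
- move=> h [_ nh] /=; rewrite gdeltaE; case: eqVneq => [e'|]; last by rewrite mul0r.
  by case: nh.
Qed.

Lemma gconv_delta_out a (f : G -> C) g : r g <> r a -> gconv m (delta a) f g = 0.
Proof.
move=> ne; apply: fsbig1 => h rh; rewrite gdeltaE.
have [e|_] := eqVneq h a; last by rewrite mul0r.
by case: ne; rewrite -e; exact/esym.
Qed.

Lemma gconv_delta a b : isotropy m x a -> isotropy m x b ->
  gconv m (delta a) (delta b) = delta (a ** b).
Proof.
move=> ia ib; have e := isoE ia ib; apply/funext => g.
have [rg|rg] := pselect (r g = r a); last first.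
  rewrite gconv_delta_out// gdeltaE; case: eqVneq => // eg.
  by case: rg; rewrite eg grangeM.
rewrite gconv_delta_l// !gdeltaE; suff -> : (inv a ** g == b) = (g == a ** b) by [].
by apply/eqP/eqP => [<-|->]; [rewrite gmulKVE|rewrite gmulKE].
Qed.

Lemma gconv_delta1 (h : G -> C) : group_algebra m x h -> gconv m (delta x) h = h.
Proof.
move=> [_ hi]; apply/funext => g; have rx := gunits_rangeE ux.
have [rg|rg] := pselect (r g = x).
  by rewrite gconv_delta_l ?rx// (ginv_unit ux) isotropy_mul1g.
rewrite gconv_delta_out ?rx//; apply/esym/eqP; apply: contraPT (rg) => h0 /=.
by have [] := hi g h0.
Qed.

Lemma group_algebra_subspace (c : C) a b : group_algebra m x a -> group_algebra m x b ->
  group_algebra m x (c *: a + b).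
Proof.
move=> [fa ia] [fb ib].
have sub : [set g | (c *: a + b) g != 0] `<=` [set g | a g != 0] `|` [set g | b g != 0].
  move=> g /=; rewrite !fctE; have [->|] := eqVneq (a g) 0; last by left.
  by rewrite scaler0 add0r; right.
split; first by apply: sub_finite_set sub _; rewrite finite_setU.
by move=> g /sub[/ia|/ib].
Qed.

Lemma group_algebra0 : group_algebra m x (0 : G -> C).
Proof.
have e : [set g | (0 : G -> C) g != 0] = set0.
  by apply/seteqP; split=> g //=; rewrite eqxx.
by split; rewrite e; [exact: finite_set0|].
Qed.

Lemma group_algebra_sum (h : G -> C) : group_algebra m x h ->
  h = \sum_(t <- fset_set [set t | h t != 0]) h t *: delta t.
Proof.
move=> [fh hi]; apply/funext => g; rewrite fct_sumE.
rewrite (eq_bigr (fun t => h t * delta t g)) => [|t _ //].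
have [hg|hg] := boolP (g \in fset_set [set t | h t != 0]).
  rewrite (bigD1_seq g hg (fset_uniq _)) /= gdeltaE eqxx mulr1 big1 ?addr0// => t /negbTE tg.
  by rewrite gdeltaE eq_sym tg mulr0.
rewrite big_seq big1 => [|t tl].
  by apply/eqP; apply: contraNT hg => h0; rewrite in_fset_set// inE.
rewrite gdeltaE; have [e|_] := eqVneq g t; last by rewrite mulr0.
by rewrite e tl in hg.
Qed.

Definition coset g : set G := [set g ** h | h in isotropy m x].

Lemma coset_mul g t : gfiber_s m x g -> isotropy m x t -> coset (g ** t) = coset g.
Proof.
move=> sg it; have e : s g = r t by rewrite [LHS]sg [RHS]it.1.
apply/seteqP; split=> _ [h ih <-].
  by exists (t ** h); [exact: isotropyM|rewrite gmulAE// (isoE it ih)].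
have iV := isotropyV it.
exists (inv t ** h); first exact: isotropyM.
by rewrite gmulAE ?gmulKVE ?grangeM ?grangeV// ?gsourceV ?(isoE it (isotropy1 ux))//;
  rewrite [RHS]ih.1 ?it.1 ?it.2.
Qed.

Lemma coset_in g : gfiber_s m x g -> coset g g.
Proof. by move=> sg; exists x; [exact: isotropy1|rewrite -[RHS](gmul_sourceE m) sg]. Qed.

Lemma coset_xget g : gfiber_s m x g -> coset g (xget x (coset g)).
Proof. by move=> /coset_in; exact: xgetI. Qed.

Lemma coset_fiber g k : gfiber_s m x g -> coset g k -> gfiber_s m x k /\ coset k = coset g.
Proof.
move=> sg [t it <-]; have e : s g = r t by rewrite [LHS]sg [RHS]it.1.
by split; [rewrite /gfiber_s /= gsourceM//; exact: it.2|exact: coset_mul].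
Qed.

Definition coset_rep g : G := xget x (coset g).
(** The same representatives as those chosen in [ind_l2norm], so that the norm of the form agrees
    with it literally. *)
Definition transversal : set G := xget x @` isotropy_cosets m x.

Lemma transversal_fiber : transversal `<=` gfiber_s m x.
Proof.
by move=> _ [_ [g sg <-] <-]; have [] := coset_fiber sg (coset_xget sg).
Qed.

Lemma coset_repT k : gfiber_s m x k -> transversal (coset_rep k).
Proof. by move=> sk; exists (coset k) => //; exists k. Qed.

Lemma coset_repE k : gfiber_s m x k ->
  exists2 t, isotropy m x t & k = coset_rep k ** t.
Proof.
move=> sk; have [t it e] := coset_xget sk; exists (inv t); first exact: isotropyV.
by rewrite /coset_rep -e gmulEK// [LHS]sk [RHS]it.1.
Qed.

Lemma coset_repK g t : transversal g -> isotropy m x t -> coset_rep (g ** t) = g.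
Proof.
move=> Tg it; have sg := transversal_fiber Tg; case: Tg sg => _ [g0 sg0 <-] <- sg.
rewrite /coset_rep coset_mul//.
by have [_ ->] := coset_fiber sg0 (coset_xget sg0).
Qed.

Lemma xget_coset_inj : set_inj (isotropy_cosets m x) (xget x).
Proof.
move=> _ _ /[!inE] -[g sg <-] [g' sg' <-] e.
have [_ e1] := coset_fiber sg (coset_xget sg).
have [_ e2] := coset_fiber sg' (coset_xget sg').
by rewrite -[LHS]/(coset g) -[RHS]/(coset g') -e1 -e2; congr coset; exact: e.
Qed.

Section IsotropyRep.
Variables (H : hilbert R) (rho : (G -> C) -> H -> H).
Hypothesis hr : isotropy_rep m x rho.

Let E t := rho (fstar m (delta t)).

Lemma E_delta t : E t = rho (delta (inv t)). Proof. by rewrite /E fstar_delta. Qed.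

Lemma rho_sum h v : group_algebra m x h ->
  rho h v = \sum_(t <- fset_set [set t | h t != 0]) h t *: rho (delta t) v.
Proof.
move=> gh; rewrite {1}(group_algebra_sum gh).
have : forall t, t \in enum_fset (fset_set [set t | h t != 0]) -> isotropy m x t.
  by move=> t; rewrite in_fset_set ?inE; [exact: gh.2|exact: gh.1].
elim: (enum_fset _) => [|t l IH] li.
  rewrite !big_nil; have := rep_linear hr (-1) group_algebra0 group_algebra0 v.
  by rewrite !scaleN1r !addNr.
have li' u : u \in l -> isotropy m x u by move=> ul; apply: li; rewrite inE ul orbT.
have it : isotropy m x t by apply: li; rewrite inE eqxx.
rewrite !big_cons (rep_linear hr) ?IH//; first exact: group_algebra_delta.
elim: l li' {IH li} => [|u l IH] li; first by rewrite big_nil; exact: group_algebra0.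
rewrite big_cons; apply: group_algebra_subspace.
  by apply: group_algebra_delta; apply: li; rewrite inE eqxx.
by apply: IH => w wl; apply: li; rewrite inE wl orbT.
Qed.

Definition iso_ind_dom := ind_dom m x (isotropy m x) transversal E.
Definition iso_ind_form := ind_form (@hform R H) transversal.

Lemma iso_ind_rep (A : set (G -> C)) : A `<=` fiber_finite m ->
  form_rep A (gconv m) (fstar m) iso_ind_dom iso_ind_form (@gact R G m H).
Proof.
have Ad t : isotropy m x t -> group_algebra m x (fstar m (delta t)).
  by move=> it; rewrite fstar_delta; apply: group_algebra_delta; exact: isotropyV.
apply: (ind_form_rep (hform_space H) (@hformJ R H) (tau := coset_rep)) => //.
- by move=> t; exact: isotropyV.
- by move=> t it c u v; exact: (rep_oplinear hr (Ad t it)).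
- move=> t u v it; rewrite /hform /E (rep_star hr (Ad t it)).
  by rewrite !fstar_delta !ginvK.
- exact: transversal_fiber.
- exact: coset_repT.
- exact: coset_repE.
- exact: coset_repK.
Qed.

Lemma ind_l2normE xi : iso_ind_dom xi -> ind_l2norm m x xi = (fnorm iso_ind_form xi)%:E.
Proof.
move=> [x0 _ xf]; rewrite /ind_l2norm /fnorm.
have -> : (\esum_(c in isotropy_cosets m x) ((hnorm (xi (xget x c))) ^+ 2)%:E =
    (iso_ind_form xi xi)%:E)%E.
  rewrite -(@esum_image _ _ _ _ (xget x) (fun g => ((hnorm (xi g)) ^+ 2)%:E) xget_coset_inj).
  rewrite -/transversal esum_finite.
  - congr (_%:E); apply: eq_fsbigr => g _.
    by rewrite hnormE (sqr_fnorm (hform_space H)).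
  - by move=> g _; exact: sqr_ge0.
  - apply: sub_finite_set xf => g [Tg n0]; split=> // e; apply: n0.
    by rewrite e hnormE (fnorm0 (hform_space H)) expr0n.
rewrite poweR12_sqrt// lee_fin; apply: fsumr_ge0 => g _.
exact: (form_ge0 (hform_space H)).
Qed.

(** The vector of [Ind rho] concentrated on the trivial coset. Its value at x is the image of v
    under u_x, which may differ from v because representations are allowed to be degenerate; hence
    the inequality in [fnorm_iso_vector]. *)
Definition iso_vector (v : H) : G -> H := fun g =>
  if g \in isotropy m x then E g v else 0.

Lemma E_mul t u v : isotropy m x t -> isotropy m x u -> E (t ** u) v = E u (E t v).
Proof.
move=> it iu; rewrite !E_delta ginvM ?(isoE it iu)//.
have gt := group_algebra_delta (isotropyV it); have gu := group_algebra_delta (isotropyV iu).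
by rewrite -(rep_mul hr gu gt) gconv_delta//; exact: isotropyV.
Qed.

(** E t is the image of u_t^*, and u_t u_t^* = u_x; so the norm of E t v does not depend on t. *)
Lemma hform_E t v : isotropy m x t -> hform (E t v) (E t v) = hform (rho (delta x) v) v.
Proof.
move=> it; have gV := group_algebra_delta (isotropyV it).
rewrite E_delta /hform [hdot H (rho _ v) _](rep_star hr gV) fstar_delta ginvK.
rewrite -(rep_mul hr (group_algebra_delta it) gV) gconv_delta//; last exact: isotropyV.
rewrite (isotropy_mulV it); have gx := group_algebra_delta (isotropy1 ux).
by rewrite (rep_star hr gx) fstar_delta (ginv_unit ux).
Qed.

Lemma iso_vector_supp v g : transversal g -> iso_vector v g <> 0 -> g = coset_rep x.
Proof.
move=> Tg; rewrite /iso_vector; case: ifPn => // /[!inE] ig _.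
by rewrite -(coset_repK Tg (isotropyV ig)) (isotropy_mulV ig).
Qed.

Lemma iso_vector_dom v : iso_ind_dom (iso_vector v).
Proof.
split.
- by move=> g ng; rewrite /iso_vector memNset// => -[].
- move=> g t sg it; have e : s g = r t by rewrite [LHS]sg [RHS]it.1.
  have Et0 : E t 0 = 0.
    have gt : group_algebra m x (fstar m (delta t)).
      by rewrite fstar_delta; apply: group_algebra_delta; exact: isotropyV.
    by have := rep_oplinear hr gt (-1) 0 0; rewrite !scaleN1r !addNr.
  rewrite /iso_vector; have [ig|nig] := pselect (isotropy m x g).
    by rewrite !mem_set ?E_mul//; exact: isotropyM.
  rewrite !memNset// => igt; apply: nig; split=> //.
  by have := igt.1; rewrite /gfiber_r /= grangeM.
- apply: (sub_finite_set _ (finite_set1 (coset_rep x))) => g [Tg] /=.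
  exact: iso_vector_supp.
Qed.

Let x_fib : gfiber_s m x x := (isotropy1 ux).2.
Let T0 := coset_repT x_fib.

Lemma coset_rep_iso : isotropy m x (coset_rep x).
Proof.
have [t it e] := coset_xget x_fib; rewrite /coset_rep -e isotropy_mul1g//.
exact: it.1.
Qed.

Lemma fnorm_iso_vector v : fnorm iso_ind_form (iso_vector v) <= hnorm v.
Proof.
have hs := hform_space H.
have fs := rep_space (iso_ind_rep (A := set0) (fun _ => False_ind _)).
rewrite (fnorm_le fs); [|exact: iso_vector_dom|exact: sqrtr_ge0].
rewrite /iso_ind_form /ind_form -(@fsbig_widen _ _ _ _ [set coset_rep x]); first last.
- move=> g [Tg ng] /=; have -> : iso_vector v g = 0.
    by apply: contrapT => /(iso_vector_supp Tg).
  exact: (form0l hs).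
- by move=> _ ->.
rewrite fsbig_set1 /iso_vector mem_set; last exact: coset_rep_iso.
rewrite hform_E; last exact: coset_rep_iso.
have e : fnorm (@hform R H) (rho (delta x) v) ^+ 2 = hform (rho (delta x) v) v.
  rewrite (sqr_fnorm hs)// -(hform_E v (isotropy1 ux)) E_delta (ginv_unit ux).
  by [].
have cs := form_cauchy_schwarz hs (I : setT (rho (delta x) v)) (I : setT v).
have h1 : fnorm (@hform R H) (rho (delta x) v) <= hnorm v.
  have [->|n0] := eqVneq (fnorm (@hform R H) (rho (delta x) v)) 0; first exact: sqrtr_ge0.
  have np : 0 < fnorm (@hform R H) (rho (delta x) v) by rewrite lt_def n0 fnorm_ge0.
  by rewrite -(ler_pM2l np) -expr2 e.
apply: le_trans cs _; rewrite expr2 ler_wpM2r// fnorm_ge0.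
by [].
Qed.

(** At x, [f] applied to [iso_vector v] is the sum of f(k^-1) times the image of v under the unitary
    of k^-1, that is [rho h v] after inverting k; and the norm of an induced vector dominates its
    norm at one coset. *)
Lemma hnorm_le_ind f h v : fiber_finite m f -> group_algebra m x h ->
  (forall t, isotropy m x t -> f t = h t) ->
  hnorm (rho h v) <= fnorm iso_ind_form (gact m f (iso_vector v)).
Proof.
move=> ff gh fh; have hs := hform_space H.
have rpA := iso_ind_rep (A := [set f]) (fun a e => eq_ind_r _ ff e).
have Df : iso_ind_dom (gact m f (iso_vector v)) := rep_dom rpA (erefl f) (iso_vector_dom v).
have ex : gact m f (iso_vector v) x = rho h v.
  rewrite gactE [s x]x_fib rho_sum//.
  rewrite -(@fsbig_widen _ _ _ _ [set k | isotropy m x k /\ h (inv k) != 0]); first last.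
  - move=> k [sk nk] /=; rewrite /iso_vector; case: ifPn => [|_]; last exact: scaler0.
    move=> /[!inE] ik; rewrite /gdiv isotropy_mul1g; last by rewrite grangeV [LHS]sk.
    rewrite fh; last exact: isotropyV.
    have -> : h (inv k) = 0 by apply: contrapT => /eqP h0; apply: nk.
    exact: scale0r.
  - by move=> k [[]].
  have gfin := gh.1.
  have fin' : finite_set [set k | isotropy m x k /\ h (inv k) != 0].
    apply: sub_finite_set (finite_image inv gfin) => k [_ hk].
    by exists (inv k) => //; rewrite ginvK.
  rewrite -fsbig_finite//.
  rewrite (reindex_fsbig inv [set k | isotropy m x k /\ h (inv k) != 0] [set t | h t != 0]).
    apply: eq_fsbigr => k /[!inE] -[ik hk].
    rewrite /iso_vector mem_set// E_delta /gdiv isotropy_mul1g ?fh//.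
      exact: isotropyV.
    by rewrite grangeV; exact: ik.2.
  split.
  - by move=> k [_ hk].
  - by move=> k l _ _; exact: ginv_inj.
  - move=> k hk; exists (inv k); last by rewrite ginvK.
    by split; rewrite ?ginvK//; apply: isotropyV; exact: gh.2.
(* The representative of the trivial coset need not be x, but the values at the two points have the
   same norm. *)
have hx : hform (rho h v) (rho h v) = hform (gact m f (iso_vector v) (coset_rep x))
    (gact m f (iso_vector v) (coset_rep x)).
  have it := coset_rep_iso.
  have -> : gact m f (iso_vector v) (coset_rep x) = E (coset_rep x) (rho h v).
    have [_ dE _] := Df; rewrite -ex -dE//; congr (gact m f _ _).
    by rewrite isotropy_mul1g//; exact: it.1.
  rewrite hform_E// -(rep_mul hr (group_algebra_delta (isotropy1 ux)) gh).
  by rewrite gconv_delta1.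
have h0 : 0 <= hnorm (rho h v) by exact: sqrtr_ge0.
rewrite -ler_sqr ?nnegrE ?fnorm_ge0// (sqr_fnorm (rep_space rpA))//.
rewrite hnormE (sqr_fnorm hs)// hx.
set eta := gact m f (iso_vector v) in Df *.
have -> : hform (eta (coset_rep x)) (eta (coset_rep x)) =
    \sum_(g \in [set coset_rep x]) hform (eta g) (eta g) by rewrite fsbig_set1.
apply: (@fsum_le_esum _ _ transversal); [exact: finite_set1|by move=> _ ->|].
rewrite esum_finite//.
- by move=> g _; exact: (form_ge0 hs).
- have [_ _ ef] := Df; apply: sub_finite_set ef => g [Tg n0]; split=> // e; apply: n0.
  by rewrite e; exact: (form0l hs).
Qed.

End IsotropyRep.
End GroupAlgebra.

Lemma visser_bound_cauchy (R : realType) (e : R) : 0 < e -> exists N, forall p q,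
  (N <= p)%N -> (N <= q)%N -> `|visser_bound R p - visser_bound R q| <= e.
Proof.
move=> e0; have mono : {homo visser_bound R : n p / (n <= p)%N >-> n <= p}.
  by move=> n p np; have := visser_bound_dist R np; rewrite -subr_ge0 => <-.
have : cvgn (visser_bound R).
  apply: nondecreasing_is_cvgn mono _; exists 1 => _ [n _ <-].
  by have /andP[] := visser_bound_itv R n.
move=> /cvgrPdist_le/(_ (e / 2))[|N _ hN]; first by rewrite divr_gt0.
exists N => p q Np Nq; rewrite (splitr e) -[X in `|X|](subrKA (lim (visser_bound R @ \oo))).
by apply: le_trans (ler_normD _ _) _; apply: lerD; [rewrite distrC|]; exact: hN.
Qed.

(** * Transfer of a norm bound from the reduced algebra to [Ind rho] *)

Section Comparison.
Variables (R : realType) (G : topologicalType) (m : groupoid G).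
Local Notation C := R[i].
Hypothesis lcE : lc_etale_groupoid m.
Hypothesis Uopen : open (gunits m).
Let B : set (G -> C) := @bisec_span R G m.

Section Contraction.
Variables (f : G -> C) (k K : R).
Hypotheses (Bf : B f) (Bsf : B (fstar m f)) (k0 : 0 <= k).
Hypothesis fK : forall (V : lmodType C) (D : set V) form pi,
  form_rep B (gconv m) (fstar m) D form pi -> opbound D form (pi f) K.
Hypothesis fk : forall y, gunits m y ->
  opbound (@fiber_dom R G m y) (@fiber_form R G m y) (@gact R G m C^o f) k.

(* The cutoffs of [f^* * f] above [k'] are Cauchy in C^*(G) and tend to zero in
   C^*_r(G), where [f] has norm at most [k < k']; hence they die in [Ind rho]. *)
Lemma fnorm_of_reduced (x : G) (H : hilbert R) (rho : (G -> C) -> H -> H) (k' : R)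
    (w : G -> H) : gunits m x -> isotropy_rep m x rho ->
  factors_through_reduced m (Ind_norm m x rho) -> k < k' -> iso_ind_dom m x rho w ->
  fnorm (@iso_ind_form R G m x H) w <= 1 ->
  fnorm (@iso_ind_form R G m x H) (gact m f w) <= k' * fnorm (@iso_ind_form R G m x H) w.
Proof.
(* The rescaling constant must dominate both the universal bound K of [f] and the cutoff level
   k'. *)
move=> ux hr fac kk' Dw w1; pose L := Num.max K k'.
have k'L : k' <= L by rewrite le_max lexx orbT.
have L0 : 0 <= L by apply: le_trans k'L; apply: ltW; exact: le_lt_trans kk'.
have SA : subalgebra B (gconv m) := @bisec_subalgebra R G m lcE Uopen.
have fL (V : lmodType C) (D : set V) form pi :
    form_rep B (gconv m) (fstar m) D form pi -> opbound D form (pi f) L.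
  move=> rp v Dv; apply: le_trans (fK rp Dv) _.
  by rewrite ler_wpM2r ?fnorm_ge0// le_max lexx.
pose a := cutoff_seq (gconv m) (fstar m) f L k'.
have Ba n : B (a n) := A_cutoff_seq SA L k' Bf Bsf n.
have BFF : B `<=` fiber_finite m by exact: bisec_span_finite.
have ca : Cstar_cauchy m a.
  split=> [n|e e0]; first exact: (bisec_span_Cc lcE Uopen (Ba n)).
  have [N hN] := visser_bound_cauchy e0; exists N => p q Np Nq.
  apply: ge_ereal_sup => _ [H' [pi [hpi ->]]].
  apply: ge_ereal_sup => _ [v [_ v1] <-]; rewrite lee_fin in v1 *.
  have rp : form_rep B (gconv m) (fstar m) setT (@hform R H') pi.
    exact: form_rep_sub (bisec_span_Cc lcE Uopen) (star_rep_form_rep hpi).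
  have := cutoff_seq_dist SA Bf Bsf k0 kk' k'L rp (fL _ _ _ _ rp) q p (I : setT v).
  rewrite -hnormE => /le_trans; apply.
  have := hN p q Np Nq; have := sqrtr_ge0 (complex.Re (hdot H' v v)).
  rewrite -/(hnorm v) => v0 h; rewrite -[leRHS]mulr1; exact: ler_pM.
have ka : (fun n => reduced_norm m (a n)) @ \oo --> 0%E.
  have /andP[q0 q1] := cutoff_rate k0 kk' k'L.
  set q := (1 - _) in q0 q1.
  apply: (@squeeze_cvge _ _ _ _ (cst 0%E) _ (fun n => (q ^+ n)%:E)).
  - apply: nearW => n; apply/andP; split.
      apply: (@le_trans _ _ (regular_norm m (gfiber_s m x) (a n))).
        exact: regular_norm_ge0.
      by apply: ereal_sup_ubound; exists x.
    apply: ge_ereal_sup => _ [y uy <-].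
    have rp := fiber_rep uy BFF.
    apply: regular_norm_le; [exact: BFF|exact: exprn_ge0|].
    apply/(fiber_opbound uy); [exact: BFF|exact: exprn_ge0|].
    exact: (cutoff_seq_vanish SA Bf Bsf k0 kk' k'L rp (fL _ _ _ _ rp) n (fk uy)).
  - exact: cvg_cst.
  - by apply: cvg_EFin; [exact: nearW|apply: cvg_expr; rewrite ger0_norm].
(* Factorization through the reduced algebra enters here: the operator norms of the cutoffs in
   [Ind rho] tend to 0, so some cutoff is small on [w], which lies in the unit ball. *)
have ia := fac a (conj ca ka).
have rp := iso_ind_rep ux hr BFF.
apply: (fnorm_of_cutoff_seq SA Bf Bsf k0 kk' k'L rp (fL _ _ _ _ rp) Dw) => e e0.
have ne : nbhs (0%E : \bar R) [set u | (u < e%:E)%E].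
  by apply: open_ereal_lt'; rewrite lte_fin.
have [n _ /(_ n (leqnn n)) /= hn] := ia _ ne; exists n.
rewrite -lee_fin -(ind_l2normE ux (rep_dom rp (Ba n) Dw)).
apply: le_trans (ltW hn); apply: ereal_sup_ubound; exists w => //; split.
  by have [x0 xE _] := Dw; split.
by rewrite (ind_l2normE ux Dw) lee_fin.
Qed.

End Contraction.

End Comparison.

(** * Construction of the lift, and the upper bound *)

Section UpperBound.
Variables (R : realType) (G : topologicalType) (m : groupoid G).
Local Notation C := R[i].
Local Notation s := (gsource m).
Variables (Gam : groupType) (Phi : G -> Gam) (x : G) (U : G -> set G).
Hypothesis lcE : lc_etale_groupoid m.
Hypothesis Uopen : open (gunits m).
Hypothesis Phi_mul : forall g h, s g = grange m h -> Phi (gmul m g h) = (Phi g * Phi h)%g.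
Hypothesis ux : gunits m x.
Hypothesis Phi_inj : forall g h, isotropy m x g -> isotropy m x h -> Phi g = Phi h -> g = h.
Hypothesis bU : forall g, isotropy m x g -> bisec m (U g).
Hypothesis Ug : forall g, isotropy m x g -> U g g.
Hypothesis PhiU : forall g u, isotropy m x g -> U g u -> Phi u = Phi g.
Hypothesis Ux : U x = gunits m.
Hypothesis UV : forall g, isotropy m x g -> U (ginv m g) = gsetinv m (U g).
Hypothesis Uprod : forall g gs, isotropy m x g -> (forall h, h \in gs -> isotropy m x h) ->
  gprod m g gs = x -> gsetprod m U g gs `<=` gunits m.
Let B : set (G -> C) := @bisec_span R G m.

(** Each U_t contains t, whose source is x, so finitely many source sets share a neighbourhood of x.
    A bump supported there satisfies the hypothesis [KU] of the lift. *)
Lemma exists_neighborhood (l : seq G) : (forall t, t \in l -> isotropy m x t) ->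
  exists V, [/\ open V, V x, V `<=` gunits m & forall t, t \in l -> V `<=` s @` U t].
Proof.
elim: l => [|t l IH] li; first by exists (gunits m); split.
have [|V [oV Vx VU Vs]] := IH; first by move=> u ul; apply: li; rewrite inE ul orbT.
have it : isotropy m x t by apply: li; rewrite inE eqxx.
exists (V `&` s @` U t); split.
- by apply: openI => //; have [[]] := bU it.
- by split=> //; exists t; [exact: Ug|exact: it.2].
- by move=> g [/VU].
- by move=> u; rewrite inE => /predU1P[-> g []//|ul g [Vg _]]; exact: Vs ul g Vg.
Qed.

Lemma fstar_sum (I : Type) (l : seq I) (F : I -> G -> C) :
  fstar m (\sum_(t <- l) F t) = \sum_(t <- l) fstar m (F t).
Proof.
apply/funext => g; rewrite /fstar !fct_sumE.
by apply: (big_morph (fun z : C => z^*)) => [a b|]; rewrite ?rmorphD ?conjC0.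
Qed.

Lemma bisec_units : bisec m (gunits m).
Proof. by rewrite -Ux; apply: bU; exact: isotropy1. Qed.

Lemma exists_lift (h : G -> C) (k : R) : group_algebra m x h -> 0 <= k ->
  (norm_r m x h <= k%:E)%E ->
  exists (f : G -> C) (K : R), [/\ B f, B (fstar m f),
    forall t, isotropy m x t -> f t = h t,
    forall (V : lmodType C) (D : set V) form pi,
      form_rep B (gconv m) (fstar m) D form pi -> opbound D form (pi f) K
  & forall y, gunits m y ->
    opbound (@fiber_dom R G m y) (@fiber_form R G m y) (@gact R G m C^o f) k].
Proof.
move=> gh k0 hk; have SA : subalgebra B (gconv m) := @bisec_subalgebra R G m lcE Uopen.
pose l : seq G := enum_fset (fset_set [set t | h t != 0]).
have fh := gh.1.
have lP t : t \in l = (h t != 0) by rewrite in_fset_set//; apply/idP/idP => [/set_mem|/mem_set].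
have liso t : t \in l -> isotropy m x t by rewrite lP; exact: gh.2.
have [V [oV Vx VU Vs]] := exists_neighborhood liso.
have [b [cb bx b0 [K [cK KV bK]]]] := compact_bump R lcE Uopen ux oV Vx VU.
(* Rational parametrization of the circle: 1 - q^2 = (1 - q')^2. Both q and q' are continuous on the
   units and vanish with b, and q = 1 at x, so Q = q^2 and L = q' are elements of the algebra to
   which [opbound_of_square] applies. *)
pose den g : R := 1 + b g ^+ 2.
have den_gt0 g : 0 < den g by rewrite ltr_wpDr ?sqr_ge0.
pose q g : R := 2 * b g / den g.
pose q' g : R := 2 * b g ^+ 2 / den g.
have cden u : gunits m u -> den y @[y --> u] --> den u.
  move=> uu; apply: cvgD; [exact: cvg_cst|].
  by apply: cvgM; exact: cb.
have cdenV u : gunits m u -> (den y)^-1 @[y --> u] --> (den u)^-1.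
  by move=> uu; apply: cvgV; [rewrite gt_eqF|exact: cden].
have cq u : gunits m u -> q y @[y --> u] --> q u.
  move=> uu; apply: cvgM; [apply: cvgM; [exact: cvg_cst|exact: cb]|exact: cdenV].
have cq' u : gunits m u -> q' y @[y --> u] --> q' u.
  move=> uu; apply: cvgM; last exact: cdenV.
  by apply: cvgM; [exact: cvg_cst|apply: cvgM; exact: cb].
have cq2 u : gunits m u -> q y ^+ 2 @[y --> u] --> q u ^+ 2.
  by move=> uu; apply: cvgM; exact: cq.
have q0 g : ~ K g -> q g = 0 by move=> /bK bg; rewrite /q bg mulr0 mul0r.
have q'0 g : ~ K g -> q' g = 0 by move=> /bK bg; rewrite /q' bg expr0n mulr0 mul0r.
have q20 g : ~ K g -> q g ^+ 2 = 0 by move=> /q0 ->; rewrite expr0n.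
have qx : q x = 1 by rewrite /q /den bx; field.
have q01 g : 0 <= q g <= 1.
  rewrite divr_ge0 ?mulr_ge0 ?(ltW (den_gt0 g))//= ler_pdivrMr// mul1r /den.
  by have := sqr_ge0 (1 - b g); rewrite sqrrB; lra.
have qq' g : q' g ^+ 2 = 2 * q' g - q g ^+ 2.
  rewrite /q /q'; have := den_gt0 g; rewrite /den => d0.
  by field; rewrite gt_eqF.
have KU t : t \in l -> K `<=` s @` U t.
  by move=> tl g /KV; exact: Vs.
have Kunits : K `<=` s @` gunits m.
  by move=> g /KV/VU ug; exists g => //; exact: gunits_sourceE.
have bu := bisec_units.
pose L := source_fun (R := R) m (gunits m) q'.
pose Q := source_fun (R := R) m (gunits m) (fun u => q u ^+ 2).
have gL : bisec_fun m (gunits m) L := bisec_fun_source lcE bu cq' cK Kunits q'0.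
have BL : B L := bisec_span_fun gL.
have BQ : B Q := bisec_span_fun (bisec_fun_source lcE bu cq2 cK Kunits q20).
have sL : fstar m L = L.
  apply/funext => g; rewrite /fstar /L; have [ug|nug] := pselect (gunits m g).
    by rewrite (ginv_unit ug) source_funE//; exact: conjc_real.
  rewrite !source_fun_out ?conjC0// => ug; apply: nug.
  by rewrite -(ginvK m g) (ginv_unit ug).
have LQ : gconv m L L = (2%:R : R)%:C *: L - Q.
  have := @gconv_source_star R G m lcE _ K q' bu cq' cK Kunits q'0 1 1.
  rewrite !scale1r sL => ->; last by rewrite normr1.
  rewrite expr1n scale1r; apply/funext => g.
  rewrite -[RHS]/((2%:R : R)%:C * L g - Q g) /L /Q.
  have [ug|nug] := pselect (gunits m g); last by rewrite !source_fun_out// mulr0 subr0.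
  by rewrite !source_funE// qq' rmorphB rmorphM.
pose F t := h t *: source_fun (R := R) m (U t) q.
have gF t : t \in l -> bisec_fun m (U t) (F t).
  move=> tl; apply: bisec_funZ; have it := liso _ tl.
  exact: (bisec_fun_source lcE (bU it) cq cK (KU _ tl) q0).
pose nh t : R := complex.Re `|h t|.
have nhE t : `|h t| = (nh t)%:C by rewrite /nh normc_def.
have nh0 t : 0 <= nh t by rewrite /nh normc_def /= sqrtr_ge0.
pose f := lift_fun m U h q l.
have BF t : t \in l -> B (F t) by move=> tl; exact: bisec_span_fun (gF t tl).
have BsF t : t \in l -> B (fstar m (F t)).
  by move=> tl; exact: bisec_span_fun (bisec_fun_star lcE (gF t tl)).
have Bsum (F' : G -> G -> C) (l' : seq G) : (forall t, t \in l' -> B (F' t)) ->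
    B (\sum_(t <- l') F' t).
  elim: l' => [|t l' IH] h'; first by rewrite big_nil; exact: subalg0 SA.
  rewrite big_cons; apply: (subalgD SA); first by apply: h'; rewrite inE eqxx.
  by apply: IH => u ul; apply: h'; rewrite inE ul orbT.
have lh t : isotropy m x t -> h t <> 0 -> t \in l by move=> _ /eqP; rewrite lP.
have lu : uniq l by exact: fset_uniq.
exists f, (\sum_(t <- l) nh t); split.
- exact: Bsum.
- by rewrite /f /lift_fun fstar_sum; exact: Bsum.
- move=> t it; rewrite /f (lift_fun_word Phi_mul Phi_inj PhiU UV Uprod liso lh lu KU q0 (word_U it (Ug it))).
  by rewrite (_ : s t = x) ?qx ?mulr1//; exact: it.2.
(* For each t, the product of the adjoint of F t with F t is |h t|^2 Q and Q <= 1, so F t has norm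
   at most |h t| in every representation; the bounds add up. *)
- move=> V' D form pi rp v Dv; have fs := rep_space rp.
  have key t : t \in l -> opbound D form (pi (F t)) (nh t).
    move=> tl; have it := liso _ tl.
    have FQ := gconv_source_star lcE (bU it) cq cK (KU _ tl) q0 (nhE t).
    exact: (opbound_of_square SA rp (BF t tl) (BsF t tl) BL sL BQ (nh0 t) FQ LQ).
  rewrite /f /lift_fun; elim: l {lP liso Vs KU lh lu f gF BsF} BF key => [|t l' IH] BF key.
    by rewrite !big_nil (rep_0 SA rp)// (fnorm0 fs) mul0r.
  have tl : t \in t :: l' by rewrite inE eqxx.
  have ul u : u \in l' -> u \in t :: l' by move=> ul; rewrite inE ul orbT.
  have Bl : B (\sum_(t <- l') F t) by apply: Bsum => u /ul; exact: BF.
  rewrite !big_cons (rep_D rp (BF t tl) Bl Dv) mulrDl.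
  apply: le_trans (fnormD fs (rep_dom rp (BF t tl) Dv) (rep_dom rp Bl Dv)) _.
  apply: lerD; first exact: key.
  by apply: IH => u /ul; [exact: BF|exact: key].
- move=> y uy; apply/(fiber_opbound uy) => //.
    exact: bisec_span_finite (Bsum _ _ BF).
  move=> xi xi0 xif.
  apply: (lift_fun_bound Phi_mul ux Phi_inj PhiU Ux UV Uprod liso lh lu KU q0 q01) => //.
  by move=> zeta zf zi; exact: (norm_r_bound gh k0 hk zf zi).
Qed.

Lemma norm_e_le (h : G -> C) : group_algebra m x h -> (norm_e m x h <= norm_r m x h)%E.
Proof.
move=> gh; case E : (norm_r m x h) => [k| |]; last 2 first.
- exact: leey.
- by have := regular_norm_ge0 m (isotropy m x) h; rewrite -/(norm_r m x h) E.
have k0 : 0 <= k by rewrite -lee_fin -E; exact: regular_norm_ge0.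
have hk : (norm_r m x h <= k%:E)%E by rewrite E.
have [f [K [Bf Bsf fh fK fk]]] := exists_lift gh k0 hk.
apply: ge_ereal_sup => _ [H [rho [hr fac ->]]].
apply: ge_ereal_sup => _ [v [_ v1] <-]; rewrite !lee_fin in v1 *.
(* The cutoff level has to lie strictly above k, whence the slack e. *)
apply/ler_addgt0Pr => e e0.
have w1 := le_trans (fnorm_iso_vector ux hr v) v1.
have ff : fiber_finite m f by exact: bisec_span_finite.
apply: le_trans (hnorm_le_ind ux hr v ff gh fh) _.
have kk' : k < k + e by rewrite ltrDl.
apply: le_trans (fnorm_of_reduced lcE Uopen Bf Bsf k0 fK fk ux hr fac kk'
  (iso_vector_dom ux hr v) w1) _.
by rewrite -[leRHS]mulr1 ler_wpM2l// ltW// (le_lt_trans k0).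
Qed.

End UpperBound.

(** * Square summable functions *)

Section RealSum.
Variables (R : realType) (I : choiceType).
Implicit Types f a b : I -> R.

Definition summable_real f : Prop :=
  (\esum_(i in [set: I]) (`|f i|)%:E < +oo)%E.

Definition esum_real a : R := fine (\esum_(i in [set: I]) (a i)%:E)%E.

Lemma esum_real_ge0 a : (forall i, 0 <= a i) -> 0 <= esum_real a.
Proof. by move=> a0; apply: fine_ge0; apply: esum_ge0 => i _; rewrite lee_fin. Qed.

Lemma summable_le f a : summable_real a -> (forall i, `|f i| <= `|a i|) -> summable_real f.
Proof. by move=> sa fa; apply: le_lt_trans sa; apply: le_esum => i _; rewrite lee_fin. Qed.

Lemma esum_realE a : summable_real a -> (forall i, 0 <= a i) ->
  (\esum_(i in [set: I]) (a i)%:E = (esum_real a)%:E)%E.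
Proof.
move=> sa a0; rewrite fineK// ge0_fin_numE; last by apply: esum_ge0 => i _; rewrite lee_fin.
by apply: le_lt_trans sa; apply: le_esum => i _; rewrite lee_fin ler_norm.
Qed.

Lemma summableDr f a : summable_real f -> summable_real a -> summable_real (fun i => f i + a i).
Proof.
move=> sf sa; apply: le_lt_trans (lte_add_pinfty sf sa); rewrite -esumD => [|i _|i _]; rewrite ?lee_fin//.
by apply: le_esum => i _; rewrite -EFinD lee_fin ler_normD.
Qed.

Lemma esum_realD a b : summable_real a -> summable_real b ->
  (forall i, 0 <= a i) -> (forall i, 0 <= b i) ->
  esum_real (fun i => a i + b i) = esum_real a + esum_real b.
Proof.
move=> sa sb a0 b0; apply: EFin_inj; rewrite EFinD -!esum_realE//.
- by rewrite -esumD => [|i _|i _]; rewrite ?lee_fin.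
- exact: summableDr.
- by move=> i; rewrite addr_ge0.
Qed.

Lemma esum_real_leP a M : (forall i, 0 <= a i) ->
  (forall F, finite_set F -> \sum_(i \in F) a i <= M) ->
  summable_real a /\ esum_real a <= M.
Proof.
move=> a0 h; have : (\esum_(i in [set: I]) (a i)%:E <= M%:E)%E.
  by apply: esum_leP => F fF _; exact: h.
move=> le; have sa : summable_real a.
  rewrite /summable_real (eq_esum (b := fun i => (a i)%:E)).
    exact: le_lt_trans le (ltey _).
  by move=> i _; rewrite ger0_norm.
by split=> //; rewrite -lee_fin -esum_realE.
Qed.

Lemma fsum_le_esum_real a F : summable_real a -> (forall i, 0 <= a i) ->
  finite_set F -> \sum_(i \in F) a i <= esum_real a.
Proof.
by move=> sa a0 fF; apply: (@fsum_le_esum _ _ [set: I]) => //; rewrite esum_realE.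
Qed.

Lemma term_le_esum_real a i : summable_real a -> (forall i, 0 <= a i) -> a i <= esum_real a.
Proof.
move=> sa a0; have := fsum_le_esum_real sa a0 (finite_set1 i).
by rewrite fsbig_set1.
Qed.

Lemma esum_realZ c a : 0 <= c -> summable_real a -> (forall i, 0 <= a i) ->
  summable_real (fun i => c * a i) /\ esum_real (fun i => c * a i) = c * esum_real a.
Proof.
move=> c0 sa a0.
have le k b : 0 <= k -> summable_real b -> (forall i, 0 <= b i) ->
    summable_real (fun i => k * b i) /\ esum_real (fun i => k * b i) <= k * esum_real b.
  move=> k0 sb b0; apply: esum_real_leP => [i|F fF]; first by rewrite mulr_ge0.
  by rewrite -mulr_fsumr ler_wpM2l//; exact: fsum_le_esum_real.
have [sc lec] := le c a c0 sa a0; split=> //; apply/eqP; rewrite eq_le lec /=.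
have [->|cn0] := eqVneq c 0.
  by rewrite mul0r; apply: esum_real_ge0 => i; rewrite mul0r.
have cp : 0 < c by rewrite lt_def cn0.
have ci : 0 <= c^-1 by rewrite invr_ge0.
(* The same inequality for c^-1, applied to c a, is the reverse inequality. *)
have [_] := le _ _ ci sc (fun i => mulr_ge0 c0 (a0 i)).
have -> : (fun i => c^-1 * (c * a i)) = a by apply/funext => i; rewrite mulKf.
by rewrite mulrC ler_pdivlMr// mulrC.
Qed.

(** The unconditional sum of a signed function. By [rsumE] every decomposition into nonnegative
    summable functions gives the same value, and linearity follows from this. *)
Definition rsum f : R :=
  esum_real (fun i => Num.max (f i) 0) - esum_real (fun i => Num.max (- f i) 0).

Lemma rsumE f a b : summable_real a -> summable_real b -> (forall i, 0 <= a i) ->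
  (forall i, 0 <= b i) -> (forall i, f i = a i - b i) -> rsum f = esum_real a - esum_real b.
Proof.
move=> sa sb a0 b0 fE.
have p0 i : 0 <= Num.max (f i) 0 by rewrite le_max lexx orbT.
have n0 i : 0 <= Num.max (- f i) 0 by rewrite le_max lexx orbT.
have sp : summable_real (fun i => Num.max (f i) 0).
  apply: summable_le sa _ => i; rewrite !ger0_norm// ge_max a0 andbT fE.
  by rewrite lerBlDr lerDl.
have sn : summable_real (fun i => Num.max (- f i) 0).
  apply: summable_le sb _ => i; rewrite !ger0_norm// ge_max b0 andbT fE opprB.
  by rewrite lerBlDr lerDl.
have := esum_realD sp sb p0 b0; have := esum_realD sn sa n0 a0.
have -> : (fun i => Num.max (- f i) 0 + a i) = (fun i => Num.max (f i) 0 + b i).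
  apply/funext => i; rewrite fE; have := a0 i; have := b0 i.
  by rewrite opprB; case: (leP (a i - b i) 0); case: (leP (b i - a i) 0); lra.
by rewrite /rsum; lra.
Qed.

Lemma summable_pos f : summable_real f ->
  [/\ summable_real (fun i => Num.max (f i) 0), summable_real (fun i => Num.max (- f i) 0),
      forall i, 0 <= Num.max (f i) 0, forall i, 0 <= Num.max (- f i) 0
    & forall i, f i = Num.max (f i) 0 - Num.max (- f i) 0].
Proof.
move=> sf.
have p0 i : 0 <= Num.max (f i) 0 by rewrite le_max lexx orbT.
have n0 i : 0 <= Num.max (- f i) 0 by rewrite le_max lexx orbT.
split=> //.
- by apply: summable_le sf _ => i; rewrite ger0_norm// ge_max normr_ge0 ler_norm.
- by apply: summable_le sf _ => i; rewrite ger0_norm// ge_max normr_ge0 -normrN ler_norm.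
- by move=> i; case: (leP (f i) 0); case: (leP (- f i) 0); lra.
Qed.

Lemma rsum_pos a : summable_real a -> (forall i, 0 <= a i) -> rsum a = esum_real a.
Proof.
move=> sa a0; have s0 : summable_real (fun _ => 0).
  by apply: summable_le sa _ => i; rewrite normr0.
rewrite (@rsumE a a (fun _ => 0))//; last by move=> i; rewrite subr0.
have -> : esum_real (fun _ => 0) = 0 by rewrite /esum_real esum1.
by rewrite subr0.
Qed.

Lemma rsumD f g : summable_real f -> summable_real g ->
  rsum (fun i => f i + g i) = rsum f + rsum g.
Proof.
move=> /summable_pos[s1 s2 h1 h2 fE] /summable_pos[s3 s4 h3 h4 gE].
rewrite (@rsumE _ (fun i => Num.max (f i) 0 + Num.max (g i) 0)
  (fun i => Num.max (- f i) 0 + Num.max (- g i) 0)).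
- rewrite !esum_realD//; rewrite /rsum; lra.
- exact: summableDr.
- exact: summableDr.
- by move=> i; rewrite addr_ge0.
- by move=> i; rewrite addr_ge0.
- by move=> i; rewrite {1}fE {1}gE; lra.
Qed.

Lemma rsumN f : rsum (fun i => - f i) = - rsum f.
Proof.
rewrite /rsum opprB; congr (_ - _).
by congr esum_real; apply/funext => i; rewrite opprK.
Qed.

Lemma rsumZ c f : summable_real f -> rsum (fun i => c * f i) = c * rsum f.
Proof.
wlog c0 : c / 0 <= c => [wl|] sf.
  have [c0|c0] := leP 0 c; first exact: wl.
  have := wl (- c) _ sf; rewrite oppr_ge0 => /(_ (ltW c0)).
  have -> : (fun i => - c * f i) = (fun i => - (c * f i)) by apply/funext => i; rewrite mulNr.
  by rewrite rsumN mulNr => /oppr_inj.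
have [s1 s2 h1 h2 fE] := summable_pos sf.
have [s1' e1] := esum_realZ c0 s1 h1; have [s2' e2] := esum_realZ c0 s2 h2.
rewrite (@rsumE _ (fun i => c * Num.max (f i) 0) (fun i => c * Num.max (- f i) 0))//.
- by rewrite e1 e2 -mulrBr.
- by move=> i; rewrite mulr_ge0.
- by move=> i; rewrite mulr_ge0.
- by move=> i; rewrite {1}fE mulrBr.
Qed.

Lemma summableZr c f : summable_real f -> summable_real (fun i => c * f i).
Proof.
move=> sf; have sn : summable_real (fun i => `|f i|).
  by apply: summable_le sf _ => i; rewrite normr_id.
have [s _] := esum_realZ (normr_ge0 c) sn (fun i => normr_ge0 _).
by apply: summable_le s _ => i; rewrite normrM normrM !normr_id.
Qed.

Lemma rsum_lin3 (c d : R) f g h : summable_real f -> summable_real g -> summable_real h ->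
  rsum (fun i => c * f i + d * g i + h i) = c * rsum f + d * rsum g + rsum h.
Proof.
move=> sf sg sh; have sf' := summableZr c sf; have sg' := summableZr d sg.
by rewrite (rsumD (summableDr sf' sg') sh) (rsumD sf' sg') (rsumZ c sf) (rsumZ d sg).
Qed.

End RealSum.

Lemma sqnormD (R : realType) (z w : R[i]) : sqnorm (z + w) <= 2 * sqnorm z + 2 * sqnorm w.
Proof.
case: z w => a b [c d]; rewrite /sqnorm /=.
by have := sqr_ge0 (a - c); have := sqr_ge0 (b - d); lra.
Qed.

Lemma ReIm_mulJ (R : realType) (z w : R[i]) :
  `|complex.Re (z * w^*)| <= sqnorm z + sqnorm w /\
  `|complex.Im (z * w^*)| <= sqnorm z + sqnorm w.
Proof.
case: z w => a b [c d]; rewrite /sqnorm /= !ler_norml.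
have h1 := sqr_ge0 (a - c); have h2 := sqr_ge0 (b - d); have h3 := sqr_ge0 (a + c).
have h4 := sqr_ge0 (b + d); have h5 := sqr_ge0 (a - d); have h6 := sqr_ge0 (b - c).
have h7 := sqr_ge0 (a + d); have h8 := sqr_ge0 (b + c).
have := sqr_ge0 a; have := sqr_ge0 b; have := sqr_ge0 c; have := sqr_ge0 d.
by move=> *; split; apply/andP; split; lra.
Qed.

Section L2.
Variables (R : realType) (I : choiceType).
Local Notation C := R[i].

Definition square_summable (xi : I -> C) : Prop := summable_real (fun i => sqnorm (xi i)).

Definition square_summable_pred : {pred I -> C} := fun xi => `[< square_summable xi >].

Lemma square_summableL (c : C) (xi eta : I -> C) : square_summable xi ->
  square_summable eta -> square_summable (c *: xi + eta).
Proof.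
move=> sx se.
have s1 := summableZr (2 * sqnorm c) sx; have s2 := summableZr 2 se.
apply: summable_le (summableDr s1 s2) _ => i.
rewrite !ger0_norm ?sqnorm_ge0 ?addr_ge0 ?mulr_ge0 ?sqnorm_ge0//.
by apply: le_trans (sqnormD _ _) _; rewrite sqnormM mulrA.
Qed.

Lemma square_summable0 : square_summable 0.
Proof.
rewrite /square_summable /summable_real esum1 ?ltey// => i _.
by rewrite sqnorm0 normr0.
Qed.

Lemma square_summable_submod : submod_closed square_summable_pred.
Proof.
split=> [|c xi eta /asboolP sx /asboolP se]; apply/asboolP; first exact: square_summable0.
exact: square_summableL.
Qed.

HB.instance Definition _ := GRing.isSubmodClosed.Build C (I -> C) square_summable_pred
  square_summable_submod.

Record l2 := L2 { l2_fun : I -> C; l2_funP : l2_fun \in square_summable_pred }.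

HB.instance Definition _ := [isSub for l2_fun].
HB.instance Definition _ := [Choice of l2 by <:].
HB.instance Definition _ := [SubChoice_isSubLmodule of l2 by <:].

Lemma l2P (u : l2) : square_summable (l2_fun u).
Proof. exact/asboolP/l2_funP. Qed.

Definition mk_l2 (xi : I -> C) (h : square_summable xi) : l2 := L2 (asboolT h).

Lemma l2_ext (u v : l2) : (forall i, l2_fun u i = l2_fun v i) -> u = v.
Proof. by move=> h; apply: val_inj; apply/funext. Qed.

Lemma l2_linE c (u v : l2) i : l2_fun (c *: u + v) i = c * l2_fun u i + l2_fun v i.
Proof. by []. Qed.

Definition l2_dot (u v : l2) : C :=
  (rsum (fun i => complex.Re (l2_fun u i * (l2_fun v i)^*)) +i*
   rsum (fun i => complex.Im (l2_fun u i * (l2_fun v i)^*)))%C.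

Lemma summable_ReIm (u v : l2) :
  summable_real (fun i => complex.Re (l2_fun u i * (l2_fun v i)^*)) /\
  summable_real (fun i => complex.Im (l2_fun u i * (l2_fun v i)^*)).
Proof.
have s := summableDr (l2P u) (l2P v).
have le i : sqnorm (l2_fun u i) + sqnorm (l2_fun v i) =
    `|sqnorm (l2_fun u i) + sqnorm (l2_fun v i)|.
  by rewrite ger0_norm// addr_ge0 ?sqnorm_ge0.
split; apply: summable_le s _ => i; rewrite -le; by have [] := ReIm_mulJ (l2_fun u i) (l2_fun v i).
Qed.

Lemma l2_dotC u v : l2_dot u v = (l2_dot v u)^*.
Proof.
rewrite /l2_dot; congr (_ +i* _)%C; last rewrite -rsumN; congr rsum; apply/funext => i;
  by case: (l2_fun u i) (l2_fun v i) => a b [c d] /=; ring.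
Qed.

Lemma l2_dotL w : GRing.linear_for *%R (l2_dot^~ w).
Proof.
move=> c u v; rewrite /l2_dot.
rewrite (_ : l2_fun (c *: u + v) = fun i => c * l2_fun u i + l2_fun v i)//.
have [s1 s2] := summable_ReIm u w; have [s3 s4] := summable_ReIm v w.
case: c => a b; apply/eqP; rewrite eq_complex /=; apply/andP; split; apply/eqP.
  rewrite -mulNr -(rsum_lin3 a (- b) s1 s2 s3); congr rsum; apply/funext => i.
  case: (l2_fun w i) => e f.
  by case: (l2_fun u i) (l2_fun v i) => u1 u2 [v1 v2] /=; ring.
rewrite -(rsum_lin3 a b s2 s1 s4); congr rsum; apply/funext => i.
case: (l2_fun w i) => e f.
by case: (l2_fun u i) (l2_fun v i) => u1 u2 [v1 v2] /=; ring.
Qed.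

Lemma l2_dotR c u v w : l2_dot u (c *: v + w) = c^* * l2_dot u v + l2_dot u w.
Proof.
transitivity ((l2_dot (c *: v + w) u)^*); first exact: l2_dotC.
by rewrite l2_dotL rmorphD rmorphM (l2_dotC u v) (l2_dotC u w).
Qed.

Lemma l2_dot_bilinear : bilinear_for *%R (Num.conj \; *%R) l2_dot.
Proof. by split=> [w|u] c v w'; [exact: l2_dotL|exact: l2_dotR]. Qed.

HB.instance Definition _ := bilinear_isBilinear.Build C l2 l2 C *%R (Num.conj \; *%R)
  l2_dot l2_dot_bilinear.

Lemma l2_dot_hermitian u v : l2_dot u v = (-1) ^+ false * (l2_dot v u)^*.
Proof. by rewrite expr0 mul1r l2_dotC. Qed.

HB.instance Definition _ := isHermitianSesquilinear.Build C l2 false Num.conj l2_dot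
  l2_dot_hermitian.

Lemma l2_dotE u : l2_dot u u = (esum_real (fun i => sqnorm (l2_fun u i)))%:C.
Proof.
rewrite /l2_dot; congr (_ +i* _)%C.
  rewrite -rsum_pos; [|exact: l2P|by move=> i; exact: sqnorm_ge0].
  by congr rsum; apply/funext => i; case: (l2_fun u i) => a b; rewrite /sqnorm /=; ring.
rewrite -[RHS](mul0r (rsum (fun i => complex.Im (l2_fun u i * (l2_fun u i)^*)))).
rewrite -rsumZ; last by have [] := summable_ReIm u u.
by congr rsum; apply/funext => i; case: (l2_fun u i) => a b /=; ring.
Qed.

Lemma l2_dot_gt0 u : u != 0 -> 0 < l2_dot u u.
Proof.
move=> u0; rewrite l2_dotE ltcR; have s0 i : 0 <= sqnorm (l2_fun u i) by exact: sqnorm_ge0.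
rewrite lt_def esum_real_ge0// andbT; apply: contraNneq u0 => e0; apply/eqP/l2_ext => i.
apply: sqnorm_eq0; apply/eqP; rewrite eq_le s0 andbT -e0.
exact: (term_le_esum_real i (l2P u)).
Qed.

HB.instance Definition _ := isDotProduct.Build C l2 l2_dot l2_dot_gt0.

Definition l2_norm (u : l2) : R := Num.sqrt (complex.Re (l2_dot u u)).

Lemma l2_norm_lt u (e : R) : 0 < e -> (l2_norm u < e) =
  (esum_real (fun i => sqnorm (l2_fun u i)) < e ^+ 2).
Proof.
move=> e0; rewrite /l2_norm l2_dotE /= -{1}(gtr0_norm e0) -sqrtr_sqr ltr_sqrt//.
exact: exprn_gt0.
Qed.

(** Coordinates converge, and the Cauchy estimate on a finite set of coordinates passes to the limit
    with a bound independent of the set. This yields both the square summability of the limit and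
    the convergence in norm. *)
Lemma l2_complete (v : nat -> l2) :
  (forall e : R, 0 < e -> exists N, forall p q, (N <= p)%N -> (N <= q)%N ->
     l2_norm (v p - v q) < e) ->
  exists l, forall e : R, 0 < e -> exists N, forall p, (N <= p)%N -> l2_norm (v p - l) < e.
Proof.
move=> cv; pose a p i := complex.Re (l2_fun (v p) i); pose b p i := complex.Im (l2_fun (v p) i).
have sqE p q i : sqnorm (l2_fun (v p - v q) i) = (a p i - a q i) ^+ 2 + (b p i - b q i) ^+ 2.
  by rewrite /a /b /sqnorm -[l2_fun _ i]/(l2_fun (v p) i - l2_fun (v q) i);
    case: (l2_fun (v p) i) (l2_fun (v q) i) => ? ? [].
have ca (c : nat -> R) : (forall e : R, 0 < e -> exists N, forall p q, (N <= p)%N -> (N <= q)%N ->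
    (c p - c q) ^+ 2 < e ^+ 2) -> cvgn c.
  move=> h; apply/cauchy_cvgP/cauchy_exP => e e0; have [N hN] := h e e0.
  exists (c N); exists N => // n /= Nn; have := hN N n (leqnn N) Nn.
  rewrite -ball_normE /ball_ /= => le.
  by rewrite -ltr_sqr ?nnegrE ?normr_ge0 ?(ltW e0)// real_normK ?num_real.
have cab i : cvgn (a^~ i) /\ cvgn (b^~ i).
  have h e : 0 < e -> exists N, forall p q, (N <= p)%N -> (N <= q)%N ->
      (a p i - a q i) ^+ 2 + (b p i - b q i) ^+ 2 < e ^+ 2.
    move=> e0; have [N hN] := cv e e0; exists N => p q Np Nq.
    have := hN p q Np Nq; rewrite l2_norm_lt//; apply: le_lt_trans.
    rewrite -sqE; apply: (term_le_esum_real i (l2P _)) => j; exact: sqnorm_ge0.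
  split; apply: ca => e /h[N hN]; exists N => p q Np Nq; apply: le_lt_trans (hN p q Np Nq).
    by rewrite lerDl sqr_ge0.
  by rewrite lerDr sqr_ge0.
pose la i : R := lim (a^~ i @ \oo); pose lb i : R := lim (b^~ i @ \oo).
pose w i : C := (la i +i* lb i)%C.
have bound e N p : 0 < e -> (forall q, (N <= q)%N -> l2_norm (v p - v q) < e) ->
    forall F, finite_set F -> \sum_(i \in F) sqnorm (l2_fun (v p) i - w i) <= e ^+ 2.
  move=> e0 hN F fF; rewrite fsbig_finite//=.
  have cs : \sum_(i <- fset_set F) ((a p i - a q i) ^+ 2 + (b p i - b q i) ^+ 2) @[q --> \oo]
      --> \sum_(i <- fset_set F) ((a p i - la i) ^+ 2 + (b p i - lb i) ^+ 2).
    elim: (enum_fset (fset_set F)) => [|i l IH].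
      by rewrite big_nil; under eq_fun do rewrite big_nil; exact: cvg_cst.
    rewrite big_cons; have [c1 c2] := cab i.
    under eq_fun do rewrite big_cons.
    by apply: cvgD IH; apply: cvgD; apply: cvgM; (apply: cvgB; [exact: cvg_cst|]).
  have -> : \sum_(i <- fset_set F) sqnorm (l2_fun (v p) i - w i) =
      \sum_(i <- fset_set F) ((a p i - la i) ^+ 2 + (b p i - lb i) ^+ 2).
    by apply: eq_bigr => i _; rewrite /a /b /w /sqnorm; case: (l2_fun (v p) i).
  apply: (cvgr_to_le cs); exists N => // q /= Nq.
  have := hN q Nq; rewrite l2_norm_lt// => /ltW; apply: le_trans.
  rewrite (eq_bigr (fun i => sqnorm (l2_fun (v p - v q) i))) => [|i _]; last by rewrite sqE.
  rewrite -fsbig_finite//; apply: (fsum_le_esum_real (l2P _)) => // j.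
  exact: sqnorm_ge0.
have dist e : 0 < e -> exists N, forall p, (N <= p)%N ->
    square_summable (fun i => l2_fun (v p) i - w i) /\
    esum_real (fun i => sqnorm (l2_fun (v p) i - w i)) <= e ^+ 2.
  move=> e0; have [N hN] := cv e e0; exists N => p Np.
  apply: esum_real_leP => [i|]; first exact: sqnorm_ge0.
  by apply: (bound e N p e0) => q; exact: hN.
have ssw : square_summable w.
  have [N hN] := dist 1 ltr01; have [s _] := hN N (leqnn N).
  have := square_summableL (-1) s (l2P (v N)); congr square_summable.
  apply/funext => i; rewrite -[LHS]/(-1 * (l2_fun (v N) i - w i) + l2_fun (v N) i).
  by ring.
(* Passing to the limit makes the inequality weak; starting from e / 2 restores the strict one. *)
exists (mk_l2 ssw) => e e0; have e2 : 0 < e / 2 by rewrite divr_gt0.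
have [N hN] := dist _ e2.
exists N => p Np; rewrite l2_norm_lt//; have [_ le] := hN p Np.
apply: (le_lt_trans le); rewrite ltr_pXn2r// ?nnegrE ?divr_ge0 ?(ltW e0)//.
by rewrite ltr_pdivrMr// mulr_natr mulr2n ltrDl.
Qed.

Definition l2_hilbert : hilbert R := @Hilbert R l2 l2_dot l2_complete.

End L2.

(** * The inequality [norm_r <= norm_e] *)

Lemma hnormZ (R : realType) (H : hilbert R) (c : R[i]) (v : H) :
  hnorm (c *: v) = Num.sqrt (sqnorm c) * hnorm v.
Proof.
rewrite !hnormE /fnorm -sqrtrM ?sqnorm_ge0//; congr Num.sqrt.
rewrite hformJ /hform scalerA linearZr_LR /sqnorm /=; case: c (hdot H v v) => c d [e f] /=.
ring.
Qed.

Section RegularRep.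
Variables (R : realType) (G : topologicalType) (m : groupoid G) (x : G).
Local Notation C := R[i].
Local Notation r := (grange m).
Local Notation s := (gsource m).
Local Notation "a ** b" := (gmul m a b).
Local Notation inv := (ginv m).
Local Notation delta := (gdelta R (G := G)).

Lemma group_algebra_ind (P : (G -> C) -> Prop) : P 0 ->
  (forall c t b, isotropy m x t -> group_algebra m x b -> P b -> P (c *: delta t + b)) ->
  forall a, group_algebra m x a -> P a.
Proof.
move=> P0 PD a ga; rewrite (group_algebra_sum ga).
suff H (l : seq G) : (forall t, t \in l -> isotropy m x t) ->
    group_algebra m x (\sum_(t <- l) a t *: delta t) /\ P (\sum_(t <- l) a t *: delta t).
  apply: (proj2 (H _ _)) => t; rewrite in_fset_set ?inE; last exact: ga.1.
  exact: ga.2.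
elim: l => [|t l IH] hl; first by rewrite big_nil; split=> //; exact: group_algebra0.
have it : isotropy m x t by apply: hl; rewrite inE eqxx.
have [gl Pl] := IH (fun t' h => hl t' (mem_behead (s := t :: l) h)).
rewrite big_cons; split; last exact: PD.
by apply: group_algebra_subspace => //; exact: group_algebra_delta.
Qed.

(** The left regular representation is realized on l^2 of the whole of G, with functions cut down to
    the isotropy group: a zero summand is added, which leaves the operator norms unchanged. *)
Definition iso_part (V : zmodType) (f : G -> V) : G -> V := fun k =>
  if k \in isotropy m x then f k else 0.

Lemma iso_partE (V : zmodType) (f : G -> V) k : isotropy m x k -> iso_part f k = f k.
Proof. by move=> ik; rewrite /iso_part mem_set. Qed.

Lemma iso_part_out (V : zmodType) (f : G -> V) k : ~ isotropy m x k -> iso_part f k = 0.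
Proof. by move=> nk; rewrite /iso_part memNset. Qed.

Lemma iso_part_eq (V : zmodType) (f g : G -> V) : (forall k, isotropy m x k -> f k = g k) ->
  iso_part f = iso_part g.
Proof.
move=> e; apply/funext => k; have [ik|nk] := pselect (isotropy m x k).
  by rewrite !iso_partE ?e.
by rewrite !iso_part_out.
Qed.

Lemma bij_shift t : isotropy m x t ->
  set_bij (isotropy m x) (isotropy m x) (fun k => inv t ** k).
Proof.
move=> it; have iV := isotropyV it; split=> [k ik|k l /[!inE] ik il e|k ik].
- exact: isotropyM.
- have rt z : isotropy m x z -> r t = r z by move=> iz; rewrite [LHS]it.1 [RHS]iz.1.
  by rewrite -(gmulKVE (rt k ik)) e (gmulKVE (rt l il)).
- exists (t ** k); first exact: isotropyM.
  by rewrite gmulKE// (isoE it ik).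
Qed.

Lemma esum_iso_shift t (a : G -> R) : isotropy m x t ->
  (\esum_(k in [set: G]) (iso_part (fun k => a (inv t ** k)) k)%:E =
   \esum_(k in [set: G]) (iso_part a k)%:E)%E.
Proof.
move=> it; rewrite -!(@esum_widen _ _ [set: G] (isotropy m x))//; first last.
- by move=> k _ nk; rewrite iso_part_out.
- by move=> k _ nk; rewrite iso_part_out.
rewrite [RHS](reindex_esum _ _ _ _ (bij_shift it)); apply: eq_esum => k ik.
by rewrite !iso_partE//; apply: isotropyM => //; exact: isotropyV.
Qed.

Lemma rsum_iso_shift t (f : G -> R) : isotropy m x t ->
  rsum (iso_part (fun k => f (inv t ** k))) = rsum (iso_part f).
Proof.
move=> it.
have key (g : G -> R) : (fun k => Num.max (iso_part g k) 0) = iso_part (fun k => Num.max (g k) 0).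
  by apply/funext => k; rewrite /iso_part; case: ifP => // _; rewrite maxxx.
have keyN (g : G -> R) : (fun k => Num.max (- iso_part g k) 0) =
    iso_part (fun k => Num.max (- g k) 0).
  by apply/funext => k; rewrite /iso_part; case: ifP => // _; rewrite oppr0 maxxx.
rewrite /rsum !key !keyN /esum_real.
by rewrite (esum_iso_shift (fun k => Num.max (f k) 0) it)
  (esum_iso_shift (fun k => Num.max (- f k) 0) it).
Qed.

Definition iso_act (a xi : G -> C) : G -> C := iso_part (gact m a (xi : G -> C^o)).

Lemma iso_act_delta t xi : isotropy m x t ->
  iso_act (delta t) xi = iso_part (fun k => xi (inv t ** k)).
Proof.
move=> it; apply: iso_part_eq => k ik; rewrite -gconv_gact gconv_delta_l//.
by rewrite [LHS]ik.1 [RHS]it.1.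
Qed.

Lemma iso_act0 xi : iso_act 0 xi = 0.
Proof.
apply/funext => k; have [ik|nk] := pselect (isotropy m x k); last exact: iso_part_out.
by rewrite /iso_act iso_partE// /gact fsbig1// => h _; rewrite scale0r.
Qed.

Lemma iso_act_linl c a b xi : group_algebra m x a -> group_algebra m x b ->
  iso_act (c *: a + b) xi = c *: iso_act a xi + iso_act b xi.
Proof.
move=> ga gb; apply/funext => k.
rewrite -[RHS]/(c *: iso_act a xi k + iso_act b xi k).
have [ik|nk] := pselect (isotropy m x k).
  by rewrite /iso_act !iso_partE// (gactDl _ _ (group_algebra_finite ga) (group_algebra_finite gb)).
by rewrite /iso_act !iso_part_out// scaler0 addr0.
Qed.

Lemma iso_act_linr c a xi eta : group_algebra m x a ->
  iso_act a (c *: xi + eta) = c *: iso_act a xi + iso_act a eta.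
Proof.
move=> ga; apply/funext => k; rewrite -[RHS]/(c *: iso_act a xi k + iso_act a eta k).
have [ik|nk] := pselect (isotropy m x k).
  rewrite /iso_act !iso_partE//.
  by rewrite -[c *: xi + eta]/(c *: (xi : G -> C^o) + eta) (gactDr _ _ _ (group_algebra_finite ga)).
by rewrite /iso_act !iso_part_out// scaler0 addr0.
Qed.

Lemma iso_act_mul a b xi : group_algebra m x a -> group_algebra m x b ->
  iso_act (gconv m a b) xi = iso_act a (iso_act b xi).
Proof.
move=> ga gb; apply: iso_part_eq => k ik.
rewrite (gactM _ (group_algebra_finite ga) (group_algebra_finite gb)).
apply: eq_fsbigr => h /[!inE] rh; have [ah0|ah0] := eqVneq (a h) 0.
  by rewrite ah0 !scale0r.
congr (_ *: _); rewrite /iso_act iso_partE//.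
by apply: isotropyM => //; apply: isotropyV; exact: ga.2.
Qed.

Lemma sqnorm_iso_part (f : G -> C) :
  (fun k => sqnorm (iso_part f k)) = iso_part (fun k => sqnorm (f k)).
Proof. by apply/funext => k; rewrite /iso_part; case: ifP => // _; rewrite sqnorm0. Qed.

Lemma iso_act_deltaE t xi : isotropy m x t ->
  (\esum_(k in [set: G]) (sqnorm (iso_act (delta t) xi k))%:E <=
   \esum_(k in [set: G]) (sqnorm (xi k))%:E)%E.
Proof.
move=> it; rewrite iso_act_delta//.
have -> : (\esum_(k in [set: G]) (sqnorm (iso_part (fun k => xi (inv t ** k)) k))%:E =
    \esum_(k in [set: G]) (iso_part (fun k => sqnorm (xi (inv t ** k))) k)%:E)%E.
  by apply: eq_esum => k _; rewrite -(sqnorm_iso_part (fun k => xi (inv t ** k))).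
rewrite (esum_iso_shift (fun k => sqnorm (xi k)) it); apply: le_esum => k _.
by rewrite lee_fin /iso_part; case: ifP => // _; exact: sqnorm_ge0.
Qed.

Lemma summable_iso_act a xi : group_algebra m x a -> square_summable xi ->
  square_summable (iso_act a xi).
Proof.
move=> ga sx; elim/group_algebra_ind: a / ga => [|c t b it gb sb].
  by rewrite iso_act0; exact: square_summable0.
have gt : group_algebra m x (delta t) by exact: group_algebra_delta.
rewrite iso_act_linl//; apply: square_summableL => //.
rewrite /square_summable /summable_real.
have e (f : G -> C) : (\esum_(k in [set: G]) (`|sqnorm (f k)|)%:E =
    \esum_(k in [set: G]) (sqnorm (f k))%:E)%E.
  by apply: eq_esum => k _; rewrite ger0_norm ?sqnorm_ge0.
by rewrite e; apply: le_lt_trans (iso_act_deltaE _ it) _; rewrite -e.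
Qed.

Definition left_regular (a : G -> C) (u : l2_hilbert R G) : l2_hilbert R G :=
  if pselect (square_summable (iso_act a (l2_fun u))) is left h then mk_l2 h else 0.

Lemma left_regularE a u : group_algebra m x a ->
  l2_fun (left_regular a u) = iso_act a (l2_fun u).
Proof.
move=> ga; rewrite /left_regular; case: pselect => // nh; case: nh.
by apply: summable_iso_act => //; exact: l2P.
Qed.

Lemma l2_norm2 (u : l2 R G) : l2_norm u ^+ 2 = esum_real (fun i => sqnorm (l2_fun u i)).
Proof.
by rewrite /l2_norm l2_dotE sqr_sqrtr//; apply: esum_real_ge0 => i; exact: sqnorm_ge0.
Qed.

Lemma left_regular_lin c a b u : group_algebra m x a -> group_algebra m x b ->
  left_regular (c *: a + b) u = c *: left_regular a u + left_regular b u.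
Proof.
move=> ga gb; apply: l2_ext => k; rewrite l2_linE !left_regularE//.
  by rewrite iso_act_linl.
exact: group_algebra_subspace.
Qed.

Lemma left_regular_bounded a : group_algebra m x a ->
  exists M : R, forall u, hnorm (left_regular a u) <= M * hnorm u.
Proof.
move=> ga; have hs := hform_space (l2_hilbert R G).
elim/group_algebra_ind: a / ga => [|c t b it gb [M hM]].
  exists 0 => u; have -> : left_regular 0 u = 0.
    by apply: l2_ext => k; rewrite left_regularE ?iso_act0//; exact: group_algebra0.
  by rewrite mul0r hnormE (fnorm0 hs).
have gt : group_algebra m x (delta t) by exact: group_algebra_delta.
have ht u : hnorm (left_regular (delta t) u) <= hnorm u.
  rewrite -ler_sqr ?nnegrE ?sqrtr_ge0//.
  rewrite -[hnorm u]/(l2_norm u) -[hnorm _]/(l2_norm (left_regular (delta t) u)) !l2_norm2.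
  rewrite -lee_fin -!esum_realE; try exact: l2P; try by move=> i; exact: sqnorm_ge0.
  by rewrite left_regularE//; exact: iso_act_deltaE.
have hK := @hnormZ R (l2_hilbert R G) c; set K := Num.sqrt (sqnorm c) in hK.
exists (K + M) => u; rewrite left_regular_lin// mulrDl.
apply: le_trans (fnormD hs (I : setT _) (I : setT _)) _; apply: lerD; last exact: hM.
by rewrite -hnormE hK; apply: ler_wpM2l; [exact: sqrtr_ge0|exact: ht].
Qed.

Lemma left_regular_delta_adj t (u v : l2_hilbert R G) : isotropy m x t ->
  l2_dot (left_regular (delta t) u) v = l2_dot u (left_regular (delta (inv t)) v).
Proof.
move=> it; have iV := isotropyV it.
have gt : group_algebra m x (delta t) by exact: group_algebra_delta.
have gtV : group_algebra m x (delta (inv t)) by exact: group_algebra_delta.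
(* The shift k -> t^-1 k in the sum, proved once for [p] and then applied to the real and the
   imaginary parts of the inner product. *)
have key (p : C -> R) : p 0 = 0 ->
    rsum (fun k => p (l2_fun (left_regular (delta t) u) k * (l2_fun v k)^*)) =
    rsum (fun k => p (l2_fun u k * (l2_fun (left_regular (delta (inv t)) v) k)^*)).
  move=> p0; rewrite !left_regularE// !iso_act_delta// ginvK.
  transitivity (rsum (iso_part (fun k => p (l2_fun u (inv t ** k) *
      (l2_fun v (t ** (inv t ** k)))^*)))).
    congr rsum; apply/funext => k; have [ik|nk] := pselect (isotropy m x k).
      by rewrite !iso_partE// gmulKVE// [LHS]it.1 [RHS]ik.1.
    by rewrite !iso_part_out// mul0r p0.
  rewrite (rsum_iso_shift (fun k => p (l2_fun u k * (l2_fun v (t ** k))^*)) it).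
  congr rsum; apply/funext => k; have [ik|nk] := pselect (isotropy m x k).
    by rewrite !iso_partE.
  by rewrite !iso_part_out// conjC0 mulr0 p0.
by rewrite /l2_dot (key (@complex.Re R))// (key (@complex.Im R)).
Qed.

Lemma group_algebra_star (a : G -> C) : group_algebra m x a -> group_algebra m x (fstar m a).
Proof.
move=> [fa ia]; have sub g : fstar m a g != 0 -> a (inv g) != 0.
  by apply: contraNneq => a0; rewrite /fstar a0 conjC0.
split.
  apply: sub_finite_set (finite_image inv fa) => g /sub ag.
  by exists (inv g) => //; rewrite ginvK.
by move=> g /sub/ia; rewrite isotropyVE.
Qed.

Lemma left_regular_adj a (u v : l2_hilbert R G) : group_algebra m x a ->
  l2_dot (left_regular a u) v = l2_dot u (left_regular (fstar m a) v).
Proof.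
move=> ga; elim/group_algebra_ind: a / ga => [|c t b it gb IH].
  have g0 : group_algebra m x (0 : G -> C) by exact: group_algebra0.
  have -> : fstar m (0 : G -> C) = 0 by apply/funext => g; rewrite /fstar conjC0.
  have z w : left_regular 0 w = 0 :> l2 R G.
    by apply: l2_ext => k; rewrite left_regularE ?iso_act0.
  by rewrite !z linear0l linear0r.
have gt : group_algebra m x (delta t) by exact: group_algebra_delta.
have -> : fstar m (c *: delta t + b) = c^* *: fstar m (delta t) + fstar m b.
  by apply/funext => g; rewrite /fstar /= !fctE rmorphD rmorphM.
rewrite !left_regular_lin//; try exact: group_algebra_star.
rewrite l2_dotL l2_dotR IH left_regular_delta_adj// fstar_delta.
by rewrite conjCK.
Qed.

Lemma left_regular_rep : isotropy_rep m x left_regular.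
Proof.
split.
- move=> a ga c u v; apply: l2_ext => k; rewrite l2_linE !left_regularE//.
  by rewrite -[l2_fun (c *: u + v)]/(c *: l2_fun u + l2_fun v) iso_act_linr.
- exact: left_regular_bounded.
- by move=> c a b ga gb u; exact: left_regular_lin.
- move=> a b ga gb u; apply: val_inj => /=; rewrite [RHS]left_regularE// [in RHS]left_regularE//.
  rewrite -iso_act_mul// /left_regular; case: pselect => //= nh; case: nh.
  by rewrite iso_act_mul//; apply: summable_iso_act => //; apply: summable_iso_act => //; exact: l2P.
- by move=> a ga u v; exact: left_regular_adj.
Qed.

End RegularRep.

(** * Compactly supported functions have finite support on fibers *)

Section CompactSupport.
Variables (R : realType) (G : topologicalType) (m : groupoid G).
Local Notation C := R[i].
Local Notation r := (grange m).
Local Notation s := (gsource m).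
Hypothesis lcE : lc_etale_groupoid m.

Lemma etale_range_inj g : exists W, [/\ open W, W g & forall h k, W h -> W k -> r h = r k -> h = k].
Proof.
have [W [oW Wg _ [_ [f' [f'K _]]]]] := etale_range lcE g; exists W; split=> // h k Wh Wk e.
by rewrite -(f'K h Wh) e f'K.
Qed.

Lemma etale_source_inj g : exists W, [/\ open W, W g & forall h k, W h -> W k -> s h = s k -> h = k].
Proof.
have [W [oW Wg Wi]] := etale_range_inj (ginv m g); exists (ginv m @^-1` W); split=> //.
  by apply: open_comp => // h _; exact: (etale_inv lcE).
by move=> h k Wh Wk e; apply: (@ginv_inj _ m); apply: Wi; rewrite ?grangeV.
Qed.

(** Were the set infinite, the filter of sets containing all but finitely many of its points would
    cluster at some p in [K]; but a neighbourhood of p on which f is injective contains at most one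
    of them. *)
Lemma compact_fiber_finite (f : G -> G) (K : set G) z : compact K ->
  (forall g, exists W, [/\ open W, W g & forall h k, W h -> W k -> f h = f k -> h = k]) ->
  finite_set [set h | f h = z /\ K h].
Proof.
move=> cK inj; set S := [set h | _]; apply: contrapT => infS.
pose F : set_system G := [set A | finite_set (S `\` A)].
have pF : ProperFilter F.
  split; first by rewrite /F /= setD0.
  split.
  - by rewrite /F /= setDT; exact: finite_set0.
  - by move=> A B FA FB; rewrite /F /= setDIr finite_setU.
  - by move=> A B AB FA; apply: sub_finite_set FA => h [Sh nB]; split=> // /AB.
have FK : F K.
  by rewrite /F /=; have -> : S `\` K = set0 by apply/seteqP; split=> // h [[_ Kh] /(_ Kh)].
have [p [_ cp]] := cK F pF FK; have [W [oW Wp Wi]] := inj p.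
have FW : F (~` (S `&` W)).
  rewrite /F /= setDE setCK setIA setIid.
  have [->|/set0P[h [[fh _] Wh]]] := eqVneq (S `&` W) set0; first exact: finite_set0.
  apply: (sub_finite_set _ (finite_set1 h)) => k [[fk _] Wk] /=.
  by apply: Wi; rewrite ?fh.
have FS : F (S `&` ~` (S `&` W)).
  rewrite /F /= setDIr setDv set0U; exact: FW.
have [q [[Sq nq] Wq]] := cp _ _ FS (open_nbhs_nbhs (conj oW Wp)).
by apply: nq.
Qed.

Lemma Cc_on_finite (U : set G) (F : G -> C) : Cc_on U F -> fiber_finite m F.
Proof.
move=> [_ F0 cK] z; have sub (p : G -> G) :
    [set h | p h = z /\ F h <> 0] `<=` [set h | p h = z /\ (U `&` closure [set g | F g != 0]) h].
  move=> h [ph Fh]; split=> //; split.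
    by apply: contrapT => /F0.
  by apply: subset_closure; exact/eqP.
by split; apply: sub_finite_set (sub _) _; apply: compact_fiber_finite => // g;
  [exact: etale_range_inj|exact: etale_source_inj].
Qed.

Lemma Cc_finite : Cc (G := G) (R := R) `<=` fiber_finite m.
Proof.
move=> _ [n [c [F [hF ->]]]]; apply: big_ind => [|f g ff fg|i _].
- exact: fiber_finite0.
- by rewrite -[f]scale1r; exact: fiber_finite_lin.
- rewrite -[_ *: _]addr0; apply: fiber_finite_lin; last exact: fiber_finite0.
  by have [U [_ _ hU]] := hF i; exact: Cc_on_finite hU.
Qed.

End CompactSupport.

(** * The representation induced from the left regular one *)

Section LowerBound.
Variables (R : realType) (G : topologicalType) (m : groupoid G) (x : G).
Local Notation C := R[i].
Local Notation r := (grange m).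
Local Notation s := (gsource m).
Local Notation "a ** b" := (gmul m a b).
Local Notation H := (l2_hilbert R G).
Hypothesis ux : gunits m x.
Local Notation lambda := (@left_regular R G m x).

Lemma esum_iso_l2 (w : H) (eta : G -> C) : l2_fun w = iso_part m x eta ->
  (\esum_(t in isotropy m x) (sqnorm (eta t))%:E = ((hnorm w) ^+ 2)%:E)%E.
Proof.
move=> we; have sw := l2P w; rewrite -[hnorm w]/(l2_norm w) l2_norm2 -esum_realE//; last first.
  by move=> i; exact: sqnorm_ge0.
rewrite -[RHS](@esum_widen _ _ [set: G] (isotropy m x))//.
  by apply: eq_esum => t it; rewrite we iso_partE.
by move=> t _ nt; rewrite we iso_part_out// sqnorm0.
Qed.

(* [eta] represents the element [xi] of the induced space through the identification
   of the functions from [G_x] to l^2 of the isotropy group with l^2 of [G_x]. *)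
Definition untwists (xi : G -> H) (eta : G -> C) : Prop := forall g, gfiber_s m x g ->
  l2_fun (xi g) = iso_part m x (fun t => eta (g ** t)).

(** By equivariance xi(g t) is u_t^* applied to xi(g), whose value at x is xi(g)(t). So the values
    at x alone determine xi. *)
Lemma untwists_ind xi : ind_space m x lambda xi -> untwists xi (fun g => l2_fun (xi g) x).
Proof.
move=> [_ xiM] g sg; have E t k : isotropy m x t -> l2_fun (xi (g ** t)) k =
    iso_part m x (fun k => l2_fun (xi g) (t ** k)) k.
  move=> it; have iV := isotropyV it; rewrite xiM// fstar_delta left_regularE//.
    by rewrite iso_act_delta// ginvK.
  exact: group_algebra_delta.
apply/funext => k; have [ik|nk] := pselect (isotropy m x k); last first.
  rewrite iso_part_out//; have := E x k (isotropy1 ux).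
  by rewrite isotropy_mulg1// iso_part_out.
by rewrite iso_partE// E// iso_partE ?isotropy_mulg1//; [exact: ik.2|exact: isotropy1].
Qed.

Lemma untwists_Ind f xi eta : fiber_finite m f -> untwists xi eta ->
  untwists (Ind m f xi) (gact m f (eta : G -> C^o)).
Proof.
move=> ff xe g sg; apply/funext => k.
rewrite -[Ind m f xi g]/(gact m f xi g) gactE.
rewrite (@fsum_morph _ _ _ (fun u : H => l2_fun u k))//; last first.
  by apply: fiber_finite_row_act.
have kE l : s l = s g -> l2_fun (f (gdiv m g l) *: xi l) k =
    f (gdiv m g l) * iso_part m x (fun t => eta (l ** t)) k.
  by move=> sl; rewrite -xe //; exact: etrans sl sg.
have [ik|nk] := pselect (isotropy m x k); last first.
  rewrite iso_part_out// fsbig1// => l sl.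
  by rewrite kE// iso_part_out// mulr0.
have e : s g = r k by rewrite [LHS]sg [RHS]ik.1.
rewrite iso_partE// gactE (gsourceM e).
have bij := bij_mulr_fiber m k; rewrite -e in bij.
rewrite (reindex_fsbig _ _ _ _ bij); apply: eq_fsbigr => l /[!inE] sl.
rewrite kE// iso_partE//; congr (f _ * _).
rewrite gdiv_mulr; last by rewrite [LHS]sl.
  by rewrite gmulEK.
by rewrite gsourceM.
Qed.

(** The fiber G_x is the disjoint union of the cosets of the isotropy group, and on the coset of g
    the sum of |eta|^2 is |xi(g)|^2. *)
Lemma untwists_norm xi eta : untwists xi eta -> ind_l2norm m x xi = l2norm (gfiber_s m x) eta.
Proof.
move=> xe; rewrite /ind_l2norm /l2norm; congr (_ `^ _)%E.
rewrite (eq_esum (b := fun g => (sqnorm (eta g))%:E)) => [|g _]; last first.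
  by rewrite Re_norm_sqr.
rewrite [RHS](@esum_partition _ _ _ _ (isotropy_cosets m x) id (coset m x)).
- apply: eq_esum => _ [g0 sg0 <-].
  have [sg eg] := coset_fiber sg0 (coset_xget ux sg0).
  rewrite -/(coset m x g0); move: (xget x _) sg eg => g sg <-.
  rewrite -(esum_iso_l2 (xe g sg)) [RHS](reindex_esum (isotropy m x) _ (fun t => g ** t))//.
  split=> [t it|t u /[!inE] it iu e|_ [t it <-]]; [by exists t| |by exists t].
  by apply: (gmul_cancell _ _ e); rewrite [LHS]sg ?[RHS]it.1 ?[RHS]iu.1.
- by move=> _ g [g0 sg0 <-] /(coset_fiber sg0)[].
- by move=> g sg; split; [exists g|exact: coset_in].
- by move=> g _; rewrite lee_fin sqnorm_ge0.
Qed.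

(** Untwisting is isometric and intertwines the two actions, so the norm in the induced
    representation is at most the one in the regular representation at x. This is why the induced
    representation factors through the reduced algebra. *)
Lemma Ind_norm_left_regular_le (f : G -> C) : fiber_finite m f ->
  (Ind_norm m x lambda f <= reduced_norm m f)%E.
Proof.
move=> ff; apply: (@le_trans _ _ (regular_norm m (gfiber_s m x) f)); last first.
  by apply: ereal_sup_ubound; exists x.
apply: ge_ereal_sup => _ [xi [ixi xi1] <-].
have xe := untwists_ind ixi; rewrite (untwists_norm (untwists_Ind ff xe)).
rewrite (untwists_norm xe) in xi1; set eta := (fun g => _) in xe xi1 *.
have eta0 g : ~ gfiber_s m x g -> eta g = 0 by move=> ng; rewrite /eta ixi.1.
apply: ereal_sup_ubound; exists eta => //.
rewrite /l2norm; congr (_ `^ _)%E; apply: eq_esum => g sg.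
by rewrite (regularE ff (subset_refl _) eta0 sg).
Qed.

Lemma Ind_norm_left_regular_ge0 (f : G -> C) : (0 <= Ind_norm m x lambda f)%E.
Proof.
apply: (@le_trans _ _ (ind_l2norm m x (Ind m f (0 : G -> H)))); first exact: poweR_ge0.
apply: ereal_sup_ubound; exists 0 => //; split.
  split=> // g h _ ih; have gV : group_algebra m x (fstar m (gdelta R h)).
    by rewrite fstar_delta; apply: group_algebra_delta; exact: isotropyV.
  have := rep_oplinear (left_regular_rep R m x) gV (-1) 0 0.
  by rewrite !scaleN1r !addNr => ->.
rewrite /ind_l2norm poweR12_le ?ler01//; last first.
  by apply: esum_ge0 => c _; rewrite lee_fin sqr_ge0.
rewrite esum1 ?lee_fin ?sqr_ge0// => c _; rewrite hnormE (fnorm0 (hform_space H)).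
by rewrite expr0n.
Qed.

Lemma factors_left_regular : lc_etale_groupoid m ->
  factors_through_reduced m (Ind_norm m x lambda).
Proof.
move=> lcE a [[Ca _] a0]; apply: (squeeze_cvge _ (cvg_cst 0%E) a0).
apply: nearW => n; rewrite Ind_norm_left_regular_ge0 Ind_norm_left_regular_le//.
by apply: (Cc_finite lcE).
Qed.

Lemma norm_r_le_e (h : G -> C) : lc_etale_groupoid m -> group_algebra m x h ->
  (norm_r m x h <= norm_e m x h)%E.
Proof.
move=> lcE gh; apply: (@le_trans _ _ (hopnorm (lambda h))); last first.
  apply: ereal_sup_ubound; exists H, lambda; split=> //; first exact: left_regular_rep.
  exact: factors_left_regular.
apply: ge_ereal_sup => _ [zeta [z0 z1] <-].
have hf := group_algebra_finite gh.
have ze : zeta = iso_part m x zeta.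
  apply/funext => k; have [ik|nk] := pselect (isotropy m x k); first by rewrite iso_partE.
  by rewrite iso_part_out// z0.
have szeta : square_summable zeta.
  rewrite l2norm_le ?ler01// expr1n in z1; apply: le_lt_trans (ltey 1).
  apply: le_trans z1; rewrite -(@esum_widen _ _ [set: G] (isotropy m x))//.
    by apply: le_esum => k _; rewrite ger0_norm ?sqnorm_ge0.
  by move=> k _ nk; rewrite z0// sqnorm0 normr0.
pose u : H := mk_l2 szeta.
have uE : (\esum_(t in isotropy m x) (sqnorm (zeta t))%:E = ((hnorm u) ^+ 2)%:E)%E.
  exact: esum_iso_l2.
have u1 : ((hnorm u)%:E <= 1)%E.
  rewrite l2norm_le ?ler01// uE lee_fin in z1.
  by rewrite lee_fin -ler_sqr ?nnegrE ?sqrtr_ge0 ?ler01.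
apply: le_trans (ereal_sup_ubound _); last first.
  by exists u; [split|reflexivity].
rewrite l2norm_le ?sqrtr_ge0//.
have IG : isotropy m x `<=` gfiber_s m x by move=> t [].
rewrite (eq_esum (b := fun k => (sqnorm (gact m h (zeta : G -> C^o) k))%:E)) => [|k ik].
  by rewrite (esum_iso_l2 (left_regularE u gh)).
by rewrite (regularE hf IG z0 ik.2).
Qed.

End LowerBound.

Theorem theorem4p11 (R : realType) (G : topologicalType) (m : groupoid G)
    (Gam : groupType) (Phi : G -> Gam) (x : G) (U : G -> set G) :
  lc_etale_groupoid m ->
  grading m Phi ->
  gunits m x ->
  (forall g h, isotropy m x g -> isotropy m x h -> Phi g = Phi h -> g = h) ->
  (forall g, isotropy m x g -> bisection m (U g)) ->
  (forall g, isotropy m x g -> U g g /\ Phi @` U g = [set Phi g]) ->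
  U x = gunits m ->
  (forall g, isotropy m x g -> U (ginv m g) = gsetinv m (U g)) ->
  (forall g gs, isotropy m x g -> (forall h, h \in gs -> isotropy m x h) ->
     gprod m g gs = x -> gsetprod m U g gs `<=` gunits m) ->
  forall h : G -> R[i], group_algebra m x h ->
    norm_e m x h = norm_r m x h.
Proof.
move=> lcE [_ grad] ux Phi_inj bU UP Ux UV Uprod h gh.
apply/eqP; rewrite eq_le norm_r_le_e// andbT.
(* The unit space is U_x, and a bisection is open. *)
have Uopen : open (gunits m) by rewrite -Ux; case: (bU x (isotropy1 ux)).
have Phi_mul g k : gsource m g = grange m k -> Phi (gmul m g k) = (Phi g * Phi k)%g.
  by move=> /gcompP; exact: grad.
have PhiU g u : isotropy m x g -> U g u -> Phi u = Phi g.
  by move=> ig Uu; have : (Phi @` U g) (Phi u) by [exists u]; rewrite (UP g ig).2.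
have Ug g : isotropy m x g -> U g g by move=> /UP[].
have bU' g : isotropy m x g -> bisec m (U g) by move=> /bU; exact: bisection_bisec.
exact: (norm_e_le lcE Uopen Phi_mul ux Phi_inj bU' Ug PhiU Ux UV Uprod gh).
Qed.
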